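(* Let $R$ be a commutative artin ring and $A$ an $R$-algebra which is finitely generated as an $R$-module. Let $P^{\bullet} : P^{-1} \to P^{0}$ be a complex of finitely generated projective left $A$-modules concentrated in degrees $-1$ and $0$. The following are equivalent. (1) $P^{\bullet}$ is a tilting complex. (2) $\mathcal{X}_{c}(P^{\bullet}) \cap \mathcal{Y}_{c}(P^{\bullet}) = \{0\}$, $\operatorname{H}^{0}(P^{\bullet}) \in \mathcal{X}_{c}(P^{\bullet})$ and $\operatorname{H}^{-1}(P^{\bullet}) \in \mathcal{Y}_{c}(P^{\bullet})$. (3) $(\mathcal{X}_{c}(P^{\bullet}), \mathcal{Y}_{c}(P^{\bullet}))$ is a torsion theory for $\mathsf{mod}\,A$ and $\operatorname{H}^{-1}(P^{\bullet}) \in \mathcal{Y}_{c}(P^{\bullet})$. (4) $(\mathcal{X}_{c}(P^{\bullet}), \mathcal{Y}_{c}(P^{\bullet}))$ is a torsion theory for $\mathsf{mod}\,A$ and $\mathcal{X}_{c}(P^{\bullet})$ is stable under $DA \otimes_{A} -$. (5) $(\mathcal{X}_{c}(P^{\bullet}), \mathcal{Y}_{c}(P^{\bullet}))$ is a torsion theory for $\mathsf{mod}\,A$ and $\mathcal{Y}_{c}(P^{\bullet})$ is stable under $\operatorname{Hom}_{A}(DA, -)$.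
   Context: $\mathsf{Mod}\,A$ is the category of left $A$-modules, $\mathsf{mod}\,A$ its full subcategory of finitely generated modules, and $\mathsf{D}(\mathsf{Mod}\,A)$ the (unbounded) derived category; modules are regarded as complexes concentrated in degree $0$. $D = \operatorname{Hom}_{R}(-, I)$, where $I$ is an injective envelope of the $R$-module $R/\operatorname{rad}(R)$; $DA$ is an $A$-$A$-bimodule. $\mathcal{X}_{c}(P^{\bullet}) = \{X \in \mathsf{mod}\,A : \operatorname{Hom}_{\mathsf{D}(\mathsf{Mod}\,A)}(P^{\bullet}, X[1]) = 0\}$ and $\mathcal{Y}_{c}(P^{\bullet}) = \{X \in \mathsf{mod}\,A : \operatorname{Hom}_{\mathsf{D}(\mathsf{Mod}\,A)}(P^{\bullet}, X) = 0\}$. A pair $(\mathcal{X}, \mathcal{Y})$ of full subcategories of an abelian category $\mathcal{A}$ is a torsion theory for $\mathcal{A}$ if: (i) $\mathcal{X} \cap \mathcal{Y} = \{0\}$; (ii) $\mathcal{X}$ is closed under factor objects; (iii) $\mathcal{Y}$ is closed under subobjects; (iv) for any $X \in \mathcal{A}$ there is an exact sequence $0 \to X' \to X \to X'' \to 0$ in $\mathcal{A}$ with $X' \in \mathcal{X}$ and $X'' \in \mathcal{Y}$. A tilting complex for $A$ (in the sense of Rickard) is a bounded complex $T^{\bullet}$ of finitely generated projective $A$-modules such that $\operatorname{Hom}_{\mathsf{D}(\mathsf{Mod}\,A)}(T^{\bullet}, T^{\bullet}[i]) = 0$ for all $i \neq 0$ and the direct summands of finite direct sums of copies of $T^{\bullet}$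 generate $\mathsf{K}^{\mathrm{b}}(\mathsf{proj}\,A)$ (the homotopy category of bounded complexes of finitely generated projective modules) as a triangulated category. *)

(* Defs.v *)
From HB Require Import structures.
From mathcomp Require Import all_boot all_algebra.
From mathcomp Require Import boolp.

Set Implicit Arguments.
Unset Strict Implicit.
Unset Printing Implicit Defensive.

Import GRing.Theory.
Local Open Scope ring_scope.
Local Open Scope quotient_scope.

(* Rings are [pzRingType]s, so that the zero ring is allowed; modules are
   left modules. *)

Section Modules.
Variable A : pzRingType.
Implicit Types M N P : lmodType A.

Definition surj (U V : Type) (f : U -> V) : Prop := forall y, exists x, f x = y.

Definition is_zero M : Prop := forall x : M, x = 0.

Definition fin_gen M : Prop :=
  exists (n : nat) (g : 'I_n -> M),
    forall x, exists c : 'I_n -> A, x = \sum_(i < n) c i *: g i.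

Definition is_projective P : Prop :=
  forall M N (g : {linear M -> N}) (f : {linear P -> N}),
    surj g -> exists h : {linear P -> M}, forall x, g (h x) = f x.

Definition is_injective P : Prop :=
  forall M N (g : {linear M -> N}) (f : {linear M -> P}),
    injective g -> exists h : {linear N -> P}, forall x, h (g x) = f x.

Definition injective_envelope M P (e : {linear M -> P}) : Prop :=
  [/\ is_injective P,
      injective e
    & forall S : {pred P}, submod_closed S ->
        (forall x, e x \in S -> x = 0) -> forall y, y \in S -> y = 0].

Definition short_exact M' M M'' (i : {linear M' -> M}) (p : {linear M -> M''}) :
    Prop :=
  [/\ injective i, surj p & forall x, p x = 0 <-> exists y, i y = x].

(* [C] is the ambient abelian category, a full subcategory of the modules. *)
Record torsion_theory (C X Y : lmodType A -> Prop) : Prop := TorsionTheory {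
  torsion_subl : forall M, X M -> C M;
  torsion_subr : forall M, Y M -> C M;
  torsion_cap : forall M, X M /\ Y M <-> is_zero M;
  torsion_quot : forall M N (f : {linear M -> N}),
    C N -> surj f -> X M -> X N;
  torsion_sub : forall M N (f : {linear M -> N}),
    C M -> injective f -> Y N -> Y M;
  torsion_seq : forall M, C M ->
    exists M' M'' (i : {linear M' -> M}) (p : {linear M -> M''}),
      [/\ X M', Y M'' & short_exact i p]
}.

End Modules.

Section QuotientModule.
Variables (A : pzRingType) (M : lmodType A).
Variables (S : {pred M}) (S_submod : submod_closed S).

Definition submod_zmodClosed : zmodClosed M :=
  let zS := GRing.isZmodClosed.Build M S (GRing.submod_closedB S_submod) in
  HB.pack_for (zmodClosed M) (S : M -> bool) zS.

Definition modquot : Type := Quotient.quot submod_zmodClosed.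

HB.instance Definition _ := GRing.Zmodule.on modquot.
HB.instance Definition _ := EqQuotient.on modquot.

Definition modpi (x : M) : modquot := \pi_modquot x.

Lemma modpi_repr (v : modquot) : modpi (repr v) = v.
Proof. exact: reprK. Qed.

Lemma modpi_surj (v : modquot) : exists x, modpi x = v.
Proof. by exists (repr v); exact: modpi_repr. Qed.

Lemma modpi_eq (x y : M) : (modpi x = modpi y) <-> (x - y \in S).
Proof.
have -> : (x - y \in S) = (modpi x == modpi y).
  exact: (Quotient.idealrBE submod_zmodClosed).
by split=> /eqP.
Qed.

Lemma modpiD (x y : M) : modpi (x + y) = modpi x + modpi y.
Proof. exact: (Quotient.pi_add submod_zmodClosed). Qed.

Definition modquot_scale (a : A) (v : modquot) : modquot := modpi (a *: repr v).

Lemma modquot_scaleE a (x : M) : modquot_scale a (modpi x) = modpi (a *: x).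
Proof.
apply/modpi_eq; rewrite -scalerBr -[_ *: _]addr0 S_submod.2 ?S_submod.1 //.
by apply/modpi_eq; rewrite modpi_repr.
Qed.

Fact modquot_scaleA a b v :
  modquot_scale a (modquot_scale b v) = modquot_scale (a * b) v.
Proof.
have [x <-] := modpi_surj v.
by rewrite (modquot_scaleE b) (modquot_scaleE a) modquot_scaleE scalerA.
Qed.

Fact modquot_scale1 : left_id 1 modquot_scale.
Proof. by move=> v; have [x <-] := modpi_surj v; rewrite modquot_scaleE scale1r. Qed.

Fact modquot_scaleDr : right_distributive modquot_scale +%R.
Proof.
move=> a u v; have [x <-] := modpi_surj u; have [y <-] := modpi_surj v.
by rewrite -modpiD !modquot_scaleE -modpiD scalerDr.
Qed.

Fact modquot_scaleDl v : {morph modquot_scale^~ v : a b / a + b}.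
Proof.
by have [x <-] := modpi_surj v => a b; rewrite !modquot_scaleE -modpiD scalerDl.
Qed.

HB.instance Definition _ := GRing.Zmodule_isLmodule.Build A modquot
  modquot_scaleA modquot_scale1 modquot_scaleDr modquot_scaleDl.

Fact modpi_linear : linear modpi.
Proof. by move=> a x y; rewrite modpiD -modquot_scaleE. Qed.
HB.instance Definition _ := GRing.isLinear.Build A M modquot *:%R modpi modpi_linear.

End QuotientModule.


Section Hom.
Variables (A : pzRingType) (U V : lmodType A).

Definition Hom : Type := {linear U -> V}.

HB.instance Definition _ := gen_eqMixin Hom.
HB.instance Definition _ := gen_choiceMixin Hom.

Lemma Hom_ext (f g : Hom) : (f : U -> V) =1 g -> f = g.
Proof.
move: f g => [f [[ff] [fs]]] [g [[gf] [gs]]] /= /funext fg; subst g.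
by congr GRing.Linear.Pack; congr GRing.Linear.Class; congr (_ _);
  exact: Prop_irrelevance.
Qed.

Definition Hom_zero : Hom := \0 : {linear U -> V}.
Definition Hom_opp (f : Hom) : Hom := \- (f : {linear U -> V}).
Definition Hom_add (f g : Hom) : Hom :=
  (f : {linear U -> V}) \+ (g : {linear U -> V}).

Fact Hom_addA : associative Hom_add.
Proof. by move=> f g h; apply: Hom_ext => x /=; rewrite addrA. Qed.
Fact Hom_addC : commutative Hom_add.
Proof. by move=> f g; apply: Hom_ext => x /=; rewrite addrC. Qed.
Fact Hom_add0 : left_id Hom_zero Hom_add.
Proof. by move=> f; apply: Hom_ext => x /=; rewrite add0r. Qed.
Fact Hom_addN : left_inverse Hom_zero Hom_opp Hom_add.
Proof. by move=> f; apply: Hom_ext => x /=; rewrite addNr. Qed.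

HB.instance Definition _ :=
  GRing.isZmodule.Build Hom Hom_addA Hom_addC Hom_add0 Hom_addN.

End Hom.

Section Bimodule.
Variable A : pzRingType.

Record bimodule := Bimodule {
  bimod_sort :> lmodType A;
  ract : bimod_sort -> A -> bimod_sort;
  ract1 : forall n, ract n 1 = n;
  ractM : forall n a b, ract n (a * b) = ract (ract n a) b;
  ractDl : forall n n' a, ract (n + n') a = ract n a + ract n' a;
  ractDr : forall n a b, ract n (a + b) = ract n a + ract n b;
  ractZ : forall a n b, ract (a *: n) b = a *: ract n b
}.

Section Tensor.
Variables (N : bimodule) (X : lmodType A).

(* A sequence [:: (n_1, x_1); ...] stands for the sum of the n_k (x) x_k. *)
Inductive tens_eq : seq (N * X) -> seq (N * X) -> Prop :=
| tens_refl s : tens_eq s s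
| tens_sym s t : tens_eq s t -> tens_eq t s
| tens_trans s t u : tens_eq s t -> tens_eq t u -> tens_eq s u
| tens_cat s s' t t' :
    tens_eq s s' -> tens_eq t t' -> tens_eq (s ++ t) (s' ++ t')
| tens_comm s t : tens_eq (s ++ t) (t ++ s)
| tens_zero x : tens_eq [:: (0, x)] [::]
| tens_addl n n' x : tens_eq [:: (n + n', x)] [:: (n, x); (n', x)]
| tens_addr n x x' : tens_eq [:: (n, x + x')] [:: (n, x); (n, x')]
| tens_bal n a x : tens_eq [:: (ract n a, x)] [:: (n, a *: x)].

Definition tens_eqb : rel (seq (N * X)) := fun s t => `[< tens_eq s t >].

Fact tens_eqb_equiv : equiv_class_of tens_eqb.
Proof.
split=> [s|s t|t s u]; first exact/asboolP/tens_refl.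
- by apply/asboolP/asboolP => /tens_sym.
- by move=> /asboolP st /asboolP tu; apply/asboolP/(tens_trans st tu).
Qed.

Canonical tens_equiv := EquivRelPack tens_eqb_equiv.
Canonical tens_encModRel := defaultEncModRel tens_eqb.

Definition tensor : Type := {eq_quot tens_eqb}.

HB.instance Definition _ := EqQuotient.on tensor.
HB.instance Definition _ := Choice.on tensor.

Definition tens_class (s : seq (N * X)) : tensor := \pi_tensor s.

Lemma tens_class_eq s t : (tens_class s = tens_class t) <-> tens_eq s t.
Proof.
split=> [/eqP|st]; first by rewrite /tens_class eqmodE => /asboolP.
by apply/eqP; rewrite /tens_class eqmodE; apply/asboolP.
Qed.

Lemma tens_class_surj v : exists s, tens_class s = v.
Proof. by exists (repr v); exact: reprK. Qed.

Let repr_eq s : tens_eq (repr (tens_class s)) s.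
Proof. by apply/tens_class_eq; exact: reprK. Qed.

Lemma tens_swap p q u v : tens_eq (p :: u ++ q :: v) ([:: p; q] ++ (u ++ v)).
Proof.
rewrite -cat_rcons -cats1 -cat1s -[[:: p; q]]/([:: p] ++ [:: q]) -!catA.
apply: tens_cat; first exact: tens_refl.
by rewrite !catA; apply: tens_cat; [exact: tens_comm|exact: tens_refl].
Qed.

Definition tens_opp_seq (s : seq (N * X)) := [seq (- p.1, p.2) | p <- s].
Definition tens_scale_seq a (s : seq (N * X)) := [seq (a *: p.1, p.2) | p <- s].

Lemma tens_opp_seq_eq s t :
  tens_eq s t -> tens_eq (tens_opp_seq s) (tens_opp_seq t).
Proof.
elim=> {s t} /=.
- by move=> s; exact: tens_refl.
- by move=> s t _; exact: tens_sym.
- by move=> s t u _ h _; exact: tens_trans.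
- by move=> s s' t t' _ h _ k; rewrite /tens_opp_seq !map_cat; exact: tens_cat.
- by move=> s t; rewrite /tens_opp_seq !map_cat; exact: tens_comm.
- by move=> x; rewrite oppr0; exact: tens_zero.
- by move=> n n' x; rewrite opprD; exact: tens_addl.
- by move=> n x x'; exact: tens_addr.
- move=> n a x; have -> : - ract n a = ract (- n) a.
    apply/esym/eqP; rewrite -addr_eq0 -ractDl addNr.
    by have := ractZ (0 : A) (0 : N) a; rewrite !scale0r => ->.
  exact: tens_bal.
Qed.

Lemma tens_scale_seq_eq a s t :
  tens_eq s t -> tens_eq (tens_scale_seq a s) (tens_scale_seq a t).
Proof.
elim=> {s t} /=.
- by move=> s; exact: tens_refl.
- by move=> s t _; exact: tens_sym.
- by move=> s t u _ h _; exact: tens_trans.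
- by move=> s s' t t' _ h _ k; rewrite /tens_scale_seq !map_cat; exact: tens_cat.
- by move=> s t; rewrite /tens_scale_seq !map_cat; exact: tens_comm.
- by move=> x; rewrite scaler0; exact: tens_zero.
- by move=> n n' x; rewrite scalerDr; exact: tens_addl.
- by move=> n x x'; exact: tens_addr.
- by move=> n b x; rewrite -ractZ; exact: tens_bal.
Qed.

Definition tens_add (u v : tensor) : tensor := tens_class (repr u ++ repr v).
Definition tens_opp (u : tensor) : tensor := tens_class (tens_opp_seq (repr u)).
Definition tens_scale a (u : tensor) : tensor :=
  tens_class (tens_scale_seq a (repr u)).

Lemma tens_addE s t :
  tens_add (tens_class s) (tens_class t) = tens_class (s ++ t).
Proof. by apply/tens_class_eq/tens_cat; exact: repr_eq. Qed.
Lemma tens_oppE s : tens_opp (tens_class s) = tens_class (tens_opp_seq s).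
Proof. by apply/tens_class_eq/tens_opp_seq_eq. Qed.
Lemma tens_scaleE a s :
  tens_scale a (tens_class s) = tens_class (tens_scale_seq a s).
Proof. by apply/tens_class_eq/tens_scale_seq_eq. Qed.

Fact tens_addA : associative tens_add.
Proof.
move=> u v w; have [s <-] := tens_class_surj u.
have [t <-] := tens_class_surj v; have [r <-] := tens_class_surj w.
by rewrite (tens_addE t) (tens_addE s) (tens_addE s) (tens_addE _ r) catA.
Qed.
Fact tens_addC : commutative tens_add.
Proof.
move=> u v; have [s <-] := tens_class_surj u.
have [t <-] := tens_class_surj v.
by rewrite (tens_addE s) (tens_addE t); apply/tens_class_eq/tens_comm.
Qed.
Fact tens_add0 : left_id (tens_class [::]) tens_add.
Proof. by move=> u; have [s <-] := tens_class_surj u; rewrite tens_addE. Qed.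
Fact tens_addN : left_inverse (tens_class [::]) tens_opp tens_add.
Proof.
move=> u; have [s <-] := tens_class_surj u.
rewrite tens_oppE tens_addE; apply/tens_class_eq.
elim: s => [|[n x] s IH] /=; first exact: tens_refl.
apply: (tens_trans (tens_swap _ _ _ _)); rewrite -[X in tens_eq _ X]cat0s.
apply: tens_cat => //; apply: (tens_trans (tens_sym (tens_addl (- n) n x))).
by rewrite addNr; exact: tens_zero.
Qed.

HB.instance Definition _ :=
  GRing.isZmodule.Build tensor tens_addA tens_addC tens_add0 tens_addN.

Fact tens_scaleA a b u : tens_scale a (tens_scale b u) = tens_scale (a * b) u.
Proof.
have [s <-] := tens_class_surj u.
rewrite (tens_scaleE b) (tens_scaleE a) tens_scaleE /tens_scale_seq -map_comp.
by congr tens_class; apply: eq_map => p /=; rewrite scalerA.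
Qed.
Fact tens_scale1 : left_id 1 tens_scale.
Proof.
move=> u; have [s <-] := tens_class_surj u; rewrite tens_scaleE; congr tens_class.
by rewrite -[RHS]map_id; apply: eq_map => -[n x] /=; rewrite scale1r.
Qed.
Fact tens_scaleDr : right_distributive tens_scale +%R.
Proof.
move=> a u v; have [s <-] := tens_class_surj u.
have [t <-] := tens_class_surj v; rewrite -[_ + _]/(tens_add _ _) tens_addE.
rewrite -[RHS]/(tens_add _ _) !tens_scaleE tens_addE.
by rewrite /tens_scale_seq map_cat.
Qed.
Fact tens_scaleDl u : {morph tens_scale^~ u : a b / a + b}.
Proof.
have [s <-] := tens_class_surj u => a b; rewrite -[RHS]/(tens_add _ _).
rewrite !tens_scaleE tens_addE; apply/tens_class_eq.
elim: s => [|[n x] s IH] /=; first exact: tens_refl.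
rewrite scalerDl -cat1s.
apply: (tens_trans (tens_cat (tens_addl _ _ _) IH)).
exact/tens_sym/tens_swap.
Qed.

HB.instance Definition _ := GRing.Zmodule_isLmodule.Build A tensor
  tens_scaleA tens_scale1 tens_scaleDr tens_scaleDl.

End Tensor.

Section HomLeft.
Variables (N : bimodule) (X : lmodType A).

(* Hom_A(N, X), with (a f)(n) = f(n a). *)
Definition bimod_hom : Type := Hom N X.

HB.instance Definition _ := GRing.Zmodule.on bimod_hom.

Definition bimod_hom_scale_fun (a : A) (f : bimod_hom) (n : N) : X :=
  (f : {linear N -> X}) (ract n a).

Fact bimod_hom_scale_linear a f : linear (bimod_hom_scale_fun a f).
Proof.
by move=> b n n'; rewrite /bimod_hom_scale_fun ractDl ractZ linearP.
Qed.

HB.instance Definition _ a f :=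
  GRing.isLinear.Build A N X *:%R (bimod_hom_scale_fun a f)
    (bimod_hom_scale_linear a f).

Definition bimod_hom_scale a f : bimod_hom :=
  bimod_hom_scale_fun a f : {linear N -> X}.

Fact bimod_hom_scaleA a b f :
  bimod_hom_scale a (bimod_hom_scale b f) = bimod_hom_scale (a * b) f.
Proof. by apply: Hom_ext => n /=; rewrite /bimod_hom_scale_fun /= ractM. Qed.
Fact bimod_hom_scale1 : left_id 1 bimod_hom_scale.
Proof. by move=> f; apply: Hom_ext => n /=; rewrite /bimod_hom_scale_fun ract1. Qed.
Fact bimod_hom_scaleDr : right_distributive bimod_hom_scale +%R.
Proof. by move=> a f g; apply: Hom_ext. Qed.
Fact bimod_hom_scaleDl f : {morph bimod_hom_scale^~ f : a b / a + b}.
Proof.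
move=> a b; apply: Hom_ext => n /=.
by rewrite /bimod_hom_scale_fun ractDr linearD.
Qed.

HB.instance Definition _ := GRing.Zmodule_isLmodule.Build A bimod_hom
  bimod_hom_scaleA bimod_hom_scale1 bimod_hom_scaleDr bimod_hom_scaleDl.

End HomLeft.

End Bimodule.

(* [algType R] would exclude the zero algebra. *)
Record algebra_over (R : comPzRingType) (A : pzRingType) := AlgebraOver {
  scalar_map :> {rmorphism R -> A};
  scalar_map_central : forall r a, scalar_map r * a = a * scalar_map r
}.

Section Restriction.
Variables (R : comPzRingType) (A : pzRingType) (alg : algebra_over R A).
Variable M : lmodType A.

Definition restr (_ : algebra_over R A) : Type := M.
Local Notation restrM := (restr alg).

HB.instance Definition _ := GRing.Zmodule.on restrM.

Definition restr_scale (r : R) (x : restrM) : restrM := alg r *: (x : M).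

Fact restr_scaleA r s x :
  restr_scale r (restr_scale s x) = restr_scale (r * s) x.
Proof. by rewrite /restr_scale scalerA rmorphM. Qed.
Fact restr_scale1 : left_id 1 restr_scale.
Proof. by move=> x; rewrite /restr_scale rmorph1 scale1r. Qed.
Fact restr_scaleDr : right_distributive restr_scale +%R.
Proof. by move=> r x y; rewrite /restr_scale scalerDr. Qed.
Fact restr_scaleDl x : {morph restr_scale^~ x : r s / r + s}.
Proof. by move=> r s; rewrite /restr_scale rmorphD scalerDl. Qed.

HB.instance Definition _ := GRing.Zmodule_isLmodule.Build R restrM
  restr_scaleA restr_scale1 restr_scaleDr restr_scaleDl.

End Restriction.

Arguments restr {R A} M alg.

Section Dual.
Variables (R : comPzRingType) (A : pzRingType) (alg : algebra_over R A).
Variable I : lmodType R.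
Local Notation AR := (restr A^o alg).

(* The elements of Hom_R(A, I), with (a f b)(x) = f(b x a). *)
Definition dual_alg : Type := Hom AR I.

HB.instance Definition _ := GRing.Zmodule.on dual_alg.

Section Actions.
Variables (a : A) (f : dual_alg).

Definition dual_lact_fun (x : AR) : I :=
  (f : {linear AR -> I}) ((x : A) * a : A).
Definition dual_ract_fun (x : AR) : I :=
  (f : {linear AR -> I}) (a * (x : A) : A).

Fact dual_lact_linear : linear dual_lact_fun.
Proof.
move=> r x y; rewrite /dual_lact_fun -linearP; congr (_ _).
by rewrite -[LHS]/((alg r * (x : A) + y) * a) mulrDl -mulrA.
Qed.
Fact dual_ract_linear : linear dual_ract_fun.
Proof.
move=> r x y; rewrite /dual_ract_fun -linearP; congr (_ _).
rewrite -[LHS]/(a * (alg r * (x : A) + y)) mulrDr !mulrA.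
by rewrite -scalar_map_central -mulrA.
Qed.

HB.instance Definition _ :=
  GRing.isLinear.Build R AR I *:%R dual_lact_fun dual_lact_linear.
HB.instance Definition _ :=
  GRing.isLinear.Build R AR I *:%R dual_ract_fun dual_ract_linear.

Definition dual_lact : dual_alg := dual_lact_fun : {linear AR -> I}.
Definition dual_ract : dual_alg := dual_ract_fun : {linear AR -> I}.
End Actions.

Fact dual_lactA a b f : dual_lact a (dual_lact b f) = dual_lact (a * b) f.
Proof. by apply: Hom_ext => x /=; rewrite /dual_lact_fun /= /dual_lact_fun mulrA. Qed.
Fact dual_lact1 : left_id 1 dual_lact.
Proof. by move=> f; apply: Hom_ext => x /=; rewrite /dual_lact_fun mulr1. Qed.
Fact dual_lactDr : right_distributive dual_lact +%R.
Proof. by move=> a f g; apply: Hom_ext. Qed.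
Fact dual_lactDl f : {morph dual_lact^~ f : a b / a + b}.
Proof.
by move=> a b; apply: Hom_ext => x /=; rewrite /dual_lact_fun mulrDr linearD.
Qed.

HB.instance Definition _ := GRing.Zmodule_isLmodule.Build A dual_alg
  dual_lactA dual_lact1 dual_lactDr dual_lactDl.

Fact dual_ract1 (f : dual_alg) : dual_ract 1 f = f.
Proof. by apply: Hom_ext => x /=; rewrite /dual_ract_fun mul1r. Qed.
Fact dual_ractM (f : dual_alg) a b :
  dual_ract (a * b) f = dual_ract b (dual_ract a f).
Proof. by apply: Hom_ext => x /=; rewrite /dual_ract_fun /= /dual_ract_fun mulrA. Qed.
Fact dual_ractDl (f g : dual_alg) a :
  dual_ract a (f + g) = dual_ract a f + dual_ract a g.
Proof. exact: Hom_ext. Qed.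
Fact dual_ractDr (f : dual_alg) a b :
  dual_ract (a + b) f = dual_ract a f + dual_ract b f.
Proof. by apply: Hom_ext => x /=; rewrite /dual_ract_fun mulrDl linearD. Qed.
Fact dual_ractZ a (f : dual_alg) b :
  dual_ract b (a *: f) = a *: dual_ract b f.
Proof.
by apply: Hom_ext => x; rewrite /= /dual_ract_fun /= /dual_lact_fun mulrA.
Qed.

Definition dual_bimod : bimodule A :=
  @Bimodule A dual_alg (fun f a => dual_ract a f)
    dual_ract1 dual_ractM dual_ractDl dual_ractDr dual_ractZ.

End Dual.

Section CommutativeRings.
Variable R : comPzRingType.

Definition artinian : Prop :=
  forall J : nat -> {pred R^o},
    (forall n, submod_closed (J n)) ->
    (forall n, {subset J n.+1 <= J n}) ->
    exists n, forall m, (n <= m)%N -> J m =i J n.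

Definition maximal_ideal (m : {pred R^o}) : Prop :=
  [/\ submod_closed m, 1 \notin m
    & forall n : {pred R^o}, submod_closed n -> 1 \notin n ->
        {subset m <= n} -> {subset n <= m}].

Definition rad : {pred R^o} :=
  fun x => `[< forall m, maximal_ideal m -> x \in m >].

Fact rad_submod : submod_closed rad.
Proof.
split; first by apply/asboolP => m [[]].
move=> a x y /asboolP xr /asboolP yr; apply/asboolP => m mm.
by have [[_ mS] _ _] := mm; apply: mS; [exact: xr | exact: yr].
Qed.

Definition residue_mod : lmodType R := modquot rad_submod.

End CommutativeRings.

Section Complexes.
Variable A : pzRingType.

(* The differential [diff i j] goes from degree i to degree j, and vanishes
   unless j = i + 1; this avoids casts between degrees. *)
Record complex := Complex {
  term :> int -> lmodType A;
  diff : forall i j, {linear term i -> term j};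
  diff_shape : forall i j x, j != i + 1 -> diff i j x = 0;
  diff_diff : forall i j k x, diff j k (diff i j x) = 0
}.

Record chain_map (X Y : complex) := ChainMap {
  cmap :> forall i, {linear X i -> Y i};
  cmap_diff : forall i j x, cmap j (diff X i j x) = diff Y i j (cmap i x)
}.

Section ChainMaps.
Variables X Y Z : complex.

Definition chain_id : chain_map X X :=
  @ChainMap X X (fun i => idfun : {linear X i -> X i}) (fun _ _ _ => erefl).

Fact chain_comp_diff (g : chain_map Y Z) (f : chain_map X Y) i j x :
  g j (f j (diff X i j x)) = diff Z i j (g i (f i x)).
Proof. by rewrite !cmap_diff. Qed.

Definition chain_comp (g : chain_map Y Z) (f : chain_map X Y) : chain_map X Z :=
  @ChainMap X Z (fun i => g i \o f i : {linear X i -> Z i})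
    (chain_comp_diff g f).

(* Only the components h_{i, i - 1} of the homotopy matter. *)
Definition homotopic (f g : chain_map X Y) : Prop :=
  exists h : forall i j, {linear X i -> Y j},
    forall i x, f i x - g i x =
      diff Y (i - 1) i (h i (i - 1) x) + h (i + 1) i (diff X i (i + 1) x).

End ChainMaps.

Definition homotopy_equivalent (X Y : complex) : Prop :=
  exists (f : chain_map X Y) (g : chain_map Y X),
    homotopic (chain_comp g f) (chain_id X) /\
    homotopic (chain_comp f g) (chain_id Y).

Section Cohomology.
Variables (X : complex) (i : int).

Definition is_cycle : {pred X i} := fun x => diff X i (i + 1) x == 0.

Fact is_cycle_submod : submod_closed is_cycle.
Proof.
split; first by rewrite unfold_in linear0.
by move=> a x y; rewrite !unfold_in linearP => /eqP-> /eqP->; rewrite scaler0 addr0.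
Qed.

HB.instance Definition _ := GRing.isSubmodClosed.Build A (X i) is_cycle
  is_cycle_submod.

Record cycles := Cycle { cycle_val : X i; cycleP : cycle_val \in is_cycle }.

HB.instance Definition _ := [isSub for cycle_val].
HB.instance Definition _ := [Choice of cycles by <:].
HB.instance Definition _ := [SubChoice_isSubLmodule of cycles by <:].

Definition boundaries : {pred cycles} :=
  fun z => `[< exists y, diff X (i - 1) i y = cycle_val z >].

Fact boundaries_submod : submod_closed boundaries.
Proof.
split; first by apply/asboolP; exists 0; rewrite linear0.
move=> a u v /asboolP[x xu] /asboolP[y yv]; apply/asboolP.
by exists (a *: x + y); rewrite linearP xu yv.
Qed.

Definition cohomology : lmodType A := modquot boundaries_submod.

End Cohomology.

Section CohomologyMap.
Variables (X Y : complex) (f : chain_map X Y) (i : int).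

Fact cycles_map_subproof (z : cycles X i) : f i (cycle_val z) \in @is_cycle Y i.
Proof. by rewrite unfold_in -cmap_diff (eqP (cycleP z)) linear0. Qed.

Definition cycles_map (z : cycles X i) : cycles Y i :=
  Cycle (cycles_map_subproof z).

Definition cohomology_map (c : cohomology X i) : cohomology Y i :=
  modpi (boundaries_submod Y i) (cycles_map (repr c)).

Lemma cohomology_mapE (z : cycles X i) :
  cohomology_map (modpi (boundaries_submod X i) z) =
  modpi (boundaries_submod Y i) (cycles_map z).
Proof.
apply/modpi_eq/asboolP; set c := modpi _ z.
have /modpi_eq/asboolP[y /= yE] := modpi_repr c.
by exists (f (i - 1) y); rewrite -cmap_diff yE /= linearB.
Qed.

End CohomologyMap.

Definition quasi_iso (X Y : complex) (f : chain_map X Y) : Prop :=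
  forall i, bijective (@cohomology_map X Y f i).

(* Morphisms X -> Y in D(Mod A) are right fractions X <- Z -> Y in the homotopy
   category, with Z -> X a quasi-isomorphism, up to common refinement. *)
Record roof (X Y : complex) := Roof {
  roof_apex : complex;
  roof_den : chain_map roof_apex X;
  roof_num : chain_map roof_apex Y;
  roof_qis : quasi_iso roof_den
}.

Definition roof_eq (X Y : complex) (r s : roof X Y) : Prop :=
  exists (W : complex) (u : chain_map W (roof_apex r))
      (v : chain_map W (roof_apex s)),
    [/\ quasi_iso (chain_comp (roof_den r) u),
        homotopic (chain_comp (roof_den r) u) (chain_comp (roof_den s) v)
      & homotopic (chain_comp (roof_num r) u) (chain_comp (roof_num s) v)].

Definition derived_Hom_eq0 (X Y : complex) : Prop :=
  forall r s : roof X Y, roof_eq r s.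

Definition zero_module : lmodType A := 'rV[A]_0.

Section Stalk.
Variable M : lmodType A.

Definition stalk_term (i : int) : lmodType A := if i == 0 then M else zero_module.

Definition stalk : complex :=
  @Complex stalk_term (fun i j => \0 : {linear stalk_term i -> stalk_term j})
    (fun _ _ _ _ => erefl) (fun _ _ _ _ => erefl).

End Stalk.

Section Shift.
Variables (X : complex) (n : int).

Definition shift_diff i j : {linear X (i + n) -> X (j + n)} :=
  if odd `|n|%N then \- (diff X (i + n) (j + n)) : {linear _ -> _}
  else diff X (i + n) (j + n).

Fact shift_shape i j x : j != i + 1 -> shift_diff i j x = 0.
Proof.
move=> ij; have e : diff X (i + n) (j + n) x = 0.
  by apply: diff_shape; rewrite addrAC (inj_eq (addIr n)).
by rewrite /shift_diff; case: ifP => _ /=; rewrite e ?oppr0.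
Qed.

Fact shift_diff_diff i j k x : shift_diff j k (shift_diff i j x) = 0.
Proof.
rewrite /shift_diff; case: ifP => _ /=; last exact: diff_diff.
by rewrite linearN opprK diff_diff.
Qed.

(* X[n], with (X[n])^i = X^(i + n) and differential (-1)^n d. *)
Definition shift : complex :=
  @Complex (fun i => X (i + n)) shift_diff shift_shape shift_diff_diff.

End Shift.

(* The identity if i = j, and 0 otherwise. *)
Definition transport (X : int -> lmodType A) (i j : int) (x : X i) : X j :=
  if i =P j is ReflectT e then ecast k (X k) e x else 0.

Fact transport_linear X i j : linear (@transport X i j).
Proof.
rewrite /transport; case: eqP => [e|_] a x y; last by rewrite scaler0 addr0.
by case: _ / e.
Qed.
HB.instance Definition _ X i j :=
  GRing.isLinear.Build A (X i) (X j) *:%R (@transport X i j)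
    (@transport_linear X i j).

Lemma transport_id (X : int -> lmodType A) i (x : X i) : transport i x = x.
Proof. by rewrite /transport; case: eqP => // e; rewrite eq_axiomK. Qed.

Section Cone.
Variables (X Y : complex) (f : chain_map X Y).

Definition cone_term (i : int) : lmodType A := (X (i + 1)%R * Y i)%type.

Definition cone_diff_fun i j (z : cone_term i) : cone_term j :=
  (- diff X (i + 1) (j + 1) z.1,
   transport j (f (i + 1) z.1) + diff Y i j z.2).

Fact cone_diff_linear i j : linear (@cone_diff_fun i j).
Proof.
move=> a [x y] [x' y']; congr pair; rewrite /= !linearP //.
by rewrite scalerDr addrACA.
Qed.

HB.instance Definition _ i j :=
  GRing.isLinear.Build A (cone_term i) (cone_term j) *:%R (@cone_diff_fun i j)
    (@cone_diff_linear i j).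

Fact cone_shape i j z : j != i + 1 -> @cone_diff_fun i j z = 0.
Proof.
move=> ij; rewrite /cone_diff_fun !diff_shape ?(inj_eq (addIr 1)) //.
rewrite oppr0 addr0 /transport; case: eqP => // e.
by rewrite e eqxx in ij.
Qed.

Fact cone_diff_diff i j k z : @cone_diff_fun j k (@cone_diff_fun i j z) = 0.
Proof.
have [jE|/cone_shape->] := eqVneq j (i + 1); last exact: linear0.
have [kE|/cone_shape-> //] := eqVneq k (j + 1).
subst k j; congr pair => /=.
  by rewrite (linearN (diff X _ _)) opprK diff_diff.
rewrite !transport_id (linearD (diff Y _ _)) diff_diff addr0 (linearN (f _)).
by rewrite cmap_diff addNr.
Qed.

Definition cone : complex :=
  @Complex cone_term (fun i j => @cone_diff_fun i j : {linear _ -> _})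
    cone_shape cone_diff_diff.

End Cone.

Section DirectSum.
Variables X Y : complex.

Definition dsum_term (i : int) : lmodType A := (X i * Y i)%type.

Definition dsum_diff_fun i j (z : dsum_term i) : dsum_term j :=
  (diff X i j z.1, diff Y i j z.2).

Fact dsum_diff_linear i j : linear (@dsum_diff_fun i j).
Proof. by move=> a z z'; congr pair; rewrite /= linearP. Qed.

HB.instance Definition _ i j :=
  GRing.isLinear.Build A (dsum_term i) (dsum_term j) *:%R (@dsum_diff_fun i j)
    (@dsum_diff_linear i j).

Fact dsum_shape i j z : j != i + 1 -> @dsum_diff_fun i j z = 0.
Proof. by move=> ij; rewrite /dsum_diff_fun !diff_shape. Qed.

Fact dsum_diff_diff i j k z : @dsum_diff_fun j k (@dsum_diff_fun i j z) = 0.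
Proof. by rewrite /dsum_diff_fun /= !diff_diff. Qed.

Definition dsum : complex :=
  @Complex dsum_term (fun i j => @dsum_diff_fun i j : {linear _ -> _})
    dsum_shape dsum_diff_diff.

End DirectSum.

Definition dpow (X : complex) (n : nat) : complex :=
  iter n (dsum X) (stalk zero_module).

Definition Kb_proj (X : complex) : Prop :=
  (forall i, fin_gen (X i) /\ is_projective (X i)) /\
  exists n : nat, forall i : int, (n < `|i|)%N -> is_zero (X i).

(* The objects of a full triangulated subcategory of K^b(proj A) which is closed
   under isomorphism; up to isomorphism, all distinguished triangles are of the
   form X -> Y -> cone f -> X[1]. *)
Record triangulated_subcategory (S : complex -> Prop) : Prop :=
  TriangulatedSubcategory {
    tri_Kb_proj : forall X, S X -> Kb_proj X;
    tri_iso : forall X Y, Kb_proj Y -> homotopy_equivalent X Y -> S X -> S Y;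
    tri_zero : S (stalk zero_module);
    tri_shift : forall X n, S X -> S (shift X n);
    tri_cone : forall X Y (f : chain_map X Y), S X -> S Y -> S (cone f)
  }.

(* The objects of add(T), formed in the homotopy category K^b(proj A). *)
Definition summand_of_power (T X : complex) : Prop :=
  Kb_proj X /\
  exists (n : nat) (Y : complex),
    Kb_proj Y /\ homotopy_equivalent (dsum X Y) (dpow T n).

Definition tilting_complex (T : complex) : Prop :=
  [/\ Kb_proj T,
      forall n : int, n != 0 -> derived_Hom_eq0 T (shift T n)
    & forall S, triangulated_subcategory S ->
        (forall X, summand_of_power T X -> S X) ->
        forall X, Kb_proj X -> S X].

Definition Xc (P : complex) (M : lmodType A) : Prop :=
  fin_gen M /\ derived_Hom_eq0 P (shift (stalk M) 1).

Definition Yc (P : complex) (M : lmodType A) : Prop :=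
  fin_gen M /\ derived_Hom_eq0 P (stalk M).

End Complexes.

Definition stable_under (A : pzRingType) (F : lmodType A -> lmodType A)
    (X : lmodType A -> Prop) : Prop :=
  forall M, X M -> X (F M).

(* Main.v *)
(* Write [d : P1 -> P0] for the complex, with [P1] in degree -1.  Since [P] is a
   complex of projectives, [M] lies in [Yc P] iff [Hom (H^0 P, M) = 0], and in
   [Xc P] iff every map [P1 -> M] factors through [d].

   If [Xc P] and [Yc P] meet in zero and [H^0 P] is in [Xc P], a finitely
   generated module is an extension of its quotient by the trace of [H^0 P],
   which is in [Yc P], by that trace, which is in [Xc P].

   For the stability conditions, the trace pairing makes [Hom (X, Q)] and
   [Hom (Q, DA (x) X)] dual to each other for [Q] finitely generated projective,
   so [DA (x) X] is in [Xc P] iff [Hom (X, H^{-1} P) = 0]; the rest is the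
   tensor-hom adjunction.

   For the generation of [K^b(proj A)], let [Q] be finitely generated projective
   and extend [Q] by a power [N] of [P], as in Bongartz's completion, to a
   complex [B] with [Hom (P, B[1]) = 0].  If [G] is a right approximation of [B]
   by a power of [P], then [H^0 (cone G)] is in [Xc P] and in [Yc P], hence zero;
   this makes [B -> cone G] null-homotopic, so that [B] is a retract of a power
   of [P], and [Q] is obtained from [B] and [N].

   That [DA] is finitely generated and that [A -> Hom_R (DA, I)] is bijective is
   shown by devissage of finitely generated modules over the artinian ring [R]
   into simple ones. *)

Require Import Defs.
From HB Require Import structures.
From mathcomp Require Import all_boot all_algebra.
From mathcomp Require Import ssrAC zify.
From mathcomp Require Import boolp classical_sets.

Set Implicit Arguments.
Unset Strict Implicit.
Unset Printing Implicit Defensive.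

Import Defs GRing.Theory.
Local Open Scope ring_scope.

(** * Submodules and ideals of artinian rings *)

(** The derived category enters only through [derived_Hom_two_term]: a quasi-isomorphism onto [P]
    has a section up to homotopy, so each vanishing condition becomes a statement about linear maps
    out of [P (-1)] and [P 0]. That [Xc P] and [Yc P] meet in zero for a tilting [P] is detected by
    [Hom (-, M)]: for [M] in both classes it is exact on [P], hence on all that [P] generates, hence
    on [A] itself, so [M = 0]. All finiteness comes from [R]. Chain maps from [P] into a complex of
    finitely generated modules are determined by finitely many values, so they form a submodule of a
    noetherian [R]-module; hence finite approximations by powers of [P] exist. Their coefficients
    lie in [R] rather than in [A], because central scalars act by [A]-linear maps. The way back from
    a torsion theory rests on [Xc P] being the left orthogonal of [Yc P]: a module is placed in
    [Xc P] by showing that its maps into [Yc P] vanish. *)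

Section Submodules.
Variables (A : pzRingType) (M : lmodType A).
Implicit Types S T : {pred M}.

Lemma submodZ S : submod_closed S -> forall a x, x \in S -> a *: x \in S.
Proof. by move=> [S0 SL] a x Sx; rewrite -[_ *: _]addr0; apply: SL. Qed.

Lemma submodD S : submod_closed S -> {in S &, forall x y, x + y \in S}.
Proof. by move=> [S0 SL] x y Sx Sy; rewrite -[x]scale1r; apply: SL. Qed.

Lemma submodN S : submod_closed S -> {in S, forall x, - x \in S}.
Proof. by move=> HS x Sx; rewrite -scaleN1r; apply: submodZ. Qed.

Lemma submodB S : submod_closed S -> {in S &, forall x y, x - y \in S}.
Proof. by move=> HS x y Sx Sy; apply: submodD => //; apply: submodN. Qed.

Lemma submod_sum S : submod_closed S ->
  forall n (f : 'I_n -> M), (forall i, f i \in S) -> \sum_i f i \in S.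
Proof.
move=> HS n f Sf; elim/big_ind: _ => //; first exact: HS.1.
exact: submodD.
Qed.

(** Zorn's lemma. Maximality of [T] is recorded elementwise: modulo [T] every nonzero submodule
    contains [x], so [x] spans a simple essential submodule of the quotient. *)
Lemma max_submod_avoiding S x : submod_closed S -> x \notin S ->
  exists T, [/\ submod_closed T, {subset S <= T}, x \notin T
    & forall y, y \notin T -> exists a, x - a *: y \in T].
Proof.
move=> S_sub Sx.
pose good (T : M -> bool) := [/\ submod_closed T, {subset S <= T} & x \notin T].
have gS : good S by split.
pose R (T U : {T : M -> bool | good T}) := `[< {subset sval T <= sval U} >].
have [|T U V /asboolP TU /asboolP UV|C Ctot|[T [T_sub ST Tx]] Tmax] :=
  @ZL_preorder _ (exist good S gS) R.
- by move=> T; apply/asboolP.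
- by apply/asboolP => y /TU /UV.
(* The union of an empty chain would not contain [S]; there [S] itself is the upper bound. *)
- have [[U CU]|C0] := pselect (exists U, C U); last first.
    by exists (exist good S gS) => T CT; case: C0; exists T.
  pose V : M -> bool := fun y => `[< exists2 T, C T & y \in sval T >].
  have VP y : reflect (exists2 T, C T & y \in sval T) (y \in V) by apply: asboolP.
  have gV : good V.
    split.
    + split; first by apply/VP; exists U => //; case: (svalP U) => -[].
      move=> a y z /VP[T CT Ty] /VP[T' CT' Tz].
      have [/asboolP TT|/asboolP TT] := Ctot _ _ CT CT'.
        apply/VP; exists T' => //; case: (svalP T') => -[_ h] _ _.
        by apply: h => //; apply: TT.
      apply/VP; exists T => //; case: (svalP T) => -[_ h] _ _.
      by apply: h => //; apply: TT.
    + by move=> y Sy; apply/VP; exists U => //; case: (svalP U) => _ + _; apply.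
    + by apply/VP => -[T CT Tx]; case: (svalP T) => _ _; rewrite Tx.
  exists (exist good V gV) => T CT; apply/asboolP => y Ty.
  by apply/VP; exists T.
exists T; split=> // y Ty.
pose U : M -> bool := fun z => `[< exists a, z - a *: y \in T >].
have UP z : reflect (exists a, z - a *: y \in T) (z \in U) by apply: asboolP.
apply/UP; apply: contraNT Ty => Ux.
have TU : {subset T <= U} by move=> z Tz; apply/UP; exists 0; rewrite scale0r subr0.
have gU : good U.
  split=> //; last by move=> z /ST /TU.
  split; first exact/TU/T_sub.1.
  move=> b z w /UP[a za] /UP[a' wa]; apply/UP; exists (b * a + a').
  have -> : b *: z + w - (b * a + a') *: y = b *: (z - a *: y) + (w - a' *: y).
    by rewrite scalerDl scalerBr -scalerA opprD addrACA.
  exact: T_sub.2.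
have /asboolP := Tmax (exist good U gU) (introT (asboolP _) TU); apply.
by apply/UP; exists 1; rewrite scale1r subrr T_sub.1.
Qed.

End Submodules.

Section Factor.
Variables (A : pzRingType).

Definition linear_of (M N : lmodType A) (f : M -> N) (f_lin : linear f) :
    {linear M -> N} :=
  HB.pack f (GRing.isLinear.Build A M N *:%R f f_lin).

(** For maps whose values are found through a choice of preimage: linearity is checked on the
    relation, where the choice does not intervene. *)
Lemma linear_of_graph (M N : lmodType A) (G : M -> N -> Prop) :
  (forall x, exists y, G x y) ->
  (forall a x y x' y', G x y -> G x' y' -> G (a *: x + x') (a *: y + y')) ->
  (forall x y y', G x y -> G x y' -> y = y') ->
  exists f : {linear M -> N}, forall x, G x (f x).
Proof.
move=> /choice[f fP] G_lin G_fun.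
have f_lin : linear f.
  by move=> a x y; apply: (G_fun (a *: x + y)) => //; apply: G_lin.
by exists (linear_of f_lin).
Qed.

Lemma factor_surj (M M'' N : lmodType A) (p : {linear M -> M''})
    (f : {linear M -> N}) : surj p -> (forall x, p x = 0 -> f x = 0) ->
  exists g : {linear M'' -> N}, forall x, g (p x) = f x.
Proof.
move=> ps fp; pose G y z := exists2 x, p x = y & f x = z.
have [|a y z y' z' [x <- <-] [x' <- <-]|y z z' [x <- <-] [x' px <-]|g gP] :=
  @linear_of_graph _ _ G.
- by move=> y; have [x <-] := ps y; exists (f x), x.
- by exists (a *: x + x'); rewrite linearP.
- by apply/eqP; rewrite -subr_eq0 -linearB fp // linearB px subrr.
exists g => x; have [x' px <-] := gP (p x).
by apply/eqP; rewrite -subr_eq0 -linearB fp // linearB px subrr.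
Qed.

Lemma factor_inj (M' M N : lmodType A) (i : {linear M' -> M})
    (f : {linear N -> M}) : injective i -> (forall x, exists y, i y = f x) ->
  exists g : {linear N -> M'}, forall x, i (g x) = f x.
Proof.
move=> i_inj fi; apply: (@linear_of_graph _ _ (fun x y => i y = f x)) => //.
- by move=> a x y x' y' yx yx'; rewrite !linearP yx yx'.
- by move=> x y y' yx y'x; apply: i_inj; rewrite yx y'x.
Qed.

End Factor.

Section Quotient.
Variables (A : pzRingType) (M : lmodType A) (S : {pred M}) (HS : submod_closed S).

Lemma modpi_eq0 x : (modpi HS x = 0) <-> (x \in S).
Proof.
have -> : 0 = modpi HS 0 by rewrite linear0.
by split=> [/modpi_eq|]; rewrite ?subr0 // => Sx; apply/modpi_eq; rewrite subr0.
Qed.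

Lemma modquot_lift (N : lmodType A) (f : {linear M -> N}) :
  (forall x, x \in S -> f x = 0) ->
  exists g : {linear modquot HS -> N}, forall x, g (modpi HS x) = f x.
Proof.
move=> fS; apply: factor_surj; first exact: modpi_surj.
by move=> x /modpi_eq0; apply: fS.
Qed.

End Quotient.

Lemma injective_ker0 (A : pzRingType) (M N : lmodType A) (f : {linear M -> N}) :
  (forall x, f x = 0 -> x = 0) -> injective f.
Proof.
by move=> f0 x y fxy; apply/eqP; rewrite -subr_eq0; apply/eqP/f0; rewrite linearB fxy subrr.
Qed.

(* [*:%R^~ x] is linear only over a commutative ring or on the regular module. *)
Section ScaleVector.
Variables (A : pzRingType) (M : lmodType A) (x : M).
Definition scale_vector (a : A^o) : M := (a : A) *: x.
Fact scale_vector_linear : linear scale_vector.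
Proof. by move=> a b c; rewrite /scale_vector scalerDl -scalerA. Qed.
HB.instance Definition _ :=
  GRing.isLinear.Build A A^o M *:%R scale_vector scale_vector_linear.
End ScaleVector.

Section Artinian.
Variables (R : comPzRingType) (R_artin : artinian R).
Implicit Types J K : {pred R^o}.

Lemma artinian_min (F : {pred R^o} -> Prop) J0 : F J0 ->
  (forall J, F J -> submod_closed J) ->
  exists J, F J /\ forall K, F K -> {subset K <= J} -> {subset J <= K}.
Proof.
move=> FJ0 Fsub; apply: contrapT => Nmin.
(* [F J] sits under the existential so that [choice] yields a total function, whose iterates form a
   strictly decreasing chain. *)
have step J : exists K, F J -> [/\ F K, {subset K <= J} & ~ {subset J <= K}].
  have [FJ|NFJ] := pselect (F J); last by exists J.
  apply: contrapT => NK; apply: Nmin; exists J; split=> // K FK KJ.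
  by apply: contrapT => NJK; apply: NK; exists K.
have [g gP] := choice step.
pose J n := iter n g J0.
have FJ n : F (J n) by elim: n => // n IH; case: (gP _ IH).
have [n nP] := R_artin (fun n => Fsub _ (FJ n)) (fun n => let: And3 _ h _ := gP _ (FJ n) in h).
have [_ _] := gP _ (FJ n); apply => x Jx.
by rewrite -[g _]/(J n.+1) nP.
Qed.

(** The quotient by [m] is a field: the form of maximality used in computations, equivalent to
    [maximal_ideal] by [maximal_idealP]. *)
Definition maximal (m : {pred R^o}) := [/\ submod_closed m, 1 \notin m
  & forall r, r \notin m -> exists s, 1 - s * r \in m].

Lemma maximal_idealP m : maximal m <-> maximal_ideal m.
Proof.
split=> -[m_sub m1 mmax]; split=> //.
  move=> n n_sub n1 mn r nr; apply/negPn/negP => /mmax[s /mn ns].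
  case/negP: n1; rewrite -[1](subrK (s * r)).
  by apply: submodD => //; rewrite -[_ * _]/(s *: (r : R^o)) submodZ.
move=> r mr; pose n : {pred R^o} := fun z => `[< exists s, z - s * r \in m >].
have nP z : reflect (exists s, z - s * r \in m) (z \in n) by apply: asboolP.
apply/nP/negPn/negP => n1.
have mn : {subset m <= n} by move=> z mz; apply/nP; exists 0; rewrite mul0r subr0.
case/negP: mr; apply: (mmax n) => //; last by apply/nP; exists 1; rewrite mul1r subrr; case: m_sub.
split; first exact/mn/m_sub.1.
move=> a x y /nP[s xs] /nP[t yt]; apply/nP; exists (a * s + t).
have -> : a *: x + y - (a * s + t) * r = a *: (x - s * r) + (y - t * r).
  have e z : a *: (z : R^o) = a * z by [].
  by rewrite !e mulrBr mulrDl mulrA opprD addrACA.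
exact: m_sub.2.
Qed.

Lemma maximal_prime m r s : maximal m -> r \notin m -> s \notin m -> r * s \notin m.
Proof.
move=> [m_sub _ mmax] mr /mmax[t mt]; apply: contra mr => mrs.
rewrite -[r](subrK (t * (r * s))); apply: submodD => //; last exact: (submodZ m_sub t mrs).
by have := submodZ m_sub r mt; rewrite -[r *: _]/(r * _) mulrBr mulr1 mulrCA.
Qed.

(* Some element lies in every maximal ideal except [m]: take [K] minimal
   among the ideals not contained in [m]. *)
Lemma artinian_separate m : maximal m ->
  exists2 x, x \notin m & forall n, maximal n -> x \in n \/ n =i m.
Proof.
move=> mm; have [m_sub m1 mmax] := mm.
pose F (K : {pred R^o}) := submod_closed K /\ exists2 k, k \in K & k \notin m.
have [] := @artinian_min F predT; [|by move=> J []|].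
  by split; [split | exists 1].
move=> K [[K_sub [k Kk mk]] Kmin]; exists k => // n nn.
have [n_sub n1 nmax] := nn.
have [nm|Nnm] := pselect ({subset n <= m}).
  right => x; apply/idP/idP; first exact: nm.
  by have /maximal_idealP[_ _ /(_ m m_sub m1 nm)] := nn; apply.
(* As [m] is prime, [k * t] lies in the intersection of [K] and [n] but not in [m]; minimality of
   [K] then puts [K] inside [n]. *)
have [t nt mt] : exists2 t, t \in n & t \notin m.
  apply: contrapT => H; apply: Nnm => t nt; apply/negPn/negP => mt.
  by apply: H; exists t.
left; pose L : {pred R^o} := [pred z | (z \in K) && (z \in n)].
suff KL : {subset K <= L} by have /andP[] := KL _ Kk.
apply: (Kmin L); last by move=> z /andP[].
split.
  split; first by rewrite inE K_sub.1 n_sub.1.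
  by move=> a x y /andP[Kx nx] /andP[Ky ny]; rewrite inE K_sub.2 ?n_sub.2.
exists (k * t); last exact: maximal_prime.
rewrite inE; apply/andP; split; last exact: (submodZ n_sub).
by rewrite mulrC; apply: (submodZ K_sub).
Qed.

(** A simple quotient [K / K'] above [J], generated by [x]. Zorn's lemma alone does not give it,
    since [K] is not known to be finitely generated; the descending chain condition supplies a
    multiplier [k] that takes the place of a generator. *)
Lemma ideal_simple_step J K : submod_closed J -> submod_closed K ->
    {subset J <= K} -> ~ {subset K <= J} ->
  exists (K' : {pred R^o}) (x : R), [/\ submod_closed K', {subset J <= K'},
      {subset K' <= K}, x \in K & maximal [pred r | r * x \in K'] /\
      forall y, y \in K -> exists r, y - r * x \in K'].
Proof.
move=> J_sub K_sub JK NKJ.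
(* Take [L] minimal with [L K] not inside [J], and [k] in [L]. If [r k y] is outside [J] for some
   [y] in [K], the ideal generated by [r k] is again in the family, so [k = s r k] for some [s]:
   thus [r] is invertible modulo the annihilator of [k]. *)
pose F (L : {pred R^o}) := submod_closed L /\
  exists k y : R, [/\ k \in L, y \in K & k * y \notin J].
have [] := @artinian_min F predT; [|by move=> ? []|].
  split; first by split.
  apply: contrapT => H; apply: NKJ => y Ky; apply/negPn/negP => Jy.
  by apply: H; exists 1, y; rewrite mul1r.
move=> L [[L_sub [k [x [Lk Kx Jkx]]]] Lmin].
pose S : {pred R^o} := [pred y | k * y \in J].
have S_sub : submod_closed S.
  split; first by rewrite inE mulr0 J_sub.1.
  move=> a y z; rewrite !inE => Jy Jz.
  by rewrite mulrDr -[a *: y]/(a * y) mulrCA (J_sub.2 a).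
have [T [T_sub ST Tx Tmax]] := max_submod_avoiding S_sub Jkx.
have inv r y : y \in K -> r * (k * y) \notin J ->
    exists s, forall z, (1 - s * r) * z \in T.
  move=> Ky Jrky; pose L' : {pred R^o} := fun z => `[< exists s, z = s * r * k >].
  have LL' : {subset L <= L'}.
    apply: (Lmin L'); last by move=> z /asboolP[s ->]; apply: (submodZ L_sub).
    split; last first.
      by exists (r * k), y; split=> //; [apply/asboolP; exists 1; rewrite mul1r | rewrite -mulrA].
    split; first by apply/asboolP; exists 0; rewrite !mul0r.
    move=> a u v /asboolP[s ->] /asboolP[t ->]; apply/asboolP; exists (a * s + t).
    by rewrite !mulrDl -[a *: _]/(a * _) !mulrA.
  have /asboolP[s ks] := LL' _ Lk.
  exists s => z; apply: ST; rewrite inE mulrA mulrBr mulr1 mulrC [k * _]mulrC -ks.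
  by rewrite subrr mulr0 J_sub.1.
pose K' : {pred R^o} := [pred z | (z \in K) && (z \in T)].
have K'_sub : submod_closed K'.
  split; first by rewrite inE K_sub.1 T_sub.1.
  by move=> a u v /andP[Kx' nx] /andP[Ky ny]; rewrite inE K_sub.2 ?T_sub.2.
have K'x r : (r * x \in K') = (r * x \in T).
  by rewrite inE andb_idl // => _; apply: (submodZ K_sub).
exists K', x; split=> //.
- move=> z Jz; rewrite inE JK //; apply: ST; rewrite inE.
  exact: (submodZ J_sub).
- by move=> z /andP[].
split.
  split.
  + split; first by rewrite inE mul0r K'_sub.1.
    move=> a u v; rewrite !inE -/K' => Ku Kv; have := K'_sub.2 a _ _ Ku Kv.
    by rewrite mulrDl -[a *: u]/(a * u) -[a *: _]/(a * _) mulrA.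
  + by rewrite inE /= -/K' K'x mul1r.
  + move=> r; rewrite inE /= -/K' K'x => /Tmax[s sx].
    by exists s; rewrite inE /= -/K' K'x mulrBl mul1r -mulrA.
move=> y Ky; have [Ty|Ty] := boolP (y \in T).
  by exists 0; rewrite mul0r subr0 inE Ky Ty.
have [r rx] := Tmax y Ty.
have Jrky : r * (k * y) \notin J.
  apply: contra Tx => Jrky; rewrite -[x](subrK (r *: (y : R^o))) submodD //.
  by apply: ST; rewrite inE -[r *: y]/(r * y) mulrCA.
have [s sP] := inv r y Ky Jrky; exists s.
rewrite inE; apply/andP; split.
  by rewrite (submodB K_sub) //; apply: (submodZ K_sub).
have -> : y - s * x = (1 - s * r) * y - s * (x - r * y).
  by rewrite mulrBl mul1r mulrBr mulrA opprB addrA subrK.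
by apply: submodB => //; apply: (submodZ T_sub).
Qed.

End Artinian.

(** * Finitely generated modules over an artinian ring *)

Section FinGen.
Variable A : pzRingType.
Implicit Types M N : lmodType A.

Lemma is_zero_fin_gen M : is_zero M -> fin_gen M.
Proof.
move=> M0; exists 0%N, (fun=> 0) => x; exists (fun=> 0).
by rewrite big_ord0; apply: M0.
Qed.

Lemma fin_gen_surj M N (f : {linear M -> N}) : surj f -> fin_gen M -> fin_gen N.
Proof.
move=> fs [n [g gP]]; exists n, (f \o g) => y; have [x <-] := fs y.
have [c ->] := gP x; exists c; rewrite linear_sum.
by apply: eq_bigr => i _; rewrite linearZ.
Qed.

Lemma fin_gen_prod M N : fin_gen M -> fin_gen N -> fin_gen (M * N)%type.
Proof.
move=> [m [f fP]] [n [g gP]].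
exists (m + n)%N, (fun i => match split i with inl i => (f i, 0) | inr j => (0, g j) end).
move=> [x y]; have [c ->] := fP x; have [d ->] := gP y.
exists (fun i => match split i with inl i => c i | inr j => d j end).
rewrite big_split_ord /=.
have -> : \sum_(i < m) match split (lshift n i) with inl i => c i | inr j => d j end
      *: match split (lshift n i) with inl i => (f i, 0) | inr j => (0, g j) end
   = (\sum_(i < m) c i *: f i, 0) :> (M * N)%type.
  under eq_bigr => i _ do rewrite (unsplitK (inl i)).
  elim/big_rec2: _ => // i x1 x2 _ ->; congr pair; rewrite /= ?scaler0 ?addr0 //.
have -> : \sum_(i < n) match split (rshift m i) with inl i => c i | inr j => d j end
      *: match split (rshift m i) with inl i => (f i, 0) | inr j => (0, g j) end
   = (0, \sum_(i < n) d i *: g i) :> (M * N)%type.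
  under eq_bigr => i _ do rewrite (unsplitK (inr i)).
  elim/big_rec2: _ => // i x1 x2 _ ->; congr pair; rewrite /= ?scaler0 ?addr0 //.
by congr pair; rewrite /= ?addr0 ?add0r.
Qed.

Lemma fin_gen_ffun M n : fin_gen M -> fin_gen {ffun 'I_n -> M}.
Proof.
elim: n => [|n IH] fgM.
  by apply: is_zero_fin_gen => f; apply/ffunP => -[].
pose h (p : M * {ffun 'I_n -> M}) : {ffun 'I_n.+1 -> M} :=
  [ffun i => if unlift ord0 i is Some j then p.2 j else p.1].
have h_lin : linear h.
  by move=> a p q; apply/ffunP => i; rewrite !ffunE; case: unliftP => [j|] _; rewrite ?ffunE.
pose hL : {linear _ -> _} := linear_of h_lin.
apply: (@fin_gen_surj _ _ hL); last exact: fin_gen_prod fgM (IH fgM).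
move=> g; exists (g ord0, [ffun j => g (lift ord0 j)]); apply/ffunP => i.
by rewrite ffunE; case: unliftP => [j|] ->; rewrite ?ffunE.
Qed.

Definition fg_submod M (S : {pred M}) := exists (n : nat) (g : 'I_n -> M),
  (forall i, g i \in S) /\
  forall x, x \in S -> exists c : 'I_n -> A, x = \sum_(i < n) c i *: g i.

Definition noetherian_module M :=
  forall S : {pred M}, submod_closed S -> fg_submod S.

Lemma noetherian_ext M' M M'' (i : {linear M' -> M}) (p : {linear M -> M''}) :
  short_exact i p -> noetherian_module M' -> noetherian_module M'' ->
  noetherian_module M.
Proof.
move=> [i_inj p_surj ex] N' N'' S S_sub.
have [|m [f [fS fP]]] := N' (fun x => i x \in S).
  by split=> [|a x y]; rewrite !unfold_in ?linear0 ?linearP; [apply: S_sub.1 | apply: S_sub.2].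
have SP y : reflect (exists2 x, x \in S & p x = y) `[< exists2 x, x \in S & p x = y >].
  exact: asboolP.
have [|n [g [gS gP]]] := N'' (fun y => `[< exists2 x, x \in S & p x = y >]).
  split; first by apply/SP; exists 0; rewrite ?linear0 ?S_sub.1.
  move=> a y z /SP[x Sx <-] /SP[x' Sx' <-]; apply/SP.
  by exists (a *: x + x'); rewrite ?linearP ?S_sub.2.
have /choice[h hP] : forall j, exists x, x \in S /\ p x = g j.
  by move=> j; have /SP[x] := gS j; exists x.
exists (m + n)%N, (fun k => match split k with inl k => i (f k) | inr j => h j end).
split; first by move=> k; case: split => j; [apply: fS | case: (hP j)].
move=> x Sx; have [|d dP] := gP (p x); first by apply/SP; exists x.
have [|x' x'P] := (ex (x - \sum_j d j *: h j)).1.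
  rewrite linearB linear_sum dP; apply/eqP; rewrite subr_eq0; apply/eqP/eq_bigr => j _.
  by rewrite linearZ /=; case: (hP j) => _ ->.
have [|c cP] := fP x'.
  rewrite unfold_in x'P; apply: submodB => //.
  by apply: submod_sum => // j; apply: submodZ => //; case: (hP j).
exists (fun k => match split k with inl k => c k | inr j => d j end).
rewrite big_split_ord /=; under eq_bigr => k _ do rewrite (unsplitK (inl k)).
under [X in _ + X]eq_bigr => k _ do rewrite (unsplitK (inr k)).
rewrite -[x](subrK (\sum_j d j *: h j)) -x'P cP linear_sum; congr (_ + _).
by apply: eq_bigr => k _; rewrite linearZ.
Qed.

End FinGen.

Section ArtinianInduction.
Variables (R : comPzRingType) (R_artin : artinian R).
Variable Q : lmodType R -> Prop.
Hypothesis Q_zero : forall M, is_zero M -> Q M.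
Hypothesis Q_simple : forall m (m_sub : submod_closed m),
  @maximal R m -> Q (modquot m_sub).
Hypothesis Q_ext : forall (M' M M'' : lmodType R) (i : {linear M' -> M}) (p : {linear M -> M''}),
  short_exact i p -> Q M' -> Q M'' -> Q M.

(** Take [K] minimal among the ideals above [J] whose quotient satisfies [Q]. If [K] were larger
    than [J], a simple step down to [K'] would present [R / K'] as an extension of [R / K] by a
    simple module, against minimality. *)
Lemma cyclic_ind (J : {pred R^o}) (J_sub : submod_closed J) : Q (modquot J_sub).
Proof.
pose F (K : {pred R^o}) := {subset J <= K} /\ exists K_sub : submod_closed K, Q (modquot K_sub).
have [] := @artinian_min R R_artin F predT.
- split=> //; have T_sub : @submod_closed R R^o predT by [].
  by exists T_sub; apply: Q_zero => v; have [x <-] := modpi_surj v; apply/modpi_eq0.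
- by move=> K [_ []].
move=> K [[JK [K_sub QK]] Kmin].
have [KJ|NKJ] := pselect ({subset K <= J}).
  have eKJ : K = J by apply: funext => x; apply/idP/idP; [exact: KJ | exact: JK].
  by subst K; rewrite (Prop_irrelevance J_sub K_sub).
have [K' [x [K'_sub JK' K'K Kx [mm Kgen]]]] := ideal_simple_step R_artin J_sub K_sub JK NKJ.
have Fk' : F K'; last first.
  have KK' := Kmin _ Fk' K'K; have [_ /negP[]] := mm.
  by rewrite inE /= mul1r; apply: KK'.
split=> //; exists K'_sub; have [m_sub _ _] := mm.
have [|i iP] := @modquot_lift R _ _ m_sub _
    (modpi K'_sub \o scale_vector (x : R^o) : {linear R^o -> _}).
  by move=> r mr; apply/modpi_eq0.
have [|p pP] := @modquot_lift R _ _ K'_sub _ (modpi K_sub).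
  by move=> r /K'K Kr; apply/modpi_eq0.
apply: (Q_ext (i := i) (p := p)) => //; last exact: Q_simple.
split.
- apply: injective_ker0 => v; have [r <-] := modpi_surj v; rewrite iP => /modpi_eq0 h.
  exact/modpi_eq0.
- by move=> v; have [r <-] := modpi_surj v; exists (modpi K'_sub r).
- move=> v; have [y <-] := modpi_surj v; rewrite pP; split.
    move=> /modpi_eq0/Kgen[r rP]; exists (modpi m_sub r); rewrite iP.
    apply/modpi_eq; rewrite -opprB; apply: submodN => //.
  move=> [w]; have [r <-] := modpi_surj w; rewrite iP => /modpi_eq/K'K rxy.
  apply/modpi_eq0; rewrite -[y](subKr (r * x)); apply: (submodB K_sub) => //.
  exact: (submodZ K_sub).
Qed.

Lemma fin_gen_ind M : fin_gen M -> Q M.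
Proof.
move=> [n]; elim: n M => [|n IH] M [g gP].
  by apply: Q_zero => x; have [c ->] := gP x; rewrite big_ord0.
pose N : {pred M} := fun x => `[< exists a, x = a *: g ord0 >].
have NP x : reflect (exists a, x = a *: g ord0) (x \in N) by apply: asboolP.
have N_sub : submod_closed N.
  split; first by apply/NP; exists 0; rewrite scale0r.
  move=> a x y /NP[b ->] /NP[c ->]; apply/NP; exists (a * b + c).
  by rewrite scalerDl scalerA.
pose J : {pred R^o} := fun a => a *: g ord0 == 0.
have J_sub : submod_closed J.
  split; first by rewrite unfold_in scale0r.
  by move=> a b c /eqP b0 /eqP c0; rewrite unfold_in scalerDl -scalerA b0 c0 scaler0 addr0.
have [|i iP] := @modquot_lift R _ _ J_sub _ (scale_vector (g ord0)).
  by move=> a /eqP.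
apply: (Q_ext (i := i) (p := modpi N_sub)).
- split.
  + apply: injective_ker0 => v; have [r <-] := modpi_surj v; rewrite iP => h.
    exact/modpi_eq0/eqP.
  + exact: modpi_surj.
  + move=> x; split.
      by move=> /modpi_eq0/NP[a ->]; exists (modpi J_sub a); rewrite iP.
    move=> [w <-]; have [r <-] := modpi_surj w; rewrite iP; apply/modpi_eq0/NP.
    by exists r.
- exact: cyclic_ind.
- apply: IH; exists (fun j => modpi N_sub (g (lift ord0 j))) => v.
  have [x <-] := modpi_surj v; have [c ->] := gP x; exists (fun j => c (lift ord0 j)).
  rewrite linear_sum big_ord_recl /= linearZ /=.
  have -> : modpi N_sub (g ord0) = 0 by apply/modpi_eq0/NP; exists 1; rewrite scale1r.
  by rewrite scaler0 add0r; apply: eq_bigr => j _; rewrite linearZ.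
Qed.

End ArtinianInduction.

Section ArtinianModules.
Variables (R : comPzRingType) (R_artin : artinian R).

Lemma artinian_noetherian (M : lmodType R) : fin_gen M -> noetherian_module M.
Proof.
apply: (fin_gen_ind R_artin) => {M}.
- move=> M M0 S _; exists 0%N, (fun=> 0); split=> [[]//|x _]; exists (fun=> 0).
  by rewrite big_ord0; apply: M0.
- move=> m m_sub [_ m1 mmax] S S_sub.
  have [S0|NS0] := pselect (forall x, x \in S -> x = 0).
    exists 0%N, (fun=> 0); split=> [[]//|x Sx]; exists (fun=> 0).
    by rewrite big_ord0; apply: S0.
  have [x Sx x0] : exists2 x, x \in S & x <> 0.
    by apply: contrapT => H; apply: NS0 => x Sx; apply: contrapT => x0; apply: H; exists x.
  exists 1%N, (fun=> x); split=> // y _; have [r rx] := modpi_surj x.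
  have /mmax[s sP] : r \notin m by apply/negP => mr; apply: x0; rewrite -rx; apply/modpi_eq0.
  have [t ty] := modpi_surj y; exists (fun=> t * s).
  rewrite big_ord1 -rx -ty -linearZ; apply/modpi_eq.
  have := submodZ m_sub t sP; rewrite -[t *: _]/(t * _) -[_ *: _]/(t * s * r).
  by rewrite mulrBr mulr1 mulrA.
- by move=> M' M M'' i p; apply: noetherian_ext.
Qed.

Lemma fin_gen_inj (M N : lmodType R) (f : {linear M -> N}) :
  injective f -> fin_gen N -> fin_gen M.
Proof.
move=> f_inj /artinian_noetherian /(_ (fun y => `[< exists x, f x = y >]))[].
  split; first by apply/asboolP; exists 0; rewrite linear0.
  move=> a y z /asboolP[x <-] /asboolP[x' <-]; apply/asboolP.
  by exists (a *: x + x'); rewrite linearP.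
move=> n [g [gS gP]].
have /choice[h hP] : forall j, exists x, f x = g j by move=> j; have /asboolP := gS j.
exists n, h => x; have [|c cP] := gP (f x); first by apply/asboolP; exists x.
exists c; apply: f_inj; rewrite cP linear_sum; apply: eq_bigr => j _.
by rewrite linearZ /= hP.
Qed.

End ArtinianModules.

(** * Matlis duality with respect to the injective envelope *)

Section Duality.
Variables (R : comPzRingType) (R_artin : artinian R).
Variables (I : lmodType R) (e : {linear residue_mod R -> I}).
Hypothesis I_env : injective_envelope e.

Let I_inj : is_injective I. Proof. by case: I_env. Qed.
Let e_inj : injective e. Proof. by case: I_env. Qed.

(** With [x] in every maximal ideal but [m], the product [r * x] is in the radical exactly when [r]
    is in [m]; so multiplication by [x] embeds [R / m] into [R / rad R]. *)
Lemma simple_into_envelope m (m_sub : submod_closed m) : @maximal R m ->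
  exists j : {linear modquot m_sub -> I}, injective j.
Proof.
move=> mm; have [x mx xP] := artinian_separate R_artin mm.
have radP r : (r * x \in @rad R) = (r \in m).
  apply/asboolP/idP => [|mr n /maximal_idealP nn].
    move=> /(_ m (proj1 (maximal_idealP _) mm)); apply: contraLR => mr.
    exact: maximal_prime.
  have [n_sub _ _] := nn; have [nx|nm] := xP _ nn.
    exact: (submodZ n_sub r nx).
  by rewrite nm mulrC; apply: (submodZ m_sub).
have [|j jP] := @modquot_lift R _ _ m_sub _
    (e \o (modpi (rad_submod R) \o scale_vector (x : R^o)) : {linear R^o -> I}).
  move=> r mr /=; rewrite -[RHS](linear0 e); congr (e _); apply/modpi_eq0.
  by rewrite /scale_vector -[_ *: _]/(r * x) radP.
exists j; apply: injective_ker0 => v; have [r <-] := modpi_surj v; rewrite jP /=.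
rewrite -[RHS in _ = RHS -> _](linear0 e) => /e_inj/modpi_eq0.
by rewrite /scale_vector -[_ *: _]/(r * x) radP => mr; apply/modpi_eq0.
Qed.

(** Enlarge [W] to a maximal submodule [S] avoiding [v]. The annihilator [m] of [v] modulo [S] is
    then a maximal ideal, and the embedding of [R / m] into [I] extends from the span of [v] by
    injectivity. *)
Lemma envelope_cogenerator (V : lmodType R) (W : {pred V}) v :
  submod_closed W -> v \notin W ->
  exists xi : {linear V -> I}, (forall w, w \in W -> xi w = 0) /\ xi v <> 0.
Proof.
move=> W_sub Wv; have [S [S_sub WS Sv Smax]] := max_submod_avoiding W_sub Wv.
pose m : {pred R^o} := fun r => (r : R) *: v \in S.
have m_sub : submod_closed m.
  split; first by rewrite unfold_in scale0r S_sub.1.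
  by move=> a b c mb mc; rewrite unfold_in scalerDl -scalerA S_sub.2.
have mm : maximal m.
  split=> //; first by rewrite unfold_in scale1r.
  move=> r /Smax[s sP]; exists s.
  by rewrite unfold_in scalerBl scale1r -scalerA.
have [j j_inj] := simple_into_envelope m_sub mm.
have [|i iP] := @modquot_lift R _ _ m_sub _ (modpi S_sub \o scale_vector v : {linear R^o -> _}).
  by move=> r mr; apply/modpi_eq0.
have i_inj : injective i.
  apply: injective_ker0 => u; have [r <-] := modpi_surj u; rewrite iP => /modpi_eq0 h.
  exact/modpi_eq0.
have [xi xiP] := I_inj j i_inj.
exists (xi \o modpi S_sub : {linear _ -> _}); split=> [w /WS Sw|] /=.
  by have /modpi_eq0-> := Sw; rewrite linear0.
have -> : modpi S_sub v = i (modpi m_sub 1) by rewrite iP /= /scale_vector scale1r.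
rewrite xiP -(linear0 j) => /j_inj/modpi_eq0; rewrite unfold_in scale1r.
by apply/negP.
Qed.

(* Essentiality of [e] gives: the elements of [I] annihilated by [m] form a
   vector space over [R/m] of dimension at most one. *)
Lemma envelope_socle m (y z : I) : @maximal R m ->
  (forall r, r \in m -> r *: y = 0) -> (forall r, r \in m -> r *: z = 0) ->
  y <> 0 -> exists r, z = r *: y.
Proof.
move=> mm; have [m_sub m1 mmax] := mm.
have soc u : (forall r, r \in m -> r *: u = 0) -> u <> 0 ->
    exists x : R, [/\ x \notin m, e (modpi (rad_submod R) x) = u
      & forall n, maximal n -> x \in n \/ n =i m].
  move=> mu u0.
  (* Essentiality puts a nonzero multiple [r *: u] into the image of [e]. As [m] kills [u] and [r]
     is invertible modulo [m], the element [u] itself is in the image. *)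
  have [r [x [xr ru0]]] : exists r x, e x = r *: u /\ r *: u <> 0.
    apply: contrapT => H; apply: u0; have [_ _ ess] := I_env.
    apply: (ess (fun w => `[< exists r, w = r *: u >])); last first.
    - by apply/asboolP; exists 1; rewrite scale1r.
    - move=> x /asboolP[r xr]; apply: contrapT => x0; apply: H; exists r, x; split=> //.
      by move=> ru0; apply: x0; apply: e_inj; rewrite linear0 xr.
    split; first by apply/asboolP; exists 0; rewrite scale0r.
    move=> a w w' /asboolP[b ->] /asboolP[c ->]; apply/asboolP; exists (a * b + c).
    by rewrite scalerDl scalerA.
  have /mmax[s sr] : r \notin m by apply/negP => /mu.
  have [x' x'x] := modpi_surj (s *: x).
  have ex' : e (modpi (rad_submod R) x') = u.
    rewrite x'x linearZ /= xr scalerA -[LHS]addr0 -(mu _ sr) scalerBl scale1r.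
    by rewrite addrC subrK.
  have mx n : maximal n -> x' \in n \/ n =i m.
    move=> nn; have [n_sub n1 nmax] := nn.
    have [nx|nx] := boolP (x' \in n); [by left | right].
    suff mn : {subset m <= n}.
      move=> w; apply/idP/idP; last exact: mn.
      by have /maximal_idealP[_ _ h] := mm; apply: h.
    move=> w mw; apply/negPn/negP => nw.
    have := maximal_prime nn nw nx; case/negP.
    suff /asboolP/(_ n (proj1 (maximal_idealP _) nn)) : w * x' \in @rad R by [].
    apply/(modpi_eq0 (rad_submod R)); rewrite -[w * x']/(w *: (x' : R^o)) linearZ /=.
    by apply: e_inj; rewrite linearZ linear0 /= ex' mu.
  exists x'; split=> //; apply/negP => mx'; apply: u0; rewrite -ex'.
  suff -> : modpi (rad_submod R) x' = 0 by rewrite linear0.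
  apply/modpi_eq0/asboolP => n /maximal_idealP /mx[//|->//].
move=> my mz y0; have [z0|z0] := pselect (z = 0); first by exists 0; rewrite scale0r.
have [x [mx <- xn]] := soc y my y0; have [x' [mx' <- x'n]] := soc z mz z0.
(* With [s] inverse to [x] modulo [m], the element [x' - x' * s * x] lies in [m], and in every other
   maximal ideal because [x'] does; hence it is in the radical. *)
have [s sx] := mmax x mx; exists (x' * s); rewrite -linearZ -linearZ; congr (e _).
apply/modpi_eq/asboolP => n /maximal_idealP nn.
have [n_sub _ _] := nn; rewrite -[_ *: _]/(x' * s * x).
have [x'n'|->] := x'n n nn.
  have := submodZ n_sub (1 - s * x) x'n'; rewrite -[(1 - s * x) *: _]/((1 - s * x) * x').
  by rewrite mulrBl mul1r mulrC mulrA.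
have := submodZ m_sub x' sx; rewrite -[_ *: _]/(x' * _).
by rewrite mulrBr mulr1 mulrA.
Qed.

(* Both properties are stated elementwise, as [Hom M I] carries no [R]-module
   structure here. *)
Definition dual_fin_gen (M : lmodType R) := exists (n : nat) (g : 'I_n -> {linear M -> I}),
  forall f : {linear M -> I}, exists c : 'I_n -> R, forall x, f x = \sum_i c i *: g i x.

Definition reflexive_module (M : lmodType R) := forall xi : Hom M I -> I,
  (forall a (f g h : Hom M I), (forall x, h x = a *: f x + g x) -> xi h = a *: xi f + xi g) ->
  exists x, forall f, xi f = f x.

(** Injectivity of [I] makes the dual sequence exact, so generators of both dual ends lift;
    reflexivity is the five lemma, carried out on elements. *)
Lemma dual_ext (M' M M'' : lmodType R) (i : {linear M' -> M}) (p : {linear M -> M''}) :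
  short_exact i p -> dual_fin_gen M' /\ reflexive_module M' ->
  dual_fin_gen M'' /\ reflexive_module M'' -> dual_fin_gen M /\ reflexive_module M.
Proof.
move=> [i_inj p_surj ex] [[m [g' g'P]] r'] [[n [g'' g''P]] r''].
have pi0 x : p (i x) = 0 by apply/ex; exists x.
have ext (f : {linear M' -> I}) : exists h : {linear M -> I}, forall x, h (i x) = f x.
  exact: I_inj.
have fact (f : {linear M -> I}) : (forall x, f (i x) = 0) ->
    exists h : {linear M'' -> I}, forall x, h (p x) = f x.
  by move=> f0; apply: factor_surj => // x /ex[y <-].
split.
  have /choice[G GP] : forall k, exists h : {linear M -> I}, forall x, h (i x) = g' k x.
    by move=> k; apply: ext.
  exists (m + n)%N, (fun k => match split k with inl k => G k
    | inr j => (g'' j \o p : {linear _ -> _}) end) => f.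
  have [c cP] := g'P (f \o i : {linear _ -> _}).
  pose fl x := f x - \sum_k c k *: G k x.
  have fl_lin : linear fl.
    move=> a x y; rewrite /fl linearP.
    under eq_bigr => k _ do rewrite linearP scalerDr scalerA mulrC -scalerA.
    by rewrite big_split /= -scaler_sumr scalerBr opprD addrACA.
  pose fL : {linear M -> I} := linear_of fl_lin.
  have [|h hP] := fact fL.
    move=> x; rewrite /= /fl -[f (i x)]/((f \o i) x) cP.
    by under [X in _ - X]eq_bigr => k _ do rewrite GP; rewrite subrr.
  have [d dP] := g''P h.
  exists (fun k => match split k with inl k => c k | inr j => d j end) => x.
  rewrite big_split_ord /=; under eq_bigr => k _ do rewrite (unsplitK (inl k)).
  under [X in _ + X]eq_bigr => k _ do rewrite (unsplitK (inr k)) /=.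
  by rewrite -dP hP /= /fl addrC subrK.
move=> xi xi_lin.
have [x''|x'' x''P] := r'' (fun f => xi (f \o p : {linear _ -> _})).
  by move=> f g h hP; apply: xi_lin => y; rewrite /= hP.
have [x xx''] := p_surj x''.
have kill (f : Hom M I) : (forall y, f (i y) = 0) -> xi f = f x.
  move=> /fact[h hP]; rewrite -hP xx'' -x''P; congr (xi _).
  by apply: Hom_ext => y /=; rewrite hP.
(* The chosen extension [E f] of [f] to [M] need not be linear in [f]. Its defect vanishes on [M'],
   where [xi] is evaluation at [x] by [kill]; so [xi (E f) - E f x] is linear in [f], and [x']
   represents it. *)
have [E EP] := choice ext.
have xiB (f g h : Hom M I) : (forall y, h y = f y - g y) -> xi h = xi f - xi g.
  move=> hP; rewrite (xi_lin 1 h g f) ?scale1r ?addrK // => y.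
  by rewrite scale1r hP subrK.
have [a f g h hP|x' x'P] := r' (fun f => xi (E f) - E f x).
  pose l : {linear M -> I} := (a \*: E f) \+ E g.
  have kP y : ((E h : {linear M -> I}) \- l) (i y) = 0 by rewrite /= !EP hP subrr.
  have := kill ((E h : {linear M -> I}) \- l : {linear M -> I}) kP.
  rewrite (xiB (E h) l) //= (xi_lin a (E f) (E g) l) // => /eqP.
  rewrite subr_eq => /eqP ->.
  by rewrite scalerBr [RHS]addrACA -opprD [LHS]addrAC [X in X + _ = _]addrAC subrr add0r addrC.
exists (x + i x') => f; rewrite linearD -[f (i x')]/((f \o i) x') -x'P.
pose k : Hom M I := (f : Hom M I) - (E (f \o i : {linear _ -> _}) : Hom M I).
have kE y : k y = f y - E (f \o i : {linear _ -> _}) y by [].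
have -> : xi f = xi k + xi (E (f \o i : {linear _ -> _})).
  rewrite (xi_lin 1 k (E (f \o i : {linear _ -> _})) f) ?scale1r // => y.
  by rewrite scale1r kE subrK.
rewrite kill; last by move=> y; rewrite kE EP subrr.
by rewrite kE -addrA; congr (_ + _); exact: addrC.
Qed.

(** By [envelope_socle], every map from [R / m] to [I] is a multiple of the embedding [j]. Since [m]
    kills [xi j], that value is a multiple of [j 1]. *)
Lemma dual_simple m (m_sub : submod_closed m) : @maximal R m ->
  dual_fin_gen (modquot m_sub) /\ reflexive_module (modquot m_sub).
Proof.
move=> mm; have [j j_inj] := simple_into_envelope m_sub mm.
have [_ m1 _] := mm.
have pm (r : R) : modpi m_sub r = r *: modpi m_sub 1.
  by rewrite -linearZ; congr (modpi _ _); rewrite -[_ *: _]/(r * 1) mulr1.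
have fm (f : {linear modquot m_sub -> I}) r : r \in m -> r *: f (modpi m_sub 1) = 0.
  by move=> mr; rewrite -linearZ /= -pm; have /modpi_eq0-> := mr; rewrite linear0.
have j1 : j (modpi m_sub 1) <> 0.
  by rewrite -(linear0 j) => /j_inj/modpi_eq0; apply/negP.
have gen (f : {linear modquot m_sub -> I}) : exists c, forall x, f x = c *: j x.
  have [c cP] := envelope_socle mm (fm j) (fm f) j1; exists c => v.
  have [r <-] := modpi_surj v; rewrite pm !linearZ /= cP !scalerA mulrC //.
split.
  exists 1%N, (fun=> j) => f; have [c cP] := gen f; exists (fun=> c) => x.
  by rewrite big_ord1.
move=> xi xi_lin.
have xi0 : xi (0 : Hom _ _) = 0.
  have := xi_lin (-1) (0 : Hom _ _) (0 : Hom _ _) (0 : Hom _ _).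
  rewrite scaleN1r addNr; apply=> x; rewrite scaleN1r addr0.
  by rewrite -[_ x]/(0 : I) oppr0.
have xiZ a (f h : Hom (modquot m_sub) I) : (forall x, h x = a *: f x) -> xi h = a *: xi f.
  move=> hP; rewrite (xi_lin a f 0 h) ?xi0 ?addr0 // => x.
  by rewrite hP -[X in _ + X]/(0 : I) addr0.
have [r rP] : exists r, xi j = r *: j (modpi m_sub 1).
  apply: (envelope_socle mm (fm j) _ j1) => r mr.
  rewrite -(xiZ r j 0) // => v; have [s <-] := modpi_surj v.
  by rewrite -[LHS]/(0 : I) pm linearZ /= scalerA mulrC -scalerA fm ?scaler0.
exists (r *: modpi m_sub 1) => f; have [c cP] := gen f.
by rewrite (xiZ c j f) // rP cP [j (_ *: _)]linearZ.
Qed.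

Lemma duality (M : lmodType R) : fin_gen M -> dual_fin_gen M /\ reflexive_module M.
Proof.
apply: (@fin_gen_ind R R_artin (fun M => dual_fin_gen M /\ reflexive_module M)) => {M}.
- move=> M M0; split.
    exists 0%N, (fun=> \0) => f; exists (fun=> 0) => x.
    by rewrite big_ord0 (M0 x) linear0.
  move=> xi xi_lin; exists 0 => f; rewrite linear0.
  have := xi_lin (-1) f f f; rewrite scaleN1r addNr; apply=> x.
  by rewrite (M0 x) linear0 scaler0 addr0.
- exact: dual_simple.
- exact: dual_ext.
Qed.

End Duality.

(** * The bimodule DA *)

Section DualBasis.
Variables (A : pzRingType).

Lemma eq_linear_gen (M N : lmodType A) n (g : 'I_n -> M) (f f' : {linear M -> N}) :
  (forall x, exists c : 'I_n -> A, x = \sum_(i < n) c i *: g i) ->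
  (forall i, f (g i) = f' (g i)) -> f =1 f'.
Proof.
move=> gP ff' x; have [c ->] := gP x; rewrite !linear_sum; apply: eq_bigr => i _.
by rewrite !linearZ /= ff'.
Qed.

Section LinearCombination.
Variables (M : lmodType A) (n : nat) (g : 'I_n -> M).
Definition lincomb (c : {ffun 'I_n -> A^o}) : M := \sum_i (c i : A) *: g i.
Fact lincomb_linear : linear lincomb.
Proof.
move=> a c c'; rewrite /lincomb scaler_sumr -big_split; apply: eq_bigr => i _.
by rewrite !ffunE scalerDl -scalerA.
Qed.
HB.instance Definition _ :=
  GRing.isLinear.Build A {ffun 'I_n -> A^o} M *:%R lincomb lincomb_linear.
End LinearCombination.

Lemma dual_basis (Q : lmodType A) : fin_gen Q -> is_projective Q ->
  exists (n : nat) (p : 'I_n -> Q) (al : 'I_n -> {linear Q -> A^o}),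
    forall q, q = \sum_i (al i q : A) *: p i.
Proof.
move=> [n [p pP]] /(_ _ _ (lincomb p) idfun)[].
  move=> q; have [c ->] := pP q; exists [ffun i => c i].
  by apply: eq_bigr => i _; rewrite ffunE.
move=> h hP; exists n, p.
have cl i : linear (fun q => h q i) by move=> a x y; rewrite linearP !ffunE.
exists (fun i => linear_of (cl i)).
by move=> q; rewrite -[LHS]hP.
Qed.

Lemma is_projective_prod (M N : lmodType A) :
  is_projective M -> is_projective N -> is_projective (M * N)%type.
Proof.
move=> PM PN V W g f g_surj.
pose il x : (M * N)%type := (x, 0); pose ir x : (M * N)%type := (0, x).
have il_lin : linear il by move=> a x y; congr pair; rewrite /= ?scaler0 ?addr0.
have ir_lin : linear ir by move=> a x y; congr pair; rewrite /= ?scaler0 ?addr0.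
have [h hP] := PM _ _ g (f \o linear_of il_lin : {linear _ -> _}) g_surj.
have [k kP] := PN _ _ g (f \o linear_of ir_lin : {linear _ -> _}) g_surj.
exists ((h \o fst) \+ (k \o snd)) => -[x y] /=; rewrite linearD hP kP /= -linearD.
by congr (f _); congr pair; rewrite /= ?addr0 ?add0r.
Qed.

Lemma is_zero_projective (M : lmodType A) : is_zero M -> is_projective M.
Proof. by move=> M0 V W g f _; exists \0 => x; rewrite (M0 x) !linear0. Qed.

End DualBasis.

Section TensorLift.
Variables (A : pzRingType) (N : bimodule A) (X : lmodType A).

Definition pure (n : N) (x : X) : tensor N X := tens_class [:: (n, x)].

Lemma tens_class_cat s t :
  tens_class (s ++ t) = tens_class s + tens_class t :> tensor N X.
Proof. exact/esym/tens_addE. Qed.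

Lemma pureDl n n' x : pure (n + n') x = pure n x + pure n' x.
Proof. by rewrite -tens_class_cat; apply/tens_class_eq/tens_addl. Qed.
Lemma pureDr n x x' : pure n (x + x') = pure n x + pure n x'.
Proof. by rewrite -tens_class_cat; apply/tens_class_eq/tens_addr. Qed.
Lemma pure_bal n a x : pure (ract n a) x = pure n (a *: x).
Proof. exact/tens_class_eq/tens_bal. Qed.
Lemma pureZ a n x : pure (a *: n) x = a *: pure n x.
Proof. by rewrite -[RHS]/(tens_scale _ _) tens_scaleE. Qed.

Lemma tensor_ind (T : tensor N X -> Prop) : T 0 ->
  (forall n x u, T u -> T (pure n x + u)) -> forall u, T u.
Proof.
move=> T0 TS u; have [s <-] := tens_class_surj u.
elim: s => [//|[n x] s IH]; rewrite -cat1s tens_class_cat; exact: TS.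
Qed.

(** Stated for additive targets because the trace pairing takes values in [I], which is no
    [A]-module. *)
Lemma tensor_lift_add (V : zmodType) (b : N -> X -> V) :
  (forall n n' x, b (n + n') x = b n x + b n' x) ->
  (forall n x x', b n (x + x') = b n x + b n x') ->
  (forall n a x, b (ract n a) x = b n (a *: x)) ->
  exists F : tensor N X -> V, [/\ F 0 = 0, forall u v, F (u + v) = F u + F v
    & forall n x, F (pure n x) = b n x].
Proof.
move=> bDl bDr bbal; pose f (s : seq (N * X)) := \sum_(p <- s) b p.1 p.2.
have f_cat s t : f (s ++ t) = f s + f t by rewrite /f big_cat.
have f1 n x : f [:: (n, x)] = b n x by rewrite /f big_seq1.
have f_eq s t : tens_eq s t -> f s = f t.
  elim=> {s t} //.
  - by move=> s t u _ -> _.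
  - by move=> s s' t t' _ e _ e'; rewrite !f_cat e e'.
  - by move=> s t; rewrite !f_cat addrC.
  - move=> x; rewrite f1 /f big_nil; apply: (addrI (b 0 x)).
    by rewrite -bDl !addr0.
  - by move=> n n' x; rewrite -[X in _ = f X]cat1s f_cat !f1.
  - by move=> n x x'; rewrite -[X in _ = f X]cat1s f_cat !f1.
  - by move=> n a x; rewrite !f1.
pose F (u : tensor N X) := f (repr u).
have FE s : F (tens_class s) = f s by apply/f_eq/tens_class_eq; exact: reprK.
exists F; split.
- by rewrite -[0]/(tens_class [::]) FE /f big_nil.
- move=> u v; have [s <-] := tens_class_surj u; have [t <-] := tens_class_surj v.
  by rewrite -tens_class_cat !FE f_cat.
- by move=> n x; rewrite FE f1.
Qed.

Lemma tensor_lift (V : lmodType A) (b : N -> X -> V) :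
  (forall n n' x, b (n + n') x = b n x + b n' x) ->
  (forall n x x', b n (x + x') = b n x + b n x') ->
  (forall n a x, b (ract n a) x = b n (a *: x)) ->
  (forall a n x, b (a *: n) x = a *: b n x) ->
  exists F : {linear tensor N X -> V}, forall n x, F (pure n x) = b n x.
Proof.
move=> bDl bDr bbal bZ; have [F [F0 FD Fp]] := tensor_lift_add bDl bDr bbal.
have F_lin : linear F.
  move=> a u v; rewrite FD; congr (_ + _); elim/tensor_ind: u => [|n x u IH].
    by rewrite scaler0 F0 scaler0.
  by rewrite scalerDr !FD IH -pureZ !Fp bZ scalerDr.
by exists (linear_of F_lin).
Qed.

Lemma tensor_fin_gen : fin_gen (N : lmodType A) -> fin_gen X -> fin_gen (tensor N X).
Proof.
move=> fgN [m [g gP]].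
pose h (c : {ffun 'I_m -> N}) : tensor N X := \sum_i pure (c i) (g i).
have h_lin : linear h.
  move=> a c c'; rewrite /h scaler_sumr -big_split; apply: eq_bigr => i _.
  by rewrite !ffunE pureDl pureZ.
apply: (@fin_gen_surj _ _ _ (linear_of h_lin));
  last exact: fin_gen_ffun.
move=> u; elim/tensor_ind: u => [|n x u [c' <-]]; first by exists 0; rewrite linear0.
have [c ->] := gP x.
exists (([ffun i => ract n (c i)] : {ffun 'I_m -> N}) + c'); rewrite linearD; congr (_ + _) => /=.
rewrite /h; under [LHS]eq_bigr => i _ do rewrite ffunE pure_bal.
elim/big_rec2: _ => [|i u1 u2 _ ->]; last by rewrite pureDr.
by apply: (addrI (pure n 0)); rewrite -pureDr !addr0.
Qed.

End TensorLift.

Section AlgebraModules.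
Variables (R : comPzRingType) (R_artin : artinian R).
Variables (A : pzRingType) (alg : algebra_over R A).
Hypothesis A_fg : fin_gen (restr A^o alg : lmodType R).

Section RestrLinear.
Variables (M N : lmodType A) (f : {linear M -> N}).
Definition restr_map (x : restr M alg) : restr N alg := f x.
Fact restr_map_linear : linear restr_map.
Proof. by move=> r x y; rewrite /restr_map -[r *: x]/(alg r *: (x : M)) linearP. Qed.
HB.instance Definition _ :=
  GRing.isLinear.Build R (restr M alg) (restr N alg) *:%R restr_map restr_map_linear.
End RestrLinear.

Section Homothety.
Variables (M : lmodType A) (r : R).
(** [A]-linear because the image of [R] is central; this is what lets [R] act on spaces of
    [A]-linear maps. *)
Definition homothety (x : M) : M := alg r *: x.
Fact homothety_linear : linear homothety.
Proof. by move=> a x y; rewrite /homothety scalerDr !scalerA scalar_map_central. Qed.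
HB.instance Definition _ :=
  GRing.isLinear.Build A M M *:%R homothety homothety_linear.
End Homothety.

Lemma restr_fin_gen (M : lmodType A) : fin_gen M -> fin_gen (restr M alg : lmodType R).
Proof.
move=> [n [g gP]].
pose h (c : {ffun 'I_n -> restr A^o alg}) : restr M alg := \sum_i (c i : A) *: g i.
have h_lin : linear h.
  move=> r c c'; rewrite /h -[RHS]/(alg r *: (_ : M) + _ : M) scaler_sumr -big_split.
  apply: eq_bigr => i _; rewrite !ffunE.
  by rewrite -[_ *: c i]/(alg r * (c i : A)) scalerDl -scalerA.
apply: (@fin_gen_surj _ _ _ (linear_of h_lin));
  last exact: fin_gen_ffun.
move=> x; have [c ->] := gP x; exists [ffun i => c i : restr A^o alg].
by apply: eq_bigr => i _; rewrite ffunE.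
Qed.

Lemma fin_gen_restr (M : lmodType A) : fin_gen (restr M alg : lmodType R) -> fin_gen M.
Proof.
by move=> [n [g gP]]; exists n, g => x; have [c ->] := gP x; exists (fun i => alg (c i)).
Qed.

Lemma alg_fin_gen_inj (M N : lmodType A) (f : {linear M -> N}) :
  injective f -> fin_gen N -> fin_gen M.
Proof.
by move=> fi /restr_fin_gen/(fin_gen_inj R_artin (f := restr_map f) fi)/fin_gen_restr.
Qed.

End AlgebraModules.

Section DualBimodule.
Variables (R : comPzRingType) (R_artin : artinian R).
Variables (A : pzRingType) (alg : algebra_over R A).
Hypothesis A_fg : fin_gen (restr A^o alg : lmodType R).
Variables (I : lmodType R) (e : {linear residue_mod R -> I}).
Hypothesis I_env : injective_envelope e.
Local Notation DA := (dual_bimod alg I).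

Definition dual_eval (f : DA) (a : A) : I :=
  ((f : Hom (restr A^o alg) I) : {linear restr A^o alg -> I}) a.

Lemma dual_evalD f g a : dual_eval (f + g) a = dual_eval f a + dual_eval g a.
Proof. by []. Qed.
Lemma dual_evalDr f a b : dual_eval f (a + b) = dual_eval f a + dual_eval f b.
Proof. by rewrite /dual_eval -linearD. Qed.
Lemma dual_eval0 f : dual_eval f 0 = 0.
Proof. by rewrite /dual_eval; exact: linear0. Qed.
Lemma dual_eval_sum f n (c : 'I_n -> A) :
  dual_eval f (\sum_i c i) = \sum_i dual_eval f (c i).
Proof. by elim/big_rec2: _ => [|i x y _ <-]; [exact: dual_eval0 | rewrite dual_evalDr]. Qed.
Lemma dual_eval_lact a (f : DA) b : dual_eval (a *: f) b = dual_eval f (b * a).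
Proof. by []. Qed.
Lemma dual_eval_ract (f : DA) a b : dual_eval (ract f a) b = dual_eval f (a * b).
Proof. by []. Qed.
Lemma dual_evalZ f r a : dual_eval f (alg r * a) = r *: dual_eval f a.
Proof. by rewrite /dual_eval -linearZ. Qed.

Lemma dual_eval_inj a b : (forall f, dual_eval f a = dual_eval f b) -> a = b.
Proof.
move=> fab; apply/eqP; rewrite -subr_eq0; apply/negPn/negP => ab0.
have [||xi [_]] := @envelope_cogenerator R R_artin I e I_env (restr A^o alg) (pred1 0) (a - b).
- by split=> [|r x y /eqP-> /eqP->]; rewrite inE ?scaler0 ?addr0.
- by [].
by rewrite (linearB xi) -[xi a]/(dual_eval xi a) fab subrr.
Qed.

Lemma dual_alg_fin_gen : fin_gen (DA : lmodType A).
Proof.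
have [[n [g gP]] _] := duality R_artin I_env A_fg.
exists n, g => f; have [c cP] := gP f; exists (fun i => alg (c i)).
apply: Hom_ext => x; rewrite cP.
have -> : forall (h : DA) y, (h : Hom _ _) y = dual_eval h y by [].
elim/big_rec2: _ => // i u v _ ->.
rewrite dual_evalD dual_eval_lact -scalar_map_central dual_evalZ //.
Qed.

Lemma bidual_alg (xi : DA -> I) : (forall f g, xi (f + g) = xi f + xi g) ->
  (forall r f, xi (alg r *: f) = r *: xi f) ->
  exists a, forall f, xi f = dual_eval f a.
Proof.
move=> xiD xiZ; have [_ /(_ xi)[|a aP]] := duality R_artin I_env A_fg; last by exists a.
move=> r f g h hP; rewrite -xiZ -xiD; congr (xi _); apply: Hom_ext => x.
rewrite hP -[RHS]/(dual_eval (alg r *: (f : DA) + (g : DA)) x) dual_evalD dual_eval_lact.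
by rewrite -scalar_map_central dual_evalZ.
Qed.

(** Evaluation at finitely many generators of [DA] embeds the module into a power of [Y]. This is
    [R]-linear since the left and right actions of [R] on [DA] agree. *)
Lemma bimod_hom_fin_gen (Y : lmodType A) : fin_gen Y -> fin_gen (bimod_hom DA Y).
Proof.
move=> fgY; apply: (@fin_gen_restr R A alg).
have [n [g gP]] := dual_alg_fin_gen.
pose h (f : restr (bimod_hom DA Y) alg) : {ffun 'I_n -> restr Y alg} :=
  [ffun i => ((f : Hom DA Y) : {linear DA -> Y}) (g i)].
have h_lin : linear h.
  move=> r f f'; apply/ffunP => i; rewrite !ffunE.
  rewrite -[LHS]/(((f : Hom DA Y) : {linear DA -> Y}) (ract (g i) (alg r)) + _).
  congr (_ + _).
  rewrite -[RHS]/(alg r *: ((f : Hom DA Y) : {linear DA -> Y}) (g i)) -linearZ.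
  congr (_ _); apply: Hom_ext => x.
  rewrite -[LHS]/(dual_eval (ract (g i) (alg r)) x) -[RHS]/(dual_eval (alg r *: g i) x).
  by rewrite dual_eval_ract dual_eval_lact scalar_map_central.
apply: (fin_gen_inj R_artin
  (f := linear_of h_lin)); last first.
  by apply: fin_gen_ffun; apply: restr_fin_gen.
move=> f f' /ffunP hff'; apply: Hom_ext; apply: (eq_linear_gen gP) => i.
by have := hff' i; rewrite !ffunE.
Qed.

Lemma dual_tensor_fin_gen (X : lmodType A) : fin_gen X -> fin_gen (tensor DA X).
Proof. by move=> fgX; apply: tensor_fin_gen => //; apply: dual_alg_fin_gen. Qed.

Section Trace.
Variables (X : lmodType A).
Local Notation T := (tensor DA X).

(** [t al] is [DA (x) al] followed by [DA (x) A = DA] and evaluation at 1. The last clause moves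
    scalars across the pairing; it is what allows changes of dual basis below. *)
Lemma trace_pairing : exists t : {linear X -> A^o} -> T -> I,
  [/\ forall al u v, t al (u + v) = t al u + t al v,
      forall al f x, t al (pure f x) = dual_eval f (al x),
      forall al, t al 0 = 0
    & forall n (al : 'I_n -> {linear X -> A^o}) (a : 'I_n -> A) (be : {linear X -> A^o}),
        (forall x, \sum_i (al i x : A) * a i = be x) ->
        forall u, \sum_i t (al i) (a i *: u) = t be u].
Proof.
have /choice[t tP] : forall al : {linear X -> A^o}, exists F : T -> I,
    [/\ F 0 = 0, forall u v, F (u + v) = F u + F v
      & forall f x, F (pure f x) = dual_eval f (al x)].
  move=> al; apply: tensor_lift_add => [f g x|f x y|f a x] //.
    by rewrite linearD dual_evalDr.
  by rewrite dual_eval_ract linearZ.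
exists t.
have t0 al : t al 0 = 0 by case: (tP al).
have tD al u v : t al (u + v) = t al u + t al v by case: (tP al).
have tp al f x : t al (pure f x) = dual_eval f (al x) by case: (tP al).
split=> // n al a be albe u.
elim/tensor_ind: u => [|f x u IH].
  by rewrite t0 big1 // => i _; rewrite scaler0 t0.
under eq_bigr => i _ do rewrite scalerDr tD -pureZ tp dual_eval_lact.
by rewrite big_split /= IH -dual_eval_sum albe tD tp.
Qed.

End Trace.

(* The functional [sum_i <p_i^* phi, psi p_i>] is the trace of
   [(DA (x) phi) \o psi]; it makes [Hom (X, Q)] and [Hom (Q, DA (x) X)] dual
   to each other, naturally in the projective module [Q]. *)
Lemma tensor_surj_inj (X Q1 Q0 : lmodType A) (d : {linear Q1 -> Q0}) :
  fin_gen Q1 -> is_projective Q1 -> fin_gen Q0 -> is_projective Q0 ->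
  (forall psi : {linear Q1 -> tensor DA X},
     exists psi' : {linear Q0 -> tensor DA X}, forall q, psi q = psi' (d q)) ->
  forall phi : {linear X -> Q1}, (forall x, d (phi x) = 0) -> forall x, phi x = 0.
Proof.
move=> fg1 pr1 fg0 pr0 dsurj phi dphi x.
have [n [p [al alP]]] := dual_basis fg1 pr1.
have [m [q [be beP]]] := dual_basis fg0 pr0.
have [t [tD tp t0 tS]] := trace_pairing X.
have tsum ga k (u : 'I_k -> tensor DA X) : t ga (\sum_i u i) = \sum_i t ga (u i).
  by elim/big_rec2: _ => // i u1 u2 _ <-; rewrite tD.
rewrite [LHS]alP big1 // => k _; suff -> : al k (phi x) = 0 by rewrite scale0r.
apply: dual_eval_inj => f; rewrite dual_eval0.
(* For this rank one map the trace equals [f (al k (phi x))]. As [psi] factors through [d], the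
   trace can also be computed over the dual basis of [Q0], where only [d \o phi = 0] occurs. *)
pose psi : {linear Q1 -> tensor DA X} := scale_vector (pure f x) \o al k.
have psiP y : psi y = (al k y : A) *: pure f x by [].
have [psi' psi'P] := dsurj psi.
have tr : \sum_i t (al i \o phi : {linear X -> A^o}) (psi (p i)) = 0.
  transitivity (\sum_i \sum_j t (al i \o phi : {linear X -> A^o})
      ((be j (d (p i)) : A) *: psi' (q j))).
    apply: eq_bigr => i _; rewrite psi'P [in LHS](beP (d (p i))) linear_sum tsum.
    by apply: eq_bigr => j _; rewrite linearZ.
  rewrite exchange_big big1 // => j _ /=.
  rewrite (tS _ _ _ (be j \o (d \o phi) : {linear X -> A^o})); last first.
    move=> y; rewrite /= [in RHS](alP (phi y)) !linear_sum; apply: eq_bigr => i _.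
    by rewrite !linearZ.
  elim/tensor_ind: (psi' (q j)) => // g y u IH.
  by rewrite tD IH tp /= dphi linear0 dual_eval0 addr0.
rewrite -tr; under eq_bigr => i _ do rewrite psiP.
rewrite (tS _ _ _ (al k \o phi : {linear X -> A^o})) ?tp // => y /=.
by rewrite [in RHS](alP (phi y)) linear_sum; apply: eq_bigr => i _; rewrite linearZ.
Qed.

(** By separation: a [psi] that does not factor through [d] is detected by some [xi] into [I]
    vanishing on all maps that do. Reflexivity of [A] turns [xi] into the trace against a map
    [phi : X -> Q1], and vanishing on those maps says [d \o phi = 0]. *)
Lemma tensor_inj_surj (X Q1 Q0 : lmodType A) (d : {linear Q1 -> Q0}) :
  fin_gen Q1 -> is_projective Q1 -> fin_gen Q0 -> is_projective Q0 ->
  (forall phi : {linear X -> Q1}, (forall x, d (phi x) = 0) -> forall x, phi x = 0) ->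
  forall psi : {linear Q1 -> tensor DA X},
    exists psi' : {linear Q0 -> tensor DA X}, forall q, psi q = psi' (d q).
Proof.
move=> fg1 pr1 fg0 pr0 dinj psi; apply: contrapT => Npsi.
have [n [p [al alP]]] := dual_basis fg1 pr1.
have [m [q [be beP]]] := dual_basis fg0 pr0.
have [t [tD tp t0 tS]] := trace_pairing X.
have tsum ga k (u : 'I_k -> tensor DA X) : t ga (\sum_i u i) = \sum_i t ga (u i).
  by elim/big_rec2: _ => // i u1 u2 _ <-; rewrite tD.
(* Maps out of [Q1] are represented by their values on the generators [p i]. *)
pose V : lmodType R := {ffun 'I_n -> restr (tensor DA X) alg}.
pose W : {pred V} := fun v => `[< exists psi' : {linear Q0 -> tensor DA X},
  forall i, v i = psi' (d (p i)) >].
have W_sub : submod_closed W.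
  split; first by apply/asboolP; exists \0 => i; rewrite ffunE.
  move=> r v w /asboolP[f fP] /asboolP[g gP]; apply/asboolP.
  by exists ((homothety alg r \o f) \+ g) => i; rewrite !ffunE fP gP.
pose v : V := [ffun i => psi (p i)].
have [|xi [xiW]] := @envelope_cogenerator R R_artin I e I_env V W v W_sub.
  apply/asboolP => -[psi' psi'P]; apply: Npsi; exists psi'.
  apply: (@eq_linear_gen _ _ _ n p psi (psi' \o d : {linear _ -> _})).
    by move=> y; exists (fun i => al i y).
  by move=> i /=; rewrite -psi'P ffunE.
apply.
pose sg i (u : restr (tensor DA X) alg) : V := [ffun j => if j == i then u else 0].
have sg_lin i : linear (sg i).
  by move=> r u w; apply/ffunP => j; rewrite !ffunE; case: eqP => // _; rewrite scaler0 addr0.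
pose sL i : {linear restr (tensor DA X) alg -> V} :=
  linear_of (sg_lin i).
have sgP (w : V) : w = \sum_i sL i (w i).
  apply/ffunP => j; rewrite sum_ffunE (bigD1 j) //= ffunE eqxx big1 ?addr0 // => i ij.
  by rewrite ffunE eq_sym (negPf ij).
have pD i f g (x : X) : xi (sL i (pure (f + g) x)) = xi (sL i (pure f x)) + xi (sL i (pure g x)).
  by rewrite pureDl !linearD.
have pZ i r f (x : X) : xi (sL i (pure (alg r *: f) x)) = r *: xi (sL i (pure f x)).
  by rewrite pureZ -[alg r *: _]/(r *: (_ : restr (tensor DA X) alg)) !linearZ.
have /choice[a aP] : forall i, exists a : {linear X -> A^o}, forall f x,
    xi (sL i (pure f x)) = dual_eval f (a x).
  move=> i; have [||| a aP] := @linear_of_graph A X A^o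
      (fun x a => forall f, xi (sL i (pure f x)) = dual_eval f a).
  - move=> x; have [||a aP] := @bidual_alg (fun f => xi (sL i (pure f x))); last by exists a.
      by move=> f g; apply: pD.
    by move=> r f; rewrite pZ.
  - move=> b x c x' c' xc x'c' f; rewrite pureDr !linearD x'c' dual_evalDr; congr (_ + _).
    by rewrite -pure_bal xc dual_eval_ract.
  - by move=> x c c' xc xc'; apply: dual_eval_inj => f; rewrite -xc -xc'.
  by exists a => f x; apply: aP.
have xiE i u : xi (sL i u) = t (a i) u.
  elim/tensor_ind: u => [|f x u IH]; first by rewrite !linear0 t0.
  by rewrite tD tp -aP -IH !linearD.
pose ph x := \sum_i (a i x : A) *: p i.
have ph_lin : linear ph.
  move=> b x y; rewrite /ph scaler_sumr -big_split; apply: eq_bigr => i _.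
  by rewrite linearP scalerDl -scalerA.
pose phi : {linear X -> Q1} := linear_of ph_lin.
have phi0 x : phi x = 0.
  apply: dinj => {}x; rewrite [LHS]beP big1 // => k _.
  suff -> : be k (d (phi x)) = 0 by rewrite scale0r.
  apply: dual_eval_inj => f; rewrite dual_eval0.
  pose psi' : {linear Q0 -> tensor DA X} := scale_vector (pure f x) \o be k.
  have psi'P y : psi' y = (be k y : A) *: pure f x by [].
  pose w : V := [ffun i => psi' (d (p i))].
  have <- : xi w = 0 by apply: xiW; apply/asboolP; exists psi' => i; rewrite ffunE.
  rewrite [w]sgP [in RHS](linear_sum xi); under [RHS]eq_bigr => i _ do rewrite xiE ffunE psi'P.
  rewrite (tS _ _ _ (be k \o (d \o phi) : {linear X -> A^o})) ?tp // => y.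
  by rewrite /= /ph !linear_sum; apply: eq_bigr => i _; rewrite !linearZ.
rewrite [v]sgP (linear_sum xi); under eq_bigr => i _ do rewrite xiE ffunE.
(* The [a i] need not be the coordinates [al i \o phi]; expanding each [p i] in the dual basis
   replaces the former by the latter, which are zero. *)
transitivity (\sum_i \sum_j t (a i) ((al j (p i) : A) *: psi (p j))).
  apply: eq_bigr => i _; rewrite [in LHS](alP (p i)) linear_sum tsum.
  by apply: eq_bigr => j _; rewrite linearZ.
rewrite exchange_big big1 // => j _ /=.
rewrite (tS _ _ _ (al j \o phi : {linear X -> A^o})); last first.
  by move=> y; rewrite /= /ph linear_sum; apply: eq_bigr => i _; rewrite linearZ.
elim/tensor_ind: (psi (p j)) => // g y u IH.
by rewrite tD IH tp /= -[ph y]/(phi y) phi0 linear0 dual_eval0 addr0.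
Qed.

End DualBimodule.

(** * Morphisms from a two-term complex of projectives *)

Section Pairing.
Variable A : pzRingType.

Section Pair.
Variables (M N1 N2 : lmodType A) (f : {linear M -> N1}) (g : {linear M -> N2}).
Definition pair_map (x : M) : N1 * N2 := (f x, g x).
Fact pair_map_linear : linear pair_map.
Proof. by move=> a x y; rewrite /pair_map !linearP. Qed.
HB.instance Definition _ :=
  GRing.isLinear.Build A M (N1 * N2)%type *:%R pair_map pair_map_linear.
End Pair.

Section Copair.
Variables (M1 M2 N : lmodType A) (f : {linear M1 -> N}) (g : {linear M2 -> N}).
Definition copair_map (x : M1 * M2) : N := f x.1 + g x.2.
Fact copair_map_linear : linear copair_map.
Proof.
by move=> a x y; rewrite /copair_map !linearP scalerDr addrACA.
Qed.
HB.instance Definition _ :=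
  GRing.isLinear.Build A (M1 * M2)%type N *:%R copair_map copair_map_linear.
End Copair.

(** Lifts along a [g] that covers the image of [f], by lifting the values at a dual basis; the image
    of [g] need not be made into a module first. *)
Lemma proj_lift (P M N : lmodType A) (g : {linear M -> N}) (f : {linear P -> N}) :
  fin_gen P -> is_projective P -> (forall x, exists m, g m = f x) ->
  exists h : {linear P -> M}, forall x, g (h x) = f x.
Proof.
move=> fgP prP gf; have [n [p [al alP]]] := dual_basis fgP prP.
have /choice[m mP] : forall i, exists m, g m = f (p i) by [].
have h_lin : linear (fun x => \sum_i (al i x : A) *: m i).
  move=> a x y; rewrite scaler_sumr -big_split; apply: eq_bigr => i _.
  by rewrite linearP scalerDl -scalerA.
exists (linear_of h_lin) => x; rewrite [in RHS](alP x) !linear_sum.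
by apply: eq_bigr => i _; rewrite !linearZ /= mP.
Qed.

End Pairing.

Section Homotopies.
Variable A : pzRingType.
Implicit Types X Y Z P : complex A.

Lemma transport_neq (X : int -> lmodType A) i j (x : X i) :
  i != j -> transport j x = 0.
Proof. by rewrite /transport; case: eqP. Qed.

Section Extension.
Variables (X Y : int -> lmodType A) (a b : int) (f : {linear X a -> Y b}).

Definition ext_map i j : {linear X i -> Y j} :=
  @transport A Y b j \o (f \o @transport A X i a).

Lemma ext_mapE x : ext_map a b x = f x.
Proof. by rewrite /= !transport_id. Qed.
Lemma ext_map0l i j x : i != a -> ext_map i j x = 0.
Proof. by move=> ia; rewrite /= (transport_neq x ia) !linear0. Qed.
Lemma ext_map0r i j x : j != b -> ext_map i j x = 0.
Proof. by rewrite eq_sym => bj; rewrite /= transport_neq. Qed.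
End Extension.

(** The degrees are free variables tied by equations, so that closed degrees can be substituted
    without transport. *)
Lemma homotopicP X Y (f g : chain_map X Y) : homotopic f g <->
  exists h : forall i j, {linear X i -> Y j}, forall i j k, i = j + 1 -> k = i + 1 ->
    forall x, f i x - g i x = diff Y j i (h i j x) + h k i (diff X i k x).
Proof.
split=> -[h hP]; exists h => i; last by move=> x; apply: hP; rewrite ?subrK.
move=> j k ij -> x; have -> : j = i - 1 by rewrite ij addrK.
exact: hP.
Qed.

Lemma homotopic_ext X Y (f g : chain_map X Y) :
  (forall i x, f i x = g i x) -> homotopic f g.
Proof.
move=> fg; exists (fun i j => \0) => i x; rewrite fg subrr linear0.
by rewrite add0r.
Qed.

Lemma homotopic_sym X Y (f g : chain_map X Y) : homotopic f g -> homotopic g f.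
Proof.
move=> [h hP]; exists (fun i j => \- h i j) => i x.
by rewrite -opprB hP opprD /= linearN.
Qed.

Lemma homotopic_trans X Y (f g k : chain_map X Y) :
  homotopic f g -> homotopic g k -> homotopic f k.
Proof.
move=> [h hP] [h' h'P]; exists (fun i j => h i j \+ h' i j) => i x.
by rewrite /= linearD addrACA -hP -h'P addrA subrK.
Qed.

Lemma homotopic_compl X Y Z (k : chain_map Y Z) (f g : chain_map X Y) :
  homotopic f g -> homotopic (chain_comp k f) (chain_comp k g).
Proof.
move=> [h hP]; exists (fun i j => k j \o h i j : {linear _ -> _}) => i x.
by rewrite /= -linearB hP linearD cmap_diff.
Qed.

Lemma homotopic_compr X Y Z (k : chain_map X Y) (f g : chain_map Y Z) :
  homotopic f g -> homotopic (chain_comp f k) (chain_comp g k).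
Proof.
move=> [h hP]; exists (fun i j => h i j \o k i : {linear _ -> _}) => i x.
by rewrite /= hP cmap_diff.
Qed.

Definition two_term X := forall i : int, i != -1 -> i != 0 -> is_zero (X i).

Lemma two_term_ind X (T : forall i, X i -> Prop) : two_term X ->
  (forall x, T (-1) x) -> (forall x, T 0 x) -> (forall i, T i 0) ->
  forall i x, T i x.
Proof.
move=> X2 T1 T0 Tz i x; have [ei|i1] := eqVneq i (-1); first by subst i.
have [ei|i0] := eqVneq i 0; first by subst i.
by rewrite (X2 i i1 i0 x).
Qed.

Section TwoTermMap.
Variables (X Y : complex A) (X2 : two_term X).
Variables (f1 : {linear X (-1) -> Y (-1)}) (f0 : {linear X 0 -> Y 0}).
Hypothesis f_comm : forall x, f0 (diff X (-1) 0 x) = diff Y (-1) 0 (f1 x).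
Hypothesis f_cycle : forall x, diff Y 0 1 (f0 x) = 0.

Definition two_term_map_fun i : {linear X i -> Y i} :=
  ext_map f1 i i \+ ext_map f0 i i.

Lemma two_term_map_funE1 x : two_term_map_fun (-1) x = f1 x.
Proof. by rewrite -[LHS]/(_ + _) ext_mapE ext_map0l ?addr0. Qed.
Lemma two_term_map_funE0 x : two_term_map_fun 0 x = f0 x.
Proof. by rewrite -[LHS]/(_ + _) ext_mapE ext_map0l ?add0r. Qed.

Fact two_term_map_diff i j x :
  two_term_map_fun j (diff X i j x) = diff Y i j (two_term_map_fun i x).
Proof.
have [ij|ij] := eqVneq j (i + 1); last by rewrite !diff_shape ?linear0.
move: i x ij; apply: (two_term_ind X2) => [x|x|i] ij; last by rewrite !linear0.
  have {}ij : j = 0 by [].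
  by subst j; rewrite two_term_map_funE0 two_term_map_funE1.
have {}ij : j = 1 by [].
subst j; rewrite two_term_map_funE0 f_cycle (X2 _ _ (diff X 0 1 x)) //.
by rewrite linear0.
Qed.

Definition two_term_map : chain_map X Y := ChainMap two_term_map_diff.

Lemma two_term_mapE1 x : two_term_map (-1) x = f1 x.
Proof. exact: two_term_map_funE1. Qed.
Lemma two_term_mapE0 x : two_term_map 0 x = f0 x.
Proof. exact: two_term_map_funE0. Qed.

End TwoTermMap.

Lemma two_term_homotopic X Y (f g : chain_map X Y) : two_term X ->
  homotopic f g <-> exists (h0 : {linear X 0 -> Y (-1)}) (h1 : {linear X (-1) -> Y (-2)}),
    (forall x, f 0 x - g 0 x = diff Y (-1) 0 (h0 x)) /\
    (forall x, f (-1) x - g (-1) x = diff Y (-2) (-1) (h1 x) + h0 (diff X (-1) 0 x)).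
Proof.
move=> X2; split=> [/homotopicP[h hP]|[h0 [h1 [h0P h1P]]]].
  exists (h 0 (-1)), (h (-1) (-2)); split=> x; last exact: hP.
  rewrite (hP 0 (-1) 1) // (X2 1 _ _ (diff X 0 1 x)) // linear0 addr0 //.
pose h i j : {linear X i -> Y j} := ext_map h0 i j \+ ext_map h1 i j.
have hE i j x : h i j x = ext_map h0 i j x + ext_map h1 i j x by [].
apply/homotopicP; exists h => i j k ij ik x.
move: i x ij ik; apply: (two_term_ind X2) => [x|x|i] ij ik; last by rewrite !(linear0, addr0).
  have {}ij : j = -2 by apply: (addIr 1); rewrite -ij.
  have {}ik : k = 0 by [].
  subst j k; rewrite h1P !hE !ext_mapE ext_map0l ?add0r //.
  by rewrite [ext_map h1 _ _ _]ext_map0l ?addr0.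
have {}ij : j = -1 by apply: (addIr 1); rewrite -ij.
have {}ik : k = 1 by [].
subst j k; rewrite h0P !hE !ext_mapE ext_map0l ?add0r //.
rewrite [ext_map h1 _ _ _]ext_map0l ?addr0 // (X2 1 _ _ (diff X 0 1 x)) //.
by rewrite linear0 addr0.
Qed.

Lemma quasi_iso_surj X Y (f : chain_map X Y) : quasi_iso f ->
  forall i j k, j = i + 1 -> k = j + 1 -> forall y, diff Y j k y = 0 ->
  exists x y', diff X j k x = 0 /\ f j x - y = diff Y i j y'.
Proof.
move=> qf i j k ij -> y y0; have -> : i = j - 1 by rewrite ij addrK.
have cy : y \in @is_cycle A Y j by rewrite unfold_in y0.
have [g _ gK] := qf j; have := gK (modpi (boundaries_submod Y j) (Cycle cy)).
have [z <-] := modpi_surj (g (modpi (boundaries_submod Y j) (Cycle cy))).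
rewrite cohomology_mapE => /modpi_eq/asboolP[y' y'P].
by exists (cycle_val z), y'; rewrite y'P; split=> //; apply/eqP/(cycleP z).
Qed.

Lemma quasi_iso_inj X Y (f : chain_map X Y) : quasi_iso f ->
  forall i j k, j = i + 1 -> k = j + 1 -> forall x y, diff X j k x = 0 ->
  f j x = diff Y i j y -> exists x', diff X i j x' = x.
Proof.
move=> qf i j k ij -> x; have {ij}-> : i = j - 1 by rewrite ij addrK.
move=> y x0 fxy; have cx : x \in @is_cycle A X j by rewrite unfold_in x0.
have : cohomology_map f (modpi (boundaries_submod X j) (Cycle cx)) =
       cohomology_map f (modpi (boundaries_submod X j) 0).
  rewrite !cohomology_mapE; apply/modpi_eq/asboolP; exists y.
  by rewrite -fxy /= linear0 subr0.
move=> /(bij_inj (qf j))/modpi_eq/asboolP[x' x'P]; exists x'.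
by rewrite x'P /= subr0.
Qed.

Lemma homotopic_id_quasi_iso X (f : chain_map X X) :
  homotopic f (chain_id X) -> quasi_iso f.
Proof.
move=> [h hP] i; have fid (c : cohomology X i) : cohomology_map f c = c.
  have [z <-] := modpi_surj c; rewrite cohomology_mapE; apply/modpi_eq/asboolP.
  exists (h i (i - 1) (cycle_val z)); have := hP i (cycle_val z).
  by rewrite (eqP (cycleP z)) linear0 addr0 => <-.
by exists id.
Qed.

Lemma quasi_iso_id X : quasi_iso (chain_id X).
Proof. by apply: homotopic_id_quasi_iso; apply: homotopic_ext. Qed.

Section TwoTermProjective.
Variable P : complex A.
Hypotheses (P2 : two_term P) (P_proj : forall i, fin_gen (P i) /\ is_projective (P i)).

(** Bounded complexes of projectives are homotopically projective. With two terms, one lifting in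
    each degree gives the section and the homotopy. *)
Lemma quasi_iso_section Z (q : chain_map Z P) : quasi_iso q ->
  exists u : chain_map P Z, homotopic (chain_comp q u) (chain_id P).
Proof.
move=> qq.
(* One lifting gives both [u0] and the homotopy [h0]: cycles [z] and elements [y] with
   [q z + d y = p] exist because [q] is onto on [H^0]. *)
have [|uh uhP] := @proj_lift A _ _ _
  (pair_map (diff Z 0 1 \o fst : {linear (Z 0 * P (-1))%type -> _})
            (copair_map (q 0) (diff P (-1) 0)))
  (pair_map \0 idfun) (P_proj 0).1 (P_proj 0).2.
  move=> p; have [|z [y [z0 zP]]] := @quasi_iso_surj _ _ _ qq (-1) 0 1 erefl erefl p.
    by rewrite (P2 _ _ (diff P 0 1 p)).
  exists (z, - y); congr pair => //=; rewrite /copair_map /= linearN /= -zP.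
  by rewrite opprB addrC subrK.
pose u0 : {linear P 0 -> Z 0} := fst \o uh; pose h0 : {linear P 0 -> P (-1)} := snd \o uh.
have u0_cyc x : diff Z 0 1 (u0 x) = 0 by have [] := uhP x.
have u0P x : q 0 (u0 x) + diff P (-1) 0 (h0 x) = x by have [] := uhP x.
(* Injectivity on [H^0] gives [z] bounding [u0 (d p)]; surjectivity on [H^{-1}] gives a cycle that
   corrects [z] so that its image under [q] is exactly [p - h0 (d p)]. *)
have [|u1 u1P] := @proj_lift A _ _ _ (pair_map (diff Z (-1) 0) (q (-1)))
    (pair_map (u0 \o diff P (-1) 0) (idfun \- (h0 \o diff P (-1) 0)))
    (P_proj (-1)).1 (P_proj (-1)).2.
  move=> p; set p' := p - h0 (diff P (-1) 0 p).
  have [||z zP] := @quasi_iso_inj _ _ _ qq (-1) 0 1 erefl erefl (u0 (diff P (-1) 0 p)) p'.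
  - exact: u0_cyc.
  - by rewrite /p' linearB /= -[X in X - _]u0P addrK.
  have [|z' [y' [z'0 z'P]]] := @quasi_iso_surj _ _ _ qq (-2) (-1) 0 erefl erefl (q (-1) z - p').
    rewrite linearB -cmap_diff zP /p' linearB /= -[X in _ - (X - _)]u0P.
    by rewrite addrK subrr.
  exists (z - z'); congr pair => /=; first by rewrite linearB zP z'0 subr0.
  have := z'P; rewrite (P2 _ _ y') // linear0 => /eqP; rewrite subr_eq0 => /eqP z'q.
  by rewrite linearB z'q subKr.
have u1d x : diff Z (-1) 0 (u1 x) = u0 (diff P (-1) 0 x) by have [] := u1P x.
have u1q x : q (-1) (u1 x) = x - h0 (diff P (-1) 0 x) by have [] := u1P x.
pose u := two_term_map P2 (fun x => esym (u1d x)) u0_cyc.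
exists u; apply/two_term_homotopic => //; exists (\- h0), \0; split=> x.
  rewrite -[LHS]/(q 0 (u 0 x) - x) two_term_mapE0 linearN /=.
  by rewrite -[X in _ - X]u0P opprD addrA subrr add0r.
rewrite -[LHS]/(q (-1) (u (-1) x) - x) two_term_mapE1 linear0 add0r.
by rewrite u1q /= addrAC subrr add0r.
Qed.

(** Denominators of roofs out of [P] have sections, so [Hom (P, Y)] vanishes exactly when every
    chain map [P -> Y] is null-homotopic. *)
Lemma derived_Hom_two_term Y : derived_Hom_eq0 P Y <->
  forall (f1 : {linear P (-1) -> Y (-1)}) (f0 : {linear P 0 -> Y 0}),
    (forall x, f0 (diff P (-1) 0 x) = diff Y (-1) 0 (f1 x)) ->
    (forall x, diff Y 0 1 (f0 x) = 0) ->
  exists (h0 : {linear P 0 -> Y (-1)}) (h1 : {linear P (-1) -> Y (-2)}),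
    (forall x, f0 x = diff Y (-1) 0 (h0 x)) /\
    (forall x, f1 x = diff Y (-2) (-1) (h1 x) + h0 (diff P (-1) 0 x)).
Proof.
split=> [PY f1 f0 f_comm f_cyc|null r s].
  pose f := two_term_map P2 f_comm f_cyc.
  have [z z0] : exists z : chain_map P Y, forall i x, z i x = 0.
    by exists (@ChainMap A P Y (fun i => \0) (fun i j x => esym (linear0 (diff Y i j)))).
  have [W [u [v [uq uv fz]]]] :=
    PY (@Roof A P Y P (chain_id P) f (quasi_iso_id P))
       (@Roof A P Y P (chain_id P) z (quasi_iso_id P)).
  have [w wP] := quasi_iso_section uq.
  have /two_term_homotopic[]// : homotopic f z.
    apply: (homotopic_trans (g := chain_comp f (chain_comp (chain_comp (chain_id P) u) w))).
      apply: homotopic_sym; apply: homotopic_trans (homotopic_compl f wP) _.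
      exact: homotopic_ext.
    apply: (homotopic_trans (g := chain_comp (chain_comp f u) w)).
      exact: homotopic_ext.
    apply: homotopic_trans (homotopic_compr w fz) _.
    by apply: homotopic_ext => i x /=; rewrite !z0.
  move=> h0 [h1 [h0P h1P]]; exists h0, h1; split=> x.
    by rewrite -h0P z0 subr0 two_term_mapE0.
  by rewrite -h1P z0 subr0 two_term_mapE1.
have all_htpy (f g : chain_map P Y) : homotopic f g.
  have [||h0 [h1 [h0P h1P]]] := null (f (-1) \- g (-1)) (f 0 \- g 0).
  - by move=> x /=; rewrite !cmap_diff linearB.
  - by move=> x /=; rewrite linearB -!cmap_diff (P2 _ _ (diff P 0 1 x)) // !(linear0, subr0).
  by apply/two_term_homotopic => //; exists h0, h1.
have [u uP] := quasi_iso_section (@roof_qis _ _ _ r).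
have [v vP] := quasi_iso_section (@roof_qis _ _ _ s).
exists P, u, v; split=> //; first exact: homotopic_id_quasi_iso.
exact: homotopic_trans uP (homotopic_sym vP).
Qed.

End TwoTermProjective.
End Homotopies.

(** * The classes Xc and Yc *)

Section TwoTermTorsion.
Variables (A : pzRingType) (P : complex A).
Hypotheses (P2 : two_term P) (P_proj : forall i, fin_gen (P i) /\ is_projective (P i)).
Local Notation d := (diff P (-1) 0).

Lemma YcP M : Yc P M <-> fin_gen M /\
  forall f : {linear P 0 -> M}, (forall x, f (d x) = 0) -> forall x, f x = 0.
Proof.
split=> -[fgM H]; split=> //.
  move=> f fd x; have /(derived_Hom_two_term P2 P_proj) H' := H.
  have [//|//|h0 [h1 [h0P _]]] := H' \0 f.
  by rewrite h0P.
apply/(derived_Hom_two_term P2 P_proj) => f1 f0 f0d _.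
exists \0, \0; split=> x; first by rewrite (H f0).
by rewrite linear0 add0r; apply/matrixP => i [].
Qed.

Lemma XcP M : Xc P M <-> fin_gen M /\
  forall f : {linear P (-1) -> M}, exists h : {linear P 0 -> M}, forall x, f x = h (d x).
Proof.
split=> -[fgM H]; split=> //.
  move=> f; have /(derived_Hom_two_term P2 P_proj) H' := H.
  have [x|x|h0 [h1 [_ h1P]]] := H' f \0.
  - by rewrite /= oppr0.
  - by rewrite linear0.
  by exists h0 => x; rewrite h1P /= oppr0 add0r.
apply/(derived_Hom_two_term P2 P_proj) => f1 f0 _ _.
have [h hP] := H f1; exists h, \0; split=> x; last by rewrite /= oppr0 add0r.
by apply/matrixP => i [].
Qed.

Lemma cohomology0_proj : exists c : {linear P 0 -> cohomology P 0},
  surj c /\ forall x, c x = 0 <-> exists y, d y = x.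
Proof.
have cyc (x : P 0) : x \in @is_cycle A P 0.
  by rewrite unfold_in (P2 _ _ (diff P 0 (0 + 1) x)).
have c_lin : linear (fun x => modpi (boundaries_submod P 0) (Cycle (cyc x))).
  by move=> a x y; rewrite -linearP; congr modpi; apply: val_inj.
exists (linear_of c_lin); split.
  move=> v; have [z <-] := modpi_surj v; exists (cycle_val z).
  by congr modpi; apply: val_inj.
move=> x; split=> [/modpi_eq0/asboolP[y yP]|[y yP]]; first by exists y.
by apply/modpi_eq0/asboolP; exists y.
Qed.

Lemma cohomology1_inj : exists i : {linear cohomology P (-1) -> P (-1)},
  injective i /\ forall x, d x = 0 <-> exists y, i y = x.
Proof.
have val_lin : linear (@cycle_val A P (-1)) by [].
have [|i iP] := @modquot_lift A _ _ (boundaries_submod P (-1)) _ (linear_of val_lin).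
  by move=> z /asboolP[y yz]; rewrite /= -yz (P2 _ _ y) // linear0.
exists i; split.
  apply: injective_ker0 => v; have [z <-] := modpi_surj v; rewrite iP /= => z0.
  by apply/modpi_eq0/asboolP; exists 0; rewrite linear0.
move=> x; split=> [x0|[v <-]].
  have cx : x \in @is_cycle A P (-1) by rewrite unfold_in; apply/eqP.
  by exists (modpi _ (Cycle cx)); rewrite iP.
by have [z <-] := modpi_surj v; rewrite iP; apply/eqP/(cycleP z).
Qed.

(** Every chain map [P -> P[1]] is null-homotopic; the sign of the shifted differential is absorbed
    into [k']. *)
Definition presilting := forall a : {linear P (-1) -> P 0},
  exists (k : {linear P 0 -> P 0}) (k' : {linear P (-1) -> P (-1)}),
    forall x, a x = k (d x) + d (k' x).

Lemma presiltingP : Xc P (cohomology P 0) <-> presilting.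
Proof.
have [c [c_surj cP]] := cohomology0_proj.
have [fg1 pr1] := P_proj (-1); have [fg0 pr0] := P_proj 0.
split=> [/XcP[_ H] a|H].
  have [h hP] := H (c \o a); have [k kP] := pr0 _ _ c h c_surj.
  have [|k' k'P] := @proj_lift A _ _ _ d (a \- (k \o d)) fg1 pr1.
    by move=> x; apply/cP; rewrite /= linearB kP -hP subrr.
  by exists k, k' => x; rewrite k'P /= addrC subrK.
apply/XcP; split; first exact: (fin_gen_surj c_surj).
move=> f; have [a aP] := pr1 _ _ c f c_surj; have [k [k' kP]] := H a.
exists (c \o k) => x; rewrite -aP kP linearD /= [X in _ + X](_ : _ = 0) ?addr0 //.
by apply/cP; exists (k' x).
Qed.

(** A map from [H^0 P] to [H^{-1} P] is the same as a chain map [P -> P[-1]]. *)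
Lemma Yc_cohomology1P : fin_gen (cohomology P (-1)) ->
  Yc P (cohomology P (-1)) <-> forall f : {linear P 0 -> P (-1)},
    (forall x, f (d x) = 0) -> (forall x, d (f x) = 0) -> forall x, f x = 0.
Proof.
have [i [i_inj iP]] := cohomology1_inj => fgH; split=> [/YcP[_ H] f fd df x|H].
  have [|g gP] := factor_inj (f := f) i_inj; first by move=> y; apply/iP.
  rewrite -gP H ?linear0 // => y; apply: i_inj.
  by rewrite gP fd linear0.
apply/YcP; split=> // f fd x; apply: i_inj; rewrite linear0.
apply: (H (i \o f)) => y /=; first by rewrite fd linear0.
by apply/iP; exists (f y).
Qed.

Lemma dpow_two_term n : two_term (dpow P n).
Proof.
move=> i i1 i0; elim: n => [|n IH] /=.
  by rewrite /stalk_term (negPf i0) => x; apply/matrixP => k [].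
by move=> [x y]; rewrite (P2 i1 i0 x) (IH y).
Qed.

Lemma zero_module_is_zero : is_zero (@zero_module A).
Proof. by move=> x; apply/matrixP => k []. Qed.

Lemma dpow_proj n i : fin_gen (dpow P n i) /\ is_projective (dpow P n i).
Proof.
elim: n => [|n [IHf IHp]] /=.
  have z : is_zero (stalk (@zero_module A) i).
    by rewrite /= /stalk_term; case: ifP => _; apply: zero_module_is_zero.
  by split; [apply: is_zero_fin_gen | apply: is_zero_projective].
have [fgP prP] := P_proj i.
by split; [apply: fin_gen_prod | apply: is_projective_prod].
Qed.

Lemma presilting_dpow n : presilting -> forall a : {linear P (-1) -> dpow P n 0},
  exists (k : {linear P 0 -> dpow P n 0}) (k' : {linear P (-1) -> dpow P n (-1)}),
    forall x, a x = k (d x) + diff (dpow P n) (-1) 0 (k' x).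
Proof.
move=> sP; elim: n => [|n IH] a.
  by exists \0, \0 => x; apply/matrixP => k [].
have [k [k' kP]] := sP (fst \o a); have [h [h' hP]] := IH (snd \o a).
exists (pair_map k h), (pair_map k' h') => x.
by rewrite [LHS]surjective_pairing; congr pair; [apply: kP | apply: hP].
Qed.

End TwoTermTorsion.

(** * Approximation by powers of P, and the torsion theory *)

Section Approximation.
Variables (R : comPzRingType) (R_artin : artinian R).
Variables (A : pzRingType) (alg : algebra_over R A).
Hypothesis A_fg : fin_gen (restr A^o alg : lmodType R).
Variable P : complex A.
Hypotheses (P2 : two_term P) (P_proj : forall i, fin_gen (P i) /\ is_projective (P i)).
Local Notation d := (diff P (-1) 0).

(** Precomposing the copairing of the [g j] with the diagonal scaled by the [r j] gives their
    combination; centrality of [R] makes the scaled diagonal a chain map of [A]-modules. *)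
Lemma dpow_combination (M1 M0 : lmodType A) (dM : {linear M1 -> M0}) n
    (g1 : 'I_n -> {linear P (-1) -> M1}) (g0 : 'I_n -> {linear P 0 -> M0}) :
  (forall j x, dM (g1 j x) = g0 j (d x)) ->
  exists (G1 : {linear dpow P n (-1) -> M1}) (G0 : {linear dpow P n 0 -> M0}),
    (forall x, dM (G1 x) = G0 (diff (dpow P n) (-1) 0 x)) /\
    forall r : 'I_n -> R,
      exists (U1 : {linear P (-1) -> dpow P n (-1)}) (U0 : {linear P 0 -> dpow P n 0}),
      [/\ forall x, diff (dpow P n) (-1) 0 (U1 x) = U0 (d x),
          forall x, G1 (U1 x) = \sum_j alg (r j) *: g1 j x
        & forall x, G0 (U0 x) = \sum_j alg (r j) *: g0 j x].
Proof.
elim: n g1 g0 => [|n IH] g1 g0 comm.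
  exists \0, \0; split=> [x|r]; first by rewrite !linear0.
  exists \0, \0; split=> x; first by rewrite !linear0.
    by rewrite big_ord0.
  by rewrite big_ord0.
have [G1 [G0 [Gc GP]]] := IH (g1 \o lift ord0) (g0 \o lift ord0) (fun j => comm _).
exists (copair_map (g1 ord0) G1), (copair_map (g0 ord0) G0); split.
  by move=> [x y]; rewrite /= /copair_map /= linearD comm Gc.
move=> r; have [U1 [U0 [Uc U1P U0P]]] := GP (r \o lift ord0).
exists (pair_map (homothety alg (r ord0)) U1), (pair_map (homothety alg (r ord0)) U0).
split=> x.
- by congr pair => /=; [rewrite /homothety linearZ | rewrite -Uc].
- by rewrite big_ord_recl /= /copair_map /= U1P /homothety linearZ.
- by rewrite big_ord_recl /= /copair_map /= U0P /homothety linearZ.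
Qed.

(** Evaluation at generators of [P] embeds the chain maps [P -> M] into a noetherian [R]-module.
    Factorization through the approximation is strict, not only up to homotopy. *)
Lemma dpow_approximation (M1 M0 : lmodType A) (dM : {linear M1 -> M0}) :
  fin_gen M1 -> fin_gen M0 ->
  exists n (G1 : {linear dpow P n (-1) -> M1}) (G0 : {linear dpow P n 0 -> M0}),
    (forall x, dM (G1 x) = G0 (diff (dpow P n) (-1) 0 x)) /\
    forall (a1 : {linear P (-1) -> M1}) (a0 : {linear P 0 -> M0}),
      (forall x, dM (a1 x) = a0 (d x)) ->
      exists (U1 : {linear P (-1) -> dpow P n (-1)}) (U0 : {linear P 0 -> dpow P n 0}),
      [/\ forall x, diff (dpow P n) (-1) 0 (U1 x) = U0 (d x),
          forall x, G1 (U1 x) = a1 x & forall x, G0 (U0 x) = a0 x].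
Proof.
move=> fg1 fg0.
have [[k1 [p pP]] _] := P_proj (-1); have [[k0 [q qP]] _] := P_proj 0.
pose V : lmodType A := ({ffun 'I_k1 -> M1} * {ffun 'I_k0 -> M0})%type.
pose ev (a1 : P (-1) -> M1) (a0 : P 0 -> M0) : V := ([ffun i => a1 (p i)], [ffun j => a0 (q j)]).
pose W : {pred restr V alg} := fun v => `[< exists (a1 : {linear P (-1) -> M1})
  (a0 : {linear P 0 -> M0}), (forall x, dM (a1 x) = a0 (d x)) /\ v = ev a1 a0 >].
have W_sub : submod_closed W.
  split.
    apply/asboolP; exists \0, \0; split=> [x|]; first by rewrite !linear0.
    by congr pair; apply/ffunP => i; rewrite !ffunE.
  move=> r v w /asboolP[a1 [a0 [ac ->]]] /asboolP[b1 [b0 [bc ->]]]; apply/asboolP.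
  exists ((homothety alg r \o a1) \+ b1), ((homothety alg r \o a0) \+ b0); split.
    by move=> x; rewrite /= /homothety linearD linearZ ac bc.
  by congr pair; apply/ffunP => i; rewrite !ffunE.
have fgV : fin_gen (restr V alg : lmodType R).
  by apply: restr_fin_gen => //; apply: fin_gen_prod; apply: fin_gen_ffun.
have [n [g [gW gP]]] := artinian_noetherian R_artin fgV W_sub.
have /choice[a aP] : forall j, exists a : {linear P (-1) -> M1} * {linear P 0 -> M0},
    (forall x, dM (a.1 x) = a.2 (d x)) /\ g j = ev a.1 a.2.
  by move=> j; have /asboolP[a1 [a0 h]] := gW j; exists (a1, a0).
have [|G1 [G0 [Gc GP]]] := @dpow_combination _ _ dM n (fun j => (a j).1) (fun j => (a j).2).
  by move=> j; case: (aP j).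
exists n, G1, G0; split=> // a1 a0 ac.
have [|r rP] := gP (ev a1 a0); first by apply/asboolP; exists a1, a0.
have [U1 [U0 [Uc U1P U0P]]] := GP r; exists U1, U0; split=> // x.
  move: x; apply: (@eq_linear_gen _ _ _ _ p (G1 \o U1) a1) => // i /=.
  have := congr1 (fun v : V => v.1 i) rP; rewrite /= ffunE => ->; rewrite U1P.
  have -> : forall (F : 'I_n -> V), (\sum_j F j).1 i = \sum_j (F j).1 i.
    by move=> F; elim/big_rec2: _ => [|j u v _ <-]; rewrite ?ffunE.
  by apply: eq_bigr => j _; have [_ ->] := aP j; rewrite !ffunE.
move: x; apply: (@eq_linear_gen _ _ _ _ q (G0 \o U0) a0) => // i /=.
have := congr1 (fun v : V => v.2 i) rP; rewrite /= ffunE => ->; rewrite U0P.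
have -> : forall (F : 'I_n -> V), (\sum_j F j).2 i = \sum_j (F j).2 i.
  by move=> F; elim/big_rec2: _ => [|j u v _ <-]; rewrite ?ffunE.
by apply: eq_bigr => j _; have [_ ->] := aP j; rewrite !ffunE.
Qed.

Lemma torsion_theory_of_presilting :
  (forall M, Xc P M /\ Yc P M <-> is_zero M) -> presilting P ->
  torsion_theory (@fin_gen A) (Xc P) (Yc P).
Proof.
move=> cap sP; have [fg1 pr1] := P_proj (-1); have [fg0 pr0] := P_proj 0.
split=> //; try by move=> M [].
- move=> M N f fgN f_surj /(XcP P2 P_proj)[_ H]; apply/(XcP P2 P_proj); split=> // g.
  have [k kP] := pr1 _ _ f g f_surj; have [h hP] := H k.
  by exists (f \o h) => x; rewrite -kP hP.
- move=> M N f fgM f_inj /(YcP P2 P_proj)[_ H]; apply/(YcP P2 P_proj); split=> // g gd x.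
  apply: f_inj; rewrite linear0; apply: (H (f \o g)) => y /=.
  by rewrite gd linear0.
move=> X fgX.
(* With zero in degree -1, a chain map from [P] is a map [P 0 -> X] killing the image of [d]; so the
   image of [G0] is the trace of [H^0 P]. *)
have [n [G1 [G0 [Gc GP]]]] := @dpow_approximation (@zero_module A) X \0
  (is_zero_fin_gen (@zero_module_is_zero A)) fgX.
pose K : {pred dpow P n 0} := fun y => G0 y == 0.
have K_sub : submod_closed K.
  split; first by rewrite unfold_in linear0.
  by move=> a y z /eqP y0 /eqP z0; rewrite unfold_in linearP y0 z0 scaler0 addr0.
pose J : {pred X} := fun x => `[< exists y, G0 y = x >].
have J_sub : submod_closed J.
  split; first by apply/asboolP; exists 0; rewrite linear0.
  move=> a x x' /asboolP[y <-] /asboolP[y' <-]; apply/asboolP.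
  by exists (a *: y + y'); rewrite linearP.
have [|i iP] := @modquot_lift A _ _ K_sub _ G0; first by move=> y /eqP.
exists (modquot K_sub), (modquot J_sub), i, (modpi J_sub); split.
- apply/(XcP P2 P_proj); split.
    apply: (fin_gen_surj (f := modpi K_sub)); first exact: modpi_surj.
    by have [] := dpow_proj P_proj n 0.
  move=> f; have [a aP] := pr1 _ _ (modpi K_sub) f (@modpi_surj _ _ _ K_sub).
  have [k [k' kP]] := presilting_dpow sP a; exists (modpi K_sub \o k) => x.
  rewrite -aP kP linearD /= [X in _ + X](_ : _ = 0) ?addr0 //.
  by apply/modpi_eq0/eqP; rewrite -Gc.
- apply/(YcP P2 P_proj); split.
    by apply: (fin_gen_surj (f := modpi J_sub)) => //; exact: modpi_surj.
  (* The lift [f] of [g] satisfies [f \o d = G0 \o a]. Splitting [a] by [presilting_dpow], the map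
     [f - G0 \o k] kills the image of [d], so it factors through [G0], and [f] lands in the
     trace. *)
  move=> g gd; have [f fP] := pr0 _ _ (modpi J_sub) g (@modpi_surj _ _ _ J_sub).
  have [|a aP] := @proj_lift A _ _ _ G0 (f \o d) fg1 pr1.
    by move=> x; have /asboolP : (f \o d) x \in J by apply/(modpi_eq0 J_sub); rewrite /= fP gd.
  have [k [k' kP]] := presilting_dpow sP a.
  have [|U1 [U0 [_ _ U0P]]] := GP \0 (f \- (G0 \o k)).
    by move=> x; rewrite /= -[f _]/((f \o d) x) -aP kP linearD -Gc /= addr0 subrr.
  move=> x; rewrite -fP; apply/modpi_eq0/asboolP; exists (U0 x + k x).
  by rewrite linearD U0P /= subrK.
split.
- apply: injective_ker0 => v; have [y <-] := modpi_surj v; rewrite iP => /eqP y0.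
  exact/modpi_eq0.
- exact: modpi_surj.
- move=> x; split=> [/modpi_eq0/asboolP[y <-]|[v <-]].
    by exists (modpi K_sub y); rewrite iP.
  have [y <-] := modpi_surj v; rewrite iP; apply/modpi_eq0/asboolP.
  by exists y.
Qed.

End Approximation.

Section TorsionTheory.
Variables (A : pzRingType) (X Y : lmodType A -> Prop).
Hypothesis XY : torsion_theory (@fin_gen A) X Y.

Lemma torsion_Hom0 (M N : lmodType A) (f : {linear M -> N}) : X M -> Y N -> forall x, f x = 0.
Proof.
move=> XM YN; pose K : {pred M} := fun x => f x == 0.
have K_sub : submod_closed K.
  split; first by rewrite unfold_in linear0.
  by move=> a y z /eqP y0 /eqP z0; rewrite unfold_in linearP y0 z0 scaler0 addr0.
have [|g gP] := @modquot_lift A _ _ K_sub _ f; first by move=> y /eqP.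
have fgQ : fin_gen (modquot K_sub).
  apply: (fin_gen_surj (f := modpi K_sub)); first exact: modpi_surj.
  exact (torsion_subl XY XM).
have Q0 : is_zero (modquot K_sub).
  apply/(torsion_cap XY); split.
    by apply: (torsion_quot XY (f := modpi K_sub)) => //; exact: modpi_surj.
  apply: (torsion_sub XY (f := g)) => //; apply: injective_ker0 => v.
  have [x <-] := modpi_surj v; rewrite gP => fx.
  by apply/modpi_eq0; rewrite unfold_in fx.
by move=> x; rewrite -gP (Q0 (modpi K_sub x)) linear0.
Qed.

(** The torsion-free quotient of [M] is then zero, so its torsion part maps onto [M]. *)
Lemma torsion_of_Hom0 (M : lmodType A) : fin_gen M ->
  (forall (N : lmodType A) (f : {linear M -> N}), Y N -> forall x, f x = 0) -> X M.
Proof.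
move=> fgM HM; have [M' [M'' [i [p [XM' YM'' [_ _ ex]]]]]] := torsion_seq XY fgM.
apply: (torsion_quot XY (f := i)) => // x; apply/ex.
exact: HM.
Qed.

End TorsionTheory.

Section DualStability.
Variables (R : comPzRingType) (R_artin : artinian R).
Variables (A : pzRingType) (alg : algebra_over R A).
Hypothesis A_fg : fin_gen (restr A^o alg : lmodType R).
Variables (I : lmodType R) (e : {linear residue_mod R -> I}).
Hypothesis I_env : injective_envelope e.
Local Notation DA := (dual_bimod alg I).
Variable P : complex A.
Hypotheses (P2 : two_term P) (P_proj : forall i, fin_gen (P i) /\ is_projective (P i)).
Local Notation d := (diff P (-1) 0).

Lemma cohomology1_fin_gen : fin_gen (cohomology P (-1)).
Proof.
have [i [i_inj _]] := cohomology1_inj P2.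
by apply: (alg_fin_gen_inj R_artin A_fg i_inj); have [] := P_proj (-1).
Qed.

Lemma cohomology0_fin_gen : fin_gen (cohomology P 0).
Proof.
have [c [c_surj _]] := cohomology0_proj P2.
by apply: (fin_gen_surj c_surj); have [] := P_proj 0.
Qed.

Lemma Xc_cohomology0 : torsion_theory (@fin_gen A) (Xc P) (Yc P) -> Xc P (cohomology P 0).
Proof.
move=> XY; apply: (torsion_of_Hom0 XY); first exact: cohomology0_fin_gen.
have [c [c_surj cP]] := cohomology0_proj P2.
move=> N f /(YcP P2 P_proj)[_ H] v; have [x <-] := c_surj v.
apply: (H (f \o c)) => y /=.
by rewrite (_ : c (d y) = 0) ?linear0 //; apply/cP; exists y.
Qed.

Lemma tensor_XcP M : fin_gen M -> Xc P (tensor DA M) <->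
  forall phi : {linear M -> P (-1)}, (forall x, d (phi x) = 0) -> forall x, phi x = 0.
Proof.
move=> fgM; have [fg1 pr1] := P_proj (-1); have [fg0 pr0] := P_proj 0.
split=> [/(XcP P2 P_proj)[_ H]|H].
  exact: (tensor_surj_inj R_artin I_env fg1 pr1 fg0 pr0 H).
apply/(XcP P2 P_proj); split.
  exact: (dual_tensor_fin_gen R_artin A_fg I_env).
exact: (tensor_inj_surj R_artin A_fg I_env fg1 pr1 fg0 pr0 H).
Qed.

Lemma torsion_tensor_stable : torsion_theory (@fin_gen A) (Xc P) (Yc P) ->
  Yc P (cohomology P (-1)) -> stable_under (fun M => tensor DA M) (Xc P).
Proof.
move=> XY YH M XM; apply/tensor_XcP; first by case: XM.
move=> phi dphi x; have [i [i_inj iP]] := cohomology1_inj P2.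
have [|g gP] := factor_inj (f := phi) i_inj; first by move=> y; apply/iP.
by rewrite -gP (torsion_Hom0 XY g XM YH) linear0.
Qed.

(** Membership in [Yc P] is tested by maps from [H^0 P]; such a map to [Hom (DA, M)] is adjoint to
    one from [DA (x) H^0 P], which is in [Xc P]. *)
Lemma tensor_stable_hom_stable : torsion_theory (@fin_gen A) (Xc P) (Yc P) ->
  stable_under (fun M => tensor DA M) (Xc P) ->
  stable_under (fun M => bimod_hom DA M) (Yc P).
Proof.
move=> XY XDA M YM; have fgM : fin_gen M by case: YM.
apply/(YcP P2 P_proj); split; first exact: (bimod_hom_fin_gen R_artin A_fg I_env).
move=> f fd x; have [c [c_surj cP]] := cohomology0_proj P2.
have [|g gP] := factor_surj (f := f) c_surj.
  by move=> y /cP[z <-].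
have [||||F FP] := @tensor_lift A DA (cohomology P 0) M
    (fun n v => ((g v : Hom DA M) : {linear DA -> M}) n).
- by move=> n n' v; rewrite linearD.
- by move=> n v v'; rewrite linearD.
- by move=> n a v; rewrite linearZ.
- by move=> a n v; rewrite linearZ.
apply: Hom_ext => n; rewrite -gP -FP.
exact: (torsion_Hom0 XY F (XDA _ (Xc_cohomology0 XY)) YM).
Qed.

(** By adjunction [DA (x) H^0 P] is left orthogonal to [Yc P], hence in [Xc P]; [tensor_XcP] reads
    this as [Hom (H^0 P, H^{-1} P) = 0]. *)
Lemma hom_stable_Yc_cohomology1 : torsion_theory (@fin_gen A) (Xc P) (Yc P) ->
  stable_under (fun M => bimod_hom DA M) (Yc P) -> Yc P (cohomology P (-1)).
Proof.
move=> XY YDA; have [c [c_surj cP]] := cohomology0_proj P2.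
have XH := Xc_cohomology0 XY; have fgH := cohomology0_fin_gen.
have XT : Xc P (tensor DA (cohomology P 0)).
  apply: (torsion_of_Hom0 XY); first exact: (dual_tensor_fin_gen R_artin A_fg I_env).
  move=> N f YN.
  have ad_lin v : linear (fun n : DA => f (pure n v)).
    by move=> a n n'; rewrite pureDl pureZ linearP.
  pose ad v : bimod_hom DA N := linear_of (ad_lin v).
  have ad_lin2 : linear ad.
    move=> a v v'; apply: Hom_ext => n.
    by rewrite -[LHS]/(f (pure n (a *: v + v'))) pureDr linearD -pure_bal.
  move=> u; elim/tensor_ind: u => [|n v u IH]; first by rewrite linear0.
  rewrite linearD IH addr0 -[LHS]/(((ad v : Hom DA N) : {linear DA -> N}) n).
  by have -> : ad v = 0 by exact: (torsion_Hom0 XY (linear_of ad_lin2) XH (YDA _ YN)).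
apply/(Yc_cohomology1P P2 P_proj); first exact: cohomology1_fin_gen.
move=> f fd df x; have [|g gP] := factor_surj (f := f) c_surj.
  by move=> y /cP[z <-].
rewrite -gP; move: XT => /(tensor_XcP fgH); apply=> v.
by have [y <-] := c_surj v; rewrite gP.
Qed.

End DualStability.

(** * Homotopy equivalences of cones *)

Section HomotopyEquivalences.
Variable A : pzRingType.
Implicit Types X Y Z B : complex A.

Lemma homotopy_equivalent_sym X Y : homotopy_equivalent X Y -> homotopy_equivalent Y X.
Proof. by move=> [f [g [gf fg]]]; exists g, f. Qed.

Lemma iso_homotopy_equivalent X Y (f : chain_map X Y) (g : forall i, {linear Y i -> X i}) :
  (forall i, cancel (f i) (g i)) -> (forall i, cancel (g i) (f i)) ->
  homotopy_equivalent X Y.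
Proof.
move=> fK gK.
have g_diff i j y : g j (diff Y i j y) = diff X i j (g i y).
  by apply: (can_inj (fK j)); rewrite gK cmap_diff gK.
exists f, (ChainMap g_diff); split; apply: homotopic_ext => i x /=; first exact: fK.
exact: gK.
Qed.

Lemma transport_diff X i i' j j' (x : X i) : i = i' -> j = j' ->
  diff X i' j' (transport i' x) = transport j' (diff X i j x).
Proof. by move=> ? ?; subst i' j'; rewrite !transport_id. Qed.

Lemma shift_unshift X : homotopy_equivalent X (shift (shift X 1) (-1)).
Proof.
have e i : i = i - 1 + 1 :> int by rewrite subrK.
pose f i : {linear X i -> shift (shift X 1) (-1) i} := @transport A X i (i - 1 + 1).
have f_diff i j x : f j (diff X i j x) = diff (shift (shift X 1) (-1)) i j (f i x).
  rewrite -[RHS]/(- - diff X (i - 1 + 1) (j - 1 + 1) (f i x)) opprK.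
  exact/esym/(transport_diff x (e i) (e j)).
pose g i : {linear shift (shift X 1) (-1) i -> X i} :=
  (@transport A X (i - 1 + 1) i : {linear X (i - 1 + 1) -> X i}).
have tK i j (x : X i) : i = j -> transport i (transport j x) = x.
  by move=> ij; subst j; rewrite !transport_id.
apply: (iso_homotopy_equivalent (f := ChainMap f_diff) (g := g)) => i x /=.
  exact/tK/e.
by apply: tK; rewrite -e.
Qed.

Definition ses X Z Y (i : chain_map X Z) (p : chain_map Z Y) :=
  forall k, short_exact (i k) (p k).

Lemma cone_diff_comp X Y (f : chain_map X Y) i j (z : cone f i) : j = i + 1 ->
  diff (cone f) i j z =
  (- diff X (i + 1) (j + 1) z.1, transport j (f (i + 1) z.1) + diff Y i j z.2).
Proof. by []. Qed.

(** Projectivity splits the sequence in each degree, and the splittings give an explicit inverse of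
    the projection from the cone to [Y]. *)
Lemma cone_ses X Z Y (i : chain_map X Z) (p : chain_map Z Y) :
  (forall k, is_projective (Y k)) -> ses i p -> homotopy_equivalent (cone i) Y.
Proof.
move=> prY ip.
have i_inj k : injective (i k) by case: (ip k).
have pi0 k x : p k (i k x) = 0 by have [_ _ ex] := ip k; apply/ex; exists x.
have /(_ _)/cid sgE k : exists s : {linear Y k -> Z k}, forall y, p k (s y) = y.
  by have [_ ps _] := ip k; have [h hP] := prY k _ _ (p k) idfun ps; exists h.
pose sg k := sval (sgE k).
have sgP k y : p k (sg k y) = y by exact: (svalP (sgE k)).
have /(_ _)/cid rhE k : exists r : {linear Z k -> X k}, forall z, i k (r z) = z - sg k (p k z).
  have [_ _ ex] := ip k; apply: (factor_inj (f := idfun \- (sg k \o p k)) (i_inj k)) => z.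
  by apply/ex; rewrite /= linearB sgP subrr.
pose rh k := sval (rhE k).
have rhP k z : i k (rh k z) = z - sg k (p k z) by exact: (svalP (rhE k)).
(* The failure of the splitting [sg] to commute with differentials, pulled back to [X]; it is the
   component that makes [psi] a chain map. *)
pose ta k : {linear Y k -> X (k + 1)} :=
  rh (k + 1) \o ((sg (k + 1) \o diff Y k (k + 1)) \- (diff Z k (k + 1) \o sg k)).
have taP k y : i (k + 1) (ta k y) = sg (k + 1) (diff Y k (k + 1) y) - diff Z k (k + 1) (sg k y).
  by rewrite rhP /= linearB cmap_diff !sgP subrr linear0 subr0.
have Phi_diff k j (z : cone i k) : p j (diff (cone i) k j z).2 = diff Y k j (p k z.2).
  have [jk|jk] := eqVneq j (k + 1); last by rewrite !(diff_shape _ jk) linear0.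
  by subst j; rewrite cone_diff_comp //= transport_id linearD pi0 add0r cmap_diff.
pose Phi : chain_map (cone i) Y :=
  @ChainMap A (cone i) Y (fun k => p k \o snd : {linear cone i k -> Y k}) Phi_diff.
pose psi k : {linear Y k -> cone i k} := pair_map (ta k) (sg k).
have psi_diff k j (y : Y k) : psi j (diff Y k j y) = diff (cone i) k j (psi k y).
  have [jk|jk] := eqVneq j (k + 1); last by rewrite !(diff_shape _ jk) linear0.
  subst j; rewrite cone_diff_comp // transport_id; congr pair => /=.
    apply: i_inj; rewrite taP diff_diff linear0 sub0r linearN cmap_diff taP.
    by rewrite linearB diff_diff subr0.
  by rewrite taP subrK.
exists Phi, (ChainMap psi_diff); split; last first.
  by apply: homotopic_ext => k y /=; rewrite sgP.
apply/homotopicP.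
pose h k j : {linear cone i k -> cone i j} :=
  pair_map (\- (@transport A X k (j + 1) \o (rh k \o snd))) \0.
exists h => k j l; move=> kj lk; subst l k => -[x z].
rewrite !cone_diff_comp // !transport_id; congr pair => /=; last first.
  rewrite transport_id linear0 addr0 linearN rhP addr0.
  by rewrite opprB.
rewrite !transport_id linearN opprK -[rh _ (_ - _)]/(ta (j + 1) (p (j + 1) z)).
apply: i_inj; rewrite !linearB taP cmap_diff !rhP linearB (linearD (p _)) pi0 add0r.
rewrite (cmap_diff p) opprB opprD !addrA.
by rewrite [RHS](ACl (3 * 2 * 4 * (1 * 5)))%AC /= subrr addr0.
Qed.

(** The triangle [B -> X -> cone s] splits when [s] has a left inverse up to homotopy; this exhibits
    a homotopy retract as a direct summand. *)
Lemma split_homotopy_equivalent B X (s : chain_map B X) (r : chain_map X B) :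
  homotopic (chain_comp r s) (chain_id B) -> homotopy_equivalent (dsum B (cone s)) X.
Proof.
move=> /homotopicP[h hP].
have {}hP j b : r (j + 1) (s (j + 1) b) = b + diff B j (j + 1) (h (j + 1) j b)
    + h (j + 1 + 1) (j + 1) (diff B (j + 1) (j + 1 + 1) b).
  by rewrite -addrA -(hP (j + 1) j (j + 1 + 1)) //= addrC subrK.
pose T i : lmodType A := (B i * (B (i + 1)%R * X i))%type.
(* [w] vanishes on the image of [F], and [d w - w d] is the coordinate [b']. It corrects the
   projection to [X] into the chain map [G], and supplies the homotopy [k]. *)
pose w i : {linear T i -> B i} :=
  copair_map idfun (copair_map (\- h (i + 1) i) (\- r i)).
have wE i b b' x : w i (b, (b', x)) = b + (- h (i + 1) i b' - r i x) by [].
have dE i (z : T i) : diff (dsum B (cone s)) i (i + 1) z = (diff B i (i + 1) z.1,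
    (- diff B (i + 1) (i + 1 + 1) z.2.1, s (i + 1) z.2.1 + diff X i (i + 1) z.2.2)).
  by congr (_, (_, _)); rewrite /= transport_id.
have w_diff i (z : T i) : w (i + 1) (diff (dsum B (cone s)) i (i + 1) z) =
    diff B i (i + 1) (w i z) - z.2.1.
  rewrite dE; case: z => b [b' x]; rewrite !wE /= !linearD !linearN /= opprK hP (cmap_diff r).
  rewrite !opprD !addrA [LHS](ACl (1 * 4 * 6 * 3 * (2 * 5)))%AC /=.
  by rewrite subrr addr0.
pose G i : {linear dsum B (cone s) i -> X i} := (s i \o w i) \+ (snd \o snd).
have G_diff i j z : G j (diff (dsum B (cone s)) i j z) = diff X i j (G i z).
  have [ij|ij] := eqVneq j (i + 1); last by rewrite !(diff_shape _ ij) linear0.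
  subst j; rewrite -[LHS]/(s _ (w _ _) + _.2.2) w_diff dE /= linearB (cmap_diff s).
  by rewrite [RHS]linearD addrA subrK.
pose F i : {linear X i -> dsum B (cone s) i} := pair_map (r i) (pair_map \0 idfun).
have F_diff i j x : F j (diff X i j x) = diff (dsum B (cone s)) i j (F i x).
  have [ij|ij] := eqVneq j (i + 1); last by rewrite !(diff_shape _ ij) linear0.
  subst j; rewrite dE /= !linear0 add0r.
  by rewrite -(cmap_diff r).
exists (ChainMap G_diff), (ChainMap F_diff); split; last first.
  apply: homotopic_ext => i x.
  rewrite -[LHS]/(s i (w i (r i x, (0, x))) + x) wE linear0 oppr0 add0r subrr linear0.
  by rewrite add0r.
apply/homotopicP.
pose k i j : {linear dsum B (cone s) i -> dsum B (cone s) j} :=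
  pair_map (h i j \o w i) (pair_map (@transport A B i (j + 1) \o w i) \0).
exists k => i j l ij li; subst l i => z.
have kE i (y : T (i + 1)) : k (i + 1) i y = (h (i + 1) i (w _ y), (w _ y, 0)).
  by congr (_, (_, _)); rewrite /= transport_id.
rewrite !kE w_diff; case: z => b [b' x].
rewrite dE -[LHS]/(r _ (s _ (w _ (b, (b', x))) + x) - b,
  (0 - b', s _ (w _ (b, (b', x))) + x - x)).
have := wE (j + 1) b b' x; move: (w _ _) => W WE; congr (_, (_, _)) => /=.
- rewrite linearD hP linearB /= [X in X + _ + _ + _ - _]WE !addrA.
  by rewrite [LHS](ACl (4 * 5 * 2 * (1 * 7) * (6 * 3)))%AC /= !subrr !addr0.
- by rewrite addrA addNr.
- by rewrite linear0 !addr0 addrK.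
Qed.
End HomotopyEquivalences.

(** * Triangulated subcategories *)

Section PerfectComplexes.
Variable A : pzRingType.
Implicit Types X Y Z : complex A.

Lemma Kb_proj_shift X n : Kb_proj X -> Kb_proj (shift X n).
Proof.
move=> [prX [N XN]]; split=> [i|]; first exact: prX.
exists (N + `|n|)%N => i Ni; apply: XN; move: Ni; lia.
Qed.

Lemma Kb_proj_cone X Y (f : chain_map X Y) : Kb_proj X -> Kb_proj Y -> Kb_proj (cone f).
Proof.
move=> [prX [N XN]] [prY [M YM]]; split=> [i|].
  have [fgX pX] := prX (i + 1); have [fgY pY] := prY i.
  by split; [apply: fin_gen_prod | apply: is_projective_prod].
exists (N + M + 1)%N => i Ni [x y]; rewrite (XN (i + 1) _ x) ?(YM i _ y) //; move: Ni; lia.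
Qed.

Lemma Kb_proj_two_term X : two_term X ->
  (forall i, fin_gen (X i) /\ is_projective (X i)) -> Kb_proj X.
Proof.
move=> X2 prX; split=> //; exists 1%N => i i1.
by apply: X2; apply: contraTneq i1 => ->.
Qed.

Lemma stalk_Kb_proj (Q : lmodType A) : fin_gen Q -> is_projective Q -> Kb_proj (stalk Q).
Proof.
move=> fgQ prQ; apply: Kb_proj_two_term => i; rewrite /= /stalk_term.
  by move=> _ /negPf->; apply: zero_module_is_zero.
case: ifP => // _; have z := @zero_module_is_zero A.
by split; [apply: is_zero_fin_gen | apply: is_zero_projective].
Qed.

Section Triangulated.
Variable S : complex A -> Prop.
Hypothesis S_tri : triangulated_subcategory S.

Lemma ses_quot X Z Y (i : chain_map X Z) (p : chain_map Z Y) : ses i p ->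
  Kb_proj Y -> S X -> S Z -> S Y.
Proof.
move=> ip KY SX SZ; apply: (tri_iso S_tri KY _ (tri_cone S_tri i SX SZ)).
by apply: cone_ses ip => k; case: KY => /(_ k)[].
Qed.

Section ConeSes.
Variables (X Z : complex A) (i : chain_map X Z).

Fact cone_in_diff j k z :
  pair_map (\0 : {linear Z k -> X (k + 1)}) idfun (diff Z j k z) =
  diff (cone i) j k (pair_map (\0 : {linear Z j -> X (j + 1)}) idfun z).
Proof. by congr pair; rewrite /= !linear0 ?oppr0 ?add0r. Qed.

Definition cone_in : chain_map Z (cone i) :=
  @ChainMap A Z (cone i) (fun k => pair_map \0 idfun : {linear Z k -> cone i k}) cone_in_diff.

Definition cone_out : chain_map (cone i) (shift X 1) :=
  @ChainMap A (cone i) (shift X 1) (fun k => fst : {linear cone i k -> shift X 1 k})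
    (fun _ _ _ => erefl).

Lemma cone_in_out : ses cone_in cone_out.
Proof.
move=> k; split; first by move=> x y [].
  by move=> x; exists (x, 0).
by move=> [x z]; split=> [/= -> | [y [<- _]]] //; exists z.
Qed.
End ConeSes.

(** By rotation: [X[1]] is the quotient in the sequence [Z -> cone i -> X[1]], and shifting back
    recovers [X]. *)
Lemma ses_sub X Z Y (i : chain_map X Z) (p : chain_map Z Y) : ses i p ->
  Kb_proj X -> S Z -> S Y -> S X.
Proof.
move=> ip KX SZ SY; have KZ := tri_Kb_proj S_tri SZ; have KY := tri_Kb_proj S_tri SY.
have SC : S (cone i).
  apply: (tri_iso S_tri (Kb_proj_cone i KX KZ) _ SY); apply: homotopy_equivalent_sym.
  by apply: cone_ses ip => k; case: KY => /(_ k)[].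
have SX1 := ses_quot (@cone_in_out X Z i) (Kb_proj_shift 1 KX) SZ SC.
apply: (tri_iso S_tri KX _ (tri_shift S_tri (-1) SX1)).
exact/homotopy_equivalent_sym/shift_unshift.
Qed.

Lemma ses_mid X Z Y (i : chain_map X Z) (p : chain_map Z Y) : ses i p ->
  Kb_proj Z -> S X -> S Y -> S Z.
Proof.
move=> ip KZ SX SY; have KX := tri_Kb_proj S_tri SX; have KY := tri_Kb_proj S_tri SY.
have SC : S (cone i).
  apply: (tri_iso S_tri (Kb_proj_cone i KX KZ) _ SY); apply: homotopy_equivalent_sym.
  by apply: cone_ses ip => k; case: KY => /(_ k)[].
exact: (ses_sub (@cone_in_out X Z i) KZ SC (tri_shift S_tri 1 SX)).
Qed.

Lemma tri_is_zero X : (forall i, is_zero (X i)) -> S X.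
Proof.
move=> X0; apply: (tri_iso S_tri _ _ (tri_zero S_tri)).
  split; last by exists 0%N => i _; apply: X0.
  by move=> i; split; [apply: is_zero_fin_gen | apply: is_zero_projective].
have z0 i : is_zero (stalk (@zero_module A) i).
  by rewrite /= /stalk_term; case: ifP => _; apply: zero_module_is_zero.
apply: (iso_homotopy_equivalent (f := @ChainMap A (stalk (@zero_module A)) X (fun i => \0)
   (fun i j x => esym (linear0 (diff X i j)))) (g := fun i => \0)) => i x.
  by rewrite (z0 i x) !linear0.
by rewrite (X0 i x) !linear0.
Qed.

Lemma tri_single X a : Kb_proj X -> (forall i, i != a -> is_zero (X i)) ->
  S (stalk (X a)) -> S X.
Proof.
move=> KX Xa SQ; apply: (tri_iso S_tri KX _ (tri_shift S_tri (- a) SQ)).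
pose Y := shift (stalk (X a)) (- a).
have Ya i : i != a -> is_zero (Y i).
  rewrite -subr_eq0 /Y /= /stalk_term => /negPf->; exact: zero_module_is_zero.
have e : a - a = 0 by rewrite subrr.
pose f0 : {linear Y a -> X a} := 
  (@transport A (stalk_term (X a)) (a - a) 0 :
     {linear stalk_term (X a) (a - a) -> stalk_term (X a) 0}).
pose g0 : {linear X a -> Y a} := 
  (@transport A (stalk_term (X a)) 0 (a - a) :
     {linear stalk_term (X a) 0 -> stalk_term (X a) (a - a)}).
have tK (F : int -> lmodType A) i j (x : F i) : i = j -> transport i (transport j x) = x.
  by move=> ij; subst j; rewrite !transport_id.
have f_diff i j (y : Y i) : ext_map f0 j j (diff Y i j y) = diff X i j (ext_map f0 i i y).
  have -> : diff Y i j y = 0 by rewrite /= /shift_diff; case: ifP; rewrite //= oppr0.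
  rewrite linear0; have [ij|ij] := eqVneq j (i + 1); last by rewrite diff_shape.
  have [ia|ia] := eqVneq i a; last by rewrite ext_map0l // linear0.
  by rewrite (Xa j _ (diff X i j _)) // ij ia -subr_eq0 addrAC subrr.
apply: (iso_homotopy_equivalent (f := ChainMap f_diff) (g := fun i => ext_map g0 i i)).
  move=> i x; rewrite -[LHS]/(ext_map g0 i i (ext_map f0 i i x)).
  have [ia|ia] := eqVneq i a; last by rewrite (Ya i ia x) !linear0.
  by subst i; rewrite !ext_mapE; apply: (@tK (stalk_term (X a)) (a - a) 0 x e).
move=> i x; rewrite -[LHS]/(ext_map f0 i i (ext_map g0 i i x)).
have [ia|ia] := eqVneq i a; last by rewrite (Xa i ia x) !linear0.
by subst i; rewrite !ext_mapE; apply: (@tK (stalk_term (X a)) 0 (a - a) x (esym e)).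
Qed.

End Triangulated.

Section Truncation.
Variables (p : pred int) (X : complex A).

(** Truncation to an arbitrary set of degrees, so that one construction gives both a subcomplex and
    a quotient complex; the differential still squares to zero because composites through an omitted
    degree vanish. *)
Definition trunc_term (i : int) : lmodType A := if p i then X i else zero_module A.

Definition trunc_in i : {linear trunc_term i -> X i} :=
  match p i as b return {linear (if b then X i else zero_module A : lmodType A) -> X i}
  with true => idfun | false => \0 end.
Definition trunc_out i : {linear X i -> trunc_term i} :=
  match p i as b return {linear X i -> (if b then X i else zero_module A : lmodType A)}
  with true => idfun | false => \0 end.

Lemma trunc_outK i : cancel (@trunc_in i) (@trunc_out i).
Proof.
rewrite /trunc_in /trunc_out /trunc_term; case: (p i) => // x.
by rewrite /=; apply: esym; apply: zero_module_is_zero.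
Qed.
Lemma trunc_inK i x : p i -> @trunc_in i (@trunc_out i x) = x.
Proof. by rewrite /trunc_in /trunc_out /trunc_term; case: (p i). Qed.
Lemma trunc_in0 i x : ~~ p i -> @trunc_in i x = 0.
Proof. by move: x; rewrite /trunc_in /trunc_term; case: (p i). Qed.
Lemma trunc_out0 i x : ~~ p i -> @trunc_out i x = 0.
Proof. by rewrite /trunc_out /trunc_term; case: (p i). Qed.

Definition trunc_diff i j : {linear trunc_term i -> trunc_term j} :=
  @trunc_out j \o (diff X i j \o @trunc_in i).

Fact trunc_shape i j x : j != i + 1 -> trunc_diff i j x = 0.
Proof. by move=> ij; rewrite /= diff_shape // linear0. Qed.

Fact trunc_diff_diff i j k x : trunc_diff j k (trunc_diff i j x) = 0.
Proof.
rewrite /=; have [pj|pj] := boolP (p j); first by rewrite trunc_inK // diff_diff linear0.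
by rewrite trunc_in0 // !linear0.
Qed.

Definition trunc : complex A := Complex trunc_shape trunc_diff_diff.

Lemma trunc_zero i : (~~ p i) || `[< is_zero (X i) >] -> is_zero (trunc i).
Proof.
rewrite /= /trunc_term; case: (p i) => /= [/asboolP //|_].
exact: zero_module_is_zero.
Qed.

Lemma trunc_Kb_proj : Kb_proj X -> Kb_proj trunc.
Proof.
move=> [prX [N XN]]; split=> [i|]; last first.
  by exists N => i /XN Xi; apply: trunc_zero; rewrite orbC; apply/orP; left; apply/asboolP.
rewrite /= /trunc_term; case: (p i); first exact: prX.
have z := @zero_module_is_zero A.
by split; [apply: is_zero_fin_gen | apply: is_zero_projective].
Qed.

End Truncation.

(* The term of lowest degree [a] is a quotient complex, with kernel the
   complex of the terms of the other degrees. *)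
Lemma tri_of_stalks (S : complex A -> Prop) : triangulated_subcategory S ->
  (forall Q, fin_gen Q -> is_projective Q -> S (stalk Q)) ->
  forall X, Kb_proj X -> S X.
Proof.
move=> S_tri SQ X KX.
suff H : forall k X a, Kb_proj X ->
    (forall i : int, ~~ (a <= i < a + k%:Z) -> is_zero (X i)) -> S X.
  (* The degrees from [-N] to [N] are [2N + 1] in number. *)
  have [_ [N XN]] := KX; apply: (H (N.*2.+1) X (- N%:Z)) => // i iN.
  by apply: XN; move: iN; lia.
elim=> [|k IH] {KX}X a KX Xa.
  by apply: (tri_is_zero S_tri) => i; apply: Xa; lia.
pose q : pred int := fun i => i != a; pose q' : pred int := fun i => i == a.
have below i : i + 1 = a -> is_zero (X i) by move=> ia; apply: Xa; lia.
have in_diff i j (x : trunc q X i) : trunc_in q X j (diff (trunc q X) i j x) =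
    diff X i j (trunc_in q X i x).
  rewrite /=; have [qj|qj] := boolP (q j); first exact: trunc_inK.
  rewrite trunc_in0 //; have [ij|ij] := eqVneq j (i + 1); last by rewrite diff_shape.
  by rewrite (below i _ (trunc_in q X i x)) ?linear0 // -ij; apply/eqP; move: qj; rewrite negbK.
have out_diff i j (x : X i) : trunc_out q' X j (diff X i j x) =
    diff (trunc q' X) i j (trunc_out q' X i x).
  rewrite /=; have [qj|qj] := boolP (q' j); last by rewrite !trunc_out0.
  have [qi|qi] := boolP (q' i); first by rewrite trunc_inK.
  rewrite trunc_in0 // linear0.
  have [ij|ij] := eqVneq j (i + 1); last by rewrite diff_shape // linear0.
  by rewrite (below i _ x) ?linear0 // -ij; apply/eqP.
pose i : chain_map (trunc q X) X :=
  @ChainMap A (trunc q X) X (trunc_in q X) in_diff.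
pose o : chain_map X (trunc q' X) :=
  @ChainMap A X (trunc q' X) (trunc_out q' X) out_diff.
apply: (ses_mid S_tri (i := i) (p := o)) => //.
- move=> j; split; first exact: (can_inj (@trunc_outK q X j)).
    by move=> x; exists (trunc_in q' X j x); apply: trunc_outK.
  move=> x; have [ja|ja] := eqVneq j a.
    split=> [o0|[y <-]] /=; last by rewrite trunc_in0 ?linear0 // /q negbK ja.
    by exists 0; rewrite linear0 -[x](@trunc_inK q' X) ?o0 ?linear0 // /q' ja.
  split=> [_|_]; last exact: trunc_out0.
  by exists (trunc_out q X j x); apply: trunc_inK.
- apply: (IH _ (a + 1)); first exact: trunc_Kb_proj.
  move=> j ja; apply: trunc_zero; have [->|jna] := eqVneq j a; first by rewrite /q eqxx.
  by apply/orP; right; apply/asboolP; apply: Xa; move: ja jna; lia.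
- apply: (tri_single S_tri (a := a)); first exact: trunc_Kb_proj.
    by move=> j ja; apply: trunc_zero; rewrite /q' ja.
  by have [/(_ a)[fgQ prQ] _] := trunc_Kb_proj q' KX; apply: SQ.
Qed.

End PerfectComplexes.

(** * Generation *)

Section Attach.
Variables (A : pzRingType) (N : complex A) (N2 : two_term N).
Variables (Q : lmodType A) (F : {linear N (-1) -> Q}).

(** The cone of [F], seen as a chain map [N[-1] -> Q], written directly as a two-term complex with
    differential [(d, F)]. *)
Definition attach_term i : lmodType A := (N i * stalk_term Q i)%type.

Local Notation t := (@ext_map A N (stalk_term Q) (-1) 0 F).

Definition attach_diff i j : {linear attach_term i -> attach_term j} :=
  pair_map (diff N i j \o fst) (t i j \o fst).

Fact attach_shape i j x : j != i + 1 -> attach_diff i j x = 0.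
Proof.
move=> ij; congr pair; first by rewrite /= diff_shape.
have [ei|ei] := eqVneq i (-1); last by rewrite -[LHS]/(t i j x.1) ext_map0l.
by rewrite -[LHS]/(t i j x.1) ext_map0r // -[0]/(-1 + 1 : int) -ei.
Qed.

Fact attach_diff_diff i j k x : attach_diff j k (attach_diff i j x) = 0.
Proof.
congr pair; first by rewrite /= diff_diff.
rewrite -[LHS]/(t j k (diff N i j x.1)).
have [ej|ej] := eqVneq j (-1); last by rewrite ext_map0l.
have [ij|ij] := eqVneq j (i + 1); last by rewrite diff_shape ?linear0.
rewrite (N2 _ _ x.1) ?linear0 //; apply/eqP=> ei; by move: ij; rewrite ej ei.
Qed.

Definition attach : complex A := Complex attach_shape attach_diff_diff.

Lemma attach_diffE (x : attach (-1)) :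
  diff attach (-1) 0 x = (diff N (-1) 0 x.1, F x.1).
Proof. by congr pair; rewrite -[LHS]/(t (-1) 0 x.1) ext_mapE. Qed.

Lemma attach_two_term : two_term attach.
Proof.
move=> i i1 i0 [x y]; rewrite (N2 i1 i0 x); congr pair; move: y.
by rewrite /stalk_term (negPf i0); exact: zero_module_is_zero.
Qed.

Lemma attach_proj : fin_gen Q -> is_projective Q ->
  (forall i, fin_gen (N i) /\ is_projective (N i)) ->
  forall i, fin_gen (attach i) /\ is_projective (attach i).
Proof.
move=> fgQ prQ prN i; have [fgN pN] := prN i.
have [/(_ i)[fgs prs] _] := stalk_Kb_proj fgQ prQ.
by split; [apply: fin_gen_prod | apply: is_projective_prod].
Qed.

Definition attach_in : chain_map (stalk Q) attach.
Proof.
exists (fun i => pair_map \0 idfun : {linear stalk Q i -> attach i}) => i j x.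
by congr pair; rewrite /= !linear0.
Defined.

Definition attach_out : chain_map attach N :=
  @ChainMap A attach N (fun i => fst : {linear attach i -> N i}) (fun _ _ _ => erefl).

Lemma attach_ses : ses attach_in attach_out.
Proof.
move=> k; split; first by move=> x y [].
  by move=> x; exists (x, 0).
by move=> [x z]; split=> [/= -> | [y [<- _]]] //; exists z.
Qed.

End Attach.

Section Generation.
Variables (R : comPzRingType) (R_artin : artinian R).
Variables (A : pzRingType) (alg : algebra_over R A).
Hypothesis A_fg : fin_gen (restr A^o alg : lmodType R).
Variable P : complex A.
Hypotheses (P2 : two_term P) (P_proj : forall i, fin_gen (P i) /\ is_projective (P i)).
Hypothesis P_silt : presilting P.
Hypothesis P_cap : forall M, Xc P M /\ Yc P M -> is_zero M.
Local Notation d := (diff P (-1) 0).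

Section Approximated.
Variables (B1 B0 : lmodType A) (dB : {linear B1 -> B0}) (m : nat).
Local Notation X := (dpow P m).
Local Notation dX := (diff X (-1) 0).
Variables (G1 : {linear X (-1) -> B1}) (G0 : {linear X 0 -> B0}).
Hypothesis G_comm : forall x, dB (G1 x) = G0 (dX x).
Hypothesis G_approx : forall (a1 : {linear P (-1) -> B1}) (a0 : {linear P 0 -> B0}),
  (forall x, dB (a1 x) = a0 (d x)) ->
  exists (U1 : {linear P (-1) -> X (-1)}) (U0 : {linear P 0 -> X 0}),
  [/\ forall x, dX (U1 x) = U0 (d x),
      forall x, G1 (U1 x) = a1 x & forall x, G0 (U0 x) = a0 x].

(* The cokernel of [G0 + dB] is the zeroth cohomology of the cone of [G]; it
   lies in both classes. *)
Lemma approximation_surj : fin_gen B0 ->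
  (forall b : {linear P (-1) -> B0}, exists (k : {linear P 0 -> B0})
     (k1 : {linear P (-1) -> B1}), forall x, b x = k (d x) + dB (k1 x)) ->
  forall b, exists x y, b = G0 x + dB y.
Proof.
move=> fgB B_null b; have [fg1 pr1] := P_proj (-1); have [fg0 pr0] := P_proj 0.
pose W : {pred B0} := fun b => `[< exists x y, b = G0 x + dB y >].
have WP c : reflect (exists x y, c = G0 x + dB y) (c \in W) by apply: asboolP.
have W_sub : submod_closed W.
  split; first by apply/WP; exists 0, 0; rewrite !linear0 addr0.
  move=> a u v /WP[x [y ->]] /WP[x' [y' ->]]; apply/WP; exists (a *: x + x'), (a *: y + y').
  by rewrite !linearP scalerDr addrACA.
suff z : is_zero (modquot W_sub) by apply/WP/modpi_eq0/z.
apply: P_cap; have fgM : fin_gen (modquot W_sub).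
  by apply: (fin_gen_surj (f := modpi W_sub)) => //; exact: modpi_surj.
split.
  apply/(XcP P2 P_proj); split=> // f.
  have [g gP] := pr1 _ _ (modpi W_sub) f (@modpi_surj _ _ _ W_sub).
  have [k [k1 kP]] := B_null g; exists (modpi W_sub \o k) => x.
  rewrite -gP kP linearD /= [X in _ + X](_ : _ = 0) ?addr0 //.
  by apply/modpi_eq0/WP; exists 0, (k1 x); rewrite linear0 add0r.
apply/(YcP P2 P_proj); split=> // f fd.
have [g gP] := pr0 _ _ (modpi W_sub) f (@modpi_surj _ _ _ W_sub).
(* Write [g \o d = G0 \o a' + dB \o a''] and split [a' = k d + dX k']. Then [G1 \o k' + a''] and
   [g - G0 \o k] form a chain map [P -> B], which factors through [G]; so [g] lands in [W]. *)
have [|a aP] := @proj_lift A _ _ _ (copair_map G0 dB) (g \o d) fg1 pr1.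
  move=> x; have /WP[y [z yz]] : g (d x) \in W by apply/(modpi_eq0 W_sub); rewrite gP fd.
  by exists (y, z).
have [k [k' kP]] := presilting_dpow P_silt (fst \o a).
have [|U1 [U0 [_ _ U0P]]] := G_approx (a1 := (G1 \o k') \+ (snd \o a)) (a0 := g \- (G0 \o k)).
  move=> x; rewrite /= linearD G_comm -[g (d x)]/((g \o d) x) -aP.
  rewrite -[X in _ = X - _]/(G0 ((fst \o a) x) + dB (a x).2) kP linearD.
  by rewrite -[X in _ = X - _]addrA [RHS]addrC addKr.
move=> x; rewrite -gP; apply/modpi_eq0/WP; exists (U0 x + k x), 0.
by rewrite linearD U0P linear0 addr0 /= subrK.
Qed.

(** The data form a chain map from a power of [P] to the cone of [G], and the conclusion is a
    null-homotopy with components [(k, 0)] and [- k1]. One copy of [P] at a time, presilting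
    disposes of [a1]; the remainder is a chain map [P -> B], which factors through [G]. *)
Lemma approximation_null n (a1 : {linear dpow P n (-1) -> X 0})
    (a2 : {linear dpow P n (-1) -> B1}) (b : {linear dpow P n 0 -> B0}) :
  (forall x, G0 (a1 x) + dB (a2 x) = b (diff (dpow P n) (-1) 0 x)) ->
  exists (k : {linear dpow P n 0 -> X 0}) (k1 : {linear dpow P n (-1) -> X (-1)}),
    [/\ forall x, b x = G0 (k x),
        forall x, a1 x = k (diff (dpow P n) (-1) 0 x) + dX (k1 x)
      & forall x, a2 x = - G1 (k1 x)].
Proof.
elim: n a1 a2 b => [|n IH] a1 a2 b ab.
  have z (x : dpow P 0 0) : x = 0 by exact: zero_module_is_zero.
  have z1 (x : dpow P 0 (-1)) : x = 0 by exact: zero_module_is_zero.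
  exists \0, \0; split=> x; rewrite ?(z x) ?(z1 x) !linear0 //.
  by rewrite addr0.
pose inl1 : {linear P (-1) -> dpow P n.+1 (-1)} := pair_map idfun \0.
pose inl0 : {linear P 0 -> dpow P n.+1 0} := pair_map idfun \0.
pose inr1 : {linear dpow P n (-1) -> dpow P n.+1 (-1)} := pair_map \0 idfun.
pose inr0 : {linear dpow P n 0 -> dpow P n.+1 0} := pair_map \0 idfun.
have [x|h [h1 [hb ha1 ha2]]] := IH (a1 \o inr1) (a2 \o inr1) (b \o inr0).
  by rewrite /= ab; congr (b _); congr pair; rewrite /= linear0.
have [k [k1 kP]] := presilting_dpow P_silt (a1 \o inl1).
have [|U1 [U0 [Uc U1P U0P]]] := G_approx (a1 := (G1 \o k1) \+ (a2 \o inl1))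
    (a0 := (b \o inl0) \- (G0 \o k)).
  move=> x; rewrite /= linearD G_comm.
  have -> : inl0 (d x) = diff (dpow P n.+1) (-1) 0 (inl1 x).
    by congr pair; rewrite /= linear0.
  rewrite -ab -[a1 (inl1 x)]/((a1 \o inl1) x) kP [X in X + _ - _]linearD.
  by rewrite -[X in _ = X - _]addrA [RHS]addrC addKr.
exists (copair_map (k \+ U0) h), (copair_map (k1 \- U1) h1).
have sp1 (x : dpow P n.+1 (-1)) : x = inl1 x.1 + inr1 x.2.
  by case: x => x y; congr pair; rewrite /= ?addr0 ?add0r.
have sp0 (x : dpow P n.+1 0) : x = inl0 x.1 + inr0 x.2.
  by case: x => x y; congr pair; rewrite /= ?addr0 ?add0r.
split=> x.
- rewrite [in LHS](sp0 x) linearD -[b (inr0 _)]/((b \o inr0) _) hb /copair_map linearD /=.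
  by congr (_ + _); rewrite linearD U0P /= addrC subrK.
- rewrite [in LHS](sp1 x) linearD -[a1 (inr1 _)]/((a1 \o inr1) _) ha1.
  rewrite -[a1 (inl1 _)]/((a1 \o inl1) _) kP.
  rewrite -[RHS]/(k (d x.1) + U0 (d x.1) + h (diff (dpow P n) (-1) 0 x.2) +
    dX (k1 x.1 - U1 x.1 + h1 x.2)) !linearD linearN Uc !addrA.
  by rewrite [RHS](ACl (1 * 4 * 3 * 6 * (2 * 5)))%AC /= subrr addr0.
- rewrite [in LHS](sp1 x) linearD -[a2 (inr1 _)]/((a2 \o inr1) _) ha2 /copair_map.
  rewrite linearD opprD; congr (_ - _); rewrite /= linearB U1P /=.
  by rewrite opprB addrAC subrr add0r.
Qed.

End Approximated.

Lemma dpow_summand n : summand_of_power P (dpow P n).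
Proof.
have KN : Kb_proj (dpow P n).
  by apply: Kb_proj_two_term; [apply: dpow_two_term | move=> i; apply: dpow_proj].
split=> //; exists n, (stalk (zero_module A)); split.
  have z := @zero_module_is_zero A.
  by apply: stalk_Kb_proj; [apply: is_zero_fin_gen | apply: is_zero_projective].
have z i : is_zero (stalk (zero_module A) i).
  by rewrite /= /stalk_term; case: ifP => _; apply: zero_module_is_zero.
apply: (iso_homotopy_equivalent
  (f := @ChainMap A (dsum (dpow P n) (stalk (zero_module A))) (dpow P n)
    (fun i => fst : {linear dsum (dpow P n) (stalk (zero_module A)) i -> dpow P n i})
    (fun _ _ _ => erefl))
  (g := fun i => pair_map idfun \0)) => i //.
by move=> [x y]; congr pair; rewrite (z i y).
Qed.

Variable S : complex A -> Prop.
Hypothesis S_tri : triangulated_subcategory S.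
Hypothesis S_add : forall X, summand_of_power P X -> S X.

(* Bongartz completion: [B] is the extension of a power of [P] by [Q] that
   kills all maps [P -> Q[1]]; it is a retract of a power of [P]. *)
Lemma stalk_generated Q : fin_gen Q -> is_projective Q -> S (stalk Q).
Proof.
move=> fgQ prQ.
have z := @zero_module_is_zero A.
(* With [Q] in degree -1 and zero in degree 0, this approximates the chain maps [P -> Q[1]]. *)
have [n [F [F0 [_ FP]]]] := @dpow_approximation R R_artin A alg A_fg P P_proj
  Q (zero_module A) \0 fgQ (is_zero_fin_gen z).
pose N := dpow P n; have N2 : two_term N by exact: dpow_two_term.
pose B := attach N2 F; have B2 : two_term B by exact: attach_two_term.
have prN i : fin_gen (N i) /\ is_projective (N i) by exact: dpow_proj.
have prB := attach_proj N2 F fgQ prQ prN; rewrite -/B in prB.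
have KB : Kb_proj B by exact: Kb_proj_two_term.
apply: (ses_sub S_tri (attach_ses N2 F)).
- exact: stalk_Kb_proj.
- apply: S_add; split=> //.
  have [m [G1 [G0 [Gc GP]]]] := @dpow_approximation R R_artin A alg A_fg P P_proj
    _ _ (diff B (-1) 0) (prB (-1)).1 (prB 0).1.
  pose X := dpow P m; have X2 : two_term X by exact: dpow_two_term.
  (* The lift [h] is a null-homotopy of [Q -> B -> cone G]. *)
  have [b|h hP] := @proj_lift A Q _ _ (copair_map G0 (diff B (-1) 0))
      (pair_map \0 idfun : {linear Q -> B 0}) fgQ prQ.
    have [||x [y xy]] := approximation_surj Gc GP _ _ (pair_map \0 idfun b).
    - exact: (prB 0).1.
    (* [Hom (P, B[1]) = 0]: presilting removes the component in [N 0], and the universal property of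
       [F] the remaining one in [Q]. *)
    - move=> c; have [k [k1 kP]] := presilting_dpow P_silt (fst \o c).
      have [x|U1 [U0 [Uc U1P _]]] := FP ((snd \o c) \- (F \o k1)) \0.
        by [].
      exists (pair_map (k \- U0) \0), (pair_map (k1 \+ U1) \0) => x.
      rewrite attach_diffE [LHS]surjective_pairing; congr pair => /=.
        by rewrite -[(c x).1]/((fst \o c) x) kP linearD Uc addrA
            [RHS](ACl (1 * 3 * (2 * 4)))%AC /= addNr addr0.
      by rewrite linearD U1P /= add0r addrC subrK.
    by exists (x, y); exact: (esym xy).
  pose sQ : {linear Q -> X 0} := fst \o h; pose hQ : {linear Q -> B (-1)} := snd \o h.
  have QP q : G0 (sQ q) + diff B (-1) 0 (hQ q) = (0, q) by exact: hP.
  (* After subtracting the contribution of [h], the map [B -> cone G] vanishes on [Q] and descends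
     to [N], a power of [P]; it is therefore null-homotopic. *)
  have [x|k [k1 [kb ka1 ka2]]] := approximation_null Gc GP
      (a1 := \- (sQ \o F)) (a2 := pair_map idfun \0 \- (hQ \o F))
      (b := pair_map idfun \0 : {linear N 0 -> B 0}).
    rewrite -[LHS]/(G0 (- sQ (F x)) + diff B (-1) 0 ((x, 0) - hQ (F x))).
    rewrite linearN linearB attach_diffE addrCA -opprD QP.
    by congr pair; rewrite /= ?subr0 ?subrr.
  (* The [X]-components of the two homotopies assemble into [s : B -> X]; the [B]-component [hQ]
     gives the homotopy from [g \o s] to the identity. *)
  pose s1 : {linear B (-1) -> X (-1)} := \- (k1 \o fst).
  pose s0 : {linear B 0 -> X 0} := copair_map k sQ.
  have s_comm x : s0 (diff B (-1) 0 x) = diff X (-1) 0 (s1 x).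
    rewrite attach_diffE /= /copair_map /= linearN; have := ka1 x.1 => /= /eqP.
    rewrite eq_sym -subr_eq0 opprK => /eqP; rewrite addrAC => /eqP.
    by rewrite addr_eq0 => /eqP.
  have X_top (x : X 0) : diff X 0 1 x = 0 by exact: X2.
  have B_top (x : B 0) : diff B 0 1 x = 0 by exact: B2.
  pose s := two_term_map B2 s_comm (fun x => X_top (s0 x)).
  pose g := two_term_map X2 (fun x => esym (Gc x)) (fun x => B_top (G0 x)).
  exists m, (cone s); split; first by apply: Kb_proj_cone => //; case: (dpow_summand m).
  apply: (split_homotopy_equivalent (r := g)).
  apply/(two_term_homotopic _ _ B2); exists (\- (hQ \o snd)), \0; split=> x.
    rewrite -[LHS]/(g 0 (s 0 x) - x) !two_term_mapE0.
    rewrite -[s0 x]/(k x.1 + sQ x.2) linearD -kb -[RHS]/(diff B (-1) 0 (- hQ x.2)) linearN.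
    have -> : G0 (sQ x.2) = (0, x.2) - diff B (-1) 0 (hQ x.2) by rewrite -QP addrK.
    rewrite addrA (_ : pair_map idfun \0 x.1 + (0, x.2) = x).
      by rewrite addrAC subrr add0r.
    by case: (x) => y q; congr pair; rewrite /= ?addr0 ?add0r.
  rewrite -[LHS]/(g (-1) (s (-1) x) - x) !two_term_mapE1.
  rewrite -[s1 x]/(- k1 x.1) linearN -ka2.
  rewrite -[RHS]/(diff B (-2) (-1) 0 + - hQ (diff B (-1) 0 x).2) attach_diffE linear0 add0r.
  rewrite -[LHS]/((x.1, 0) - hQ (F x.1) - x) (_ : (x.1, 0) = x).
    by rewrite addrAC subrr add0r.
  by case: (x) => y o; congr pair; rewrite (z o).
- exact/S_add/dpow_summand.
Qed.

End Generation.

(** * Tilting complexes *)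

Section HomExact.
Variables (A : pzRingType) (M : lmodType A).
Implicit Types X Y T : complex A.

(** Exactness of the complex [Hom (X, M)], with degrees kept free to avoid casts. *)
Definition Hom_exact X := forall i j k, j = i + 1 -> k = j + 1 ->
  forall phi : {linear X j -> M}, (forall x, phi (diff X i j x) = 0) ->
  exists psi : {linear X k -> M}, forall x, phi x = psi (diff X j k x).

Lemma Hom_exact_htpy X Y : homotopy_equivalent X Y -> Hom_exact X -> Hom_exact Y.
Proof.
move=> [f [g [_ /homotopicP[h hP]]]] HX i j k ij jk phi phid.
have [x|psi psiP] := HX i j k ij jk (phi \o f j); first by rewrite /= cmap_diff phid.
exists ((psi \o g k) \- (phi \o h k j)) => y /=.
rewrite cmap_diff -psiP /= -linearB.
have /eqP := hP j i k ij jk y; rewrite subr_eq => /eqP /= ->.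
by rewrite addrAC addrK linearD phid add0r.
Qed.

Lemma Hom_exact_shift X n : Hom_exact X -> Hom_exact (shift X n).
Proof.
move=> HX i j k ij jk phi phid.
have [|||psi psiP] := HX (i + n) (j + n) (k + n) _ _ phi.
- by rewrite ij addrAC.
- by rewrite jk addrAC.
- move=> x; have := phid x; rewrite /= /shift_diff; case: ifP => _ //= /eqP.
  by rewrite linearN oppr_eq0 => /eqP.
rewrite /= /shift_diff; case: (odd `|n|) => //; last by exists psi.
by exists (\- psi) => x /=; rewrite linearN opprK.
Qed.

Lemma Hom_exact_cone X Y (f : chain_map X Y) :
  Hom_exact X -> Hom_exact Y -> Hom_exact (cone f).
Proof.
move=> HX HY i j k ij jk; subst j k => phi phid.
pose inl : {linear X (i + 1 + 1) -> cone f (i + 1)} := pair_map idfun \0.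
pose inr : {linear Y (i + 1) -> cone f (i + 1)} := pair_map \0 idfun.
have phiE x y : phi (x, y) = phi (inl x) + phi (inr y).
  by rewrite -linearD; congr (phi _); congr pair; rewrite /= ?addr0 ?add0r.
have dE l (x : X (l + 1)) (y : Y l) : diff (cone f) l (l + 1) (x, y) =
    (- diff X (l + 1) (l + 1 + 1) x, f (l + 1) x + diff Y l (l + 1) y).
  by rewrite cone_diff_comp // transport_id.
have [y|psi2 psi2P] := HY i (i + 1) (i + 1 + 1) erefl erefl (phi \o inr).
  by have := phid (0, y); rewrite dE !linear0 add0r.
have [x|psi1 psi1P] := HX (i + 1) (i + 1 + 1) (i + 1 + 1 + 1) erefl erefl
    ((phi \o inl) \- (psi2 \o f (i + 1 + 1))).
  have := phid (x, 0); rewrite dE linear0 addr0 phiE /= cmap_diff -psi2P /=.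
  by rewrite linearN linearN => /eqP; rewrite addrC subr_eq0 => /eqP->; rewrite subrr.
exists (copair_map (\- psi1) psi2) => -[x y].
rewrite dE -[RHS]/(- psi1 (- diff X _ _ x) + psi2 (f _ x + diff Y _ _ y)).
by rewrite linearN opprK -psi1P /= linearD -psi2P /= phiE addrA subrK.
Qed.

Lemma Hom_exact_dsum X Y : Hom_exact X -> Hom_exact Y -> Hom_exact (dsum X Y).
Proof.
move=> HX HY i j k ij jk phi phid.
pose inl : {linear X j -> dsum X Y j} := pair_map idfun \0.
pose inr : {linear Y j -> dsum X Y j} := pair_map \0 idfun.
have [x|p pP] := HX i j k ij jk (phi \o inl).
  by have := phid (x, 0); rewrite /= /dsum_diff_fun /= linear0.
have [y|q qP] := HY i j k ij jk (phi \o inr).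
  by have := phid (0, y); rewrite /= /dsum_diff_fun /= linear0.
exists (copair_map p q) => -[x y].
rewrite -[RHS]/(p (diff X j k x) + q (diff Y j k y)) -pP -qP /= -linearD.
by congr (phi _); congr pair; rewrite /= ?addr0 ?add0r.
Qed.

Lemma Hom_exact_summand X Y : Hom_exact (dsum X Y) -> Hom_exact X.
Proof.
move=> HXY i j k ij jk phi phid.
have [[x y]|psi psiP] := HXY i j k ij jk (phi \o fst : {linear dsum X Y j -> M}).
  exact: phid.
exists (psi \o (pair_map idfun \0 : {linear X k -> dsum X Y k})) => x.
have := psiP (x, 0); rewrite /= => ->; congr (psi _).
by congr pair; rewrite /= linear0.
Qed.

Lemma Hom_exact_zero X : (forall i, is_zero (X i)) -> Hom_exact X.
Proof. by move=> X0 i j k _ _ phi _; exists \0 => x; rewrite (X0 j x) linear0. Qed.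

Lemma stalk_zero_is_zero i : is_zero (stalk (zero_module A) i).
Proof. by rewrite /= /stalk_term; case: ifP => _; apply: zero_module_is_zero. Qed.

Lemma Hom_exact_triangulated :
  triangulated_subcategory (fun X => Kb_proj X /\ Hom_exact X).
Proof.
split.
- by move=> X [].
- by move=> X Y KY XY [_ HX]; split=> //; apply: Hom_exact_htpy HX.
- have z := @zero_module_is_zero A; split; last exact/Hom_exact_zero/stalk_zero_is_zero.
  by apply: stalk_Kb_proj; [apply: is_zero_fin_gen | apply: is_zero_projective].
- by move=> X n [KX HX]; split; [apply: Kb_proj_shift | apply: Hom_exact_shift].
- by move=> X Y f [KX HX] [KY HY]; split; [apply: Kb_proj_cone | apply: Hom_exact_cone].
Qed.

Lemma regular_projective : is_projective (A^o : lmodType A).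
Proof.
move=> V W g f gs; have [m gm] := gs (f 1); exists (scale_vector m) => a.
by rewrite /= /scale_vector linearZ /= gm -linearZ /= -[a *: _]/(a * 1) mulr1.
Qed.

Lemma regular_fin_gen : fin_gen (A^o : lmodType A).
Proof.
exists 1%N, (fun=> 1) => a; exists (fun=> a).
by rewrite big_ord1 -[a *: _]/(a * 1) mulr1.
Qed.

Lemma Hom_exact_stalk_is_zero : Hom_exact (stalk (A^o : lmodType A)) -> is_zero M.
Proof.
move=> H m; have [x|psi psiP] := H (-1) 0 1 erefl erefl (scale_vector m).
  by rewrite linear0.
by have := psiP 1; rewrite /= linear0 /scale_vector scale1r.
Qed.

(** The complexes with [Hom (-, M)] exact form a triangulated subcategory closed under summands;
    containing [T], it contains [A] in degree 0, where exactness forces [M = 0]. *)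
Lemma tilting_Hom_exact T : tilting_complex T -> Hom_exact T -> is_zero M.
Proof.
move=> [KT _ gen] HT; apply: Hom_exact_stalk_is_zero.
have [|//] := gen _ Hom_exact_triangulated _ (stalk (A^o : lmodType A))
  (stalk_Kb_proj regular_fin_gen regular_projective).
move=> X [KX [n [Y [_ XY]]]]; split=> //; apply: (@Hom_exact_summand X Y).
apply: (Hom_exact_htpy (homotopy_equivalent_sym XY)) => {X Y KX XY}.
elim: n => [|n IH] /=; first exact/Hom_exact_zero/stalk_zero_is_zero.
exact: Hom_exact_dsum.
Qed.

End HomExact.

Section TwoTermTilting.
Variables (A : pzRingType) (P : complex A).
Hypotheses (P2 : two_term P) (P_proj : forall i, fin_gen (P i) /\ is_projective (P i)).
Local Notation d := (diff P (-1) 0).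

(** [Xc] is exactness of [Hom (P, M)] at [P (-1)], and [Yc] at [P 0]. *)
Lemma tilting_cap M : tilting_complex P -> Xc P M -> Yc P M -> is_zero M.
Proof.
move=> TP /(XcP P2 P_proj)[_ XM] /(YcP P2 P_proj)[_ YM]; apply: (tilting_Hom_exact TP).
move=> i j k ij jk phi phid.
have [ej|j1] := eqVneq j (-1).
  have ek : k = 0 by rewrite jk ej.
  by clear ij jk; subst j k; have [psi psiP] := XM phi; exists psi.
have [ej|j0] := eqVneq j 0; last by exists \0 => x; rewrite (P2 j1 j0 x) linear0.
have ei : i = -1 by apply: (addIr 1); rewrite -ij ej.
by clear ij jk; subst i j; exists \0 => x; rewrite (YM phi).
Qed.

Lemma is_zero_Xc_Yc M : is_zero M -> Xc P M /\ Yc P M.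
Proof.
move=> M0; have fgM := is_zero_fin_gen M0; split.
  by apply/(XcP P2 P_proj); split=> // f; exists \0 => x; apply: M0.
by apply/(YcP P2 P_proj); split=> // f _ x; apply: M0.
Qed.

Lemma derived_Hom_shift1 : derived_Hom_eq0 P (shift P 1) <-> presilting P.
Proof.
rewrite (derived_Hom_two_term P2 P_proj).
have top (x : P 1) : x = 0 by exact: P2.
split=> [H a|H f1 f0 _ _].
  have [x|x|h0 [h1 [_ h1P]]] := H a \0; [exact/esym/top | exact: linear0 |].
  by exists h0, (\- h1) => x; rewrite h1P /= linearN addrC.
have [k [k' kP]] := H f1; exists k, (\- k'); split=> x.
  by rewrite [LHS]top; apply/esym/top.
by rewrite -[RHS]/(- d (- k' x) + k (d x) : P 0) linearN opprK [RHS]addrC; apply: kP.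
Qed.

Lemma derived_Hom_shiftN1 : derived_Hom_eq0 P (shift P (-1)) <->
  forall f : {linear P 0 -> P (-1)},
    (forall x, f (d x) = 0) -> (forall x, d (f x) = 0) -> forall x, f x = 0.
Proof.
rewrite (derived_Hom_two_term P2 P_proj).
have bot (x : P (-2)) : x = 0 by exact: P2.
split=> [H f fd df x|H f1 f0 f0d df0].
  have [y|y|h0 [_ [h0P _]]] := H \0 f.
  - by rewrite linear0; apply: fd.
  - by rewrite /= df oppr0.
  by rewrite h0P (bot (h0 x)) linear0.
exists \0, \0; split=> x; last by rewrite [LHS]bot; apply/esym/bot.
rewrite linear0; apply: H => y; first by rewrite f0d (bot (f1 y)) linear0.
by apply: oppr_inj; rewrite oppr0; apply: df0.
Qed.

Lemma derived_Hom_shift_far n : n != 0 -> n != 1 -> n != -1 ->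
  derived_Hom_eq0 P (shift P n).
Proof.
move=> n0 n1 nN1; apply/(derived_Hom_two_term P2 P_proj) => f1 f0 _ _.
exists \0, \0; split=> x; rewrite !linear0 ?addr0.
  by apply: P2; lia.
by apply: P2; lia.
Qed.

End TwoTermTilting.

Theorem proposition5p5
  (R : comPzRingType) (R_artin : artinian R)
  (A : pzRingType) (alg : algebra_over R A)
  (A_fg : fin_gen (restr A^o alg : lmodType R))
  (I : lmodType R) (e : {linear residue_mod R -> I})
  (I_env : injective_envelope e)
  (P : complex A)
  (P_proj : forall i : int, fin_gen (P i) /\ is_projective (P i))
  (P_conc : forall i : int, i != -1 -> i != 0 -> is_zero (P i)) :
  let DA : bimodule A := dual_bimod alg I in
  [<-> tilting_complex P;
       [/\ forall M, Xc P M /\ Yc P M <-> is_zero M,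
           Xc P (cohomology P 0)
         & Yc P (cohomology P (-1))];
       torsion_theory (@fin_gen A) (Xc P) (Yc P) /\ Yc P (cohomology P (-1));
       torsion_theory (@fin_gen A) (Xc P) (Yc P) /\
         stable_under (fun M => tensor DA M) (Xc P);
       torsion_theory (@fin_gen A) (Xc P) (Yc P) /\
         stable_under (fun M => bimod_hom DA M) (Yc P)].
Proof.
have P2 : two_term P := P_conc.
have fgH := cohomology1_fin_gen R_artin A_fg P2 P_proj.
move=> DA; tfae.
- move=> TP; have [_ HP _] := TP; split.
  + by move=> M; split=> [[]|/(is_zero_Xc_Yc P2 P_proj)//]; apply: tilting_cap.
  + by apply/(presiltingP P2 P_proj)/(derived_Hom_shift1 P2 P_proj)/HP.
  + by apply/(Yc_cohomology1P P2 P_proj fgH)/(derived_Hom_shiftN1 P2 P_proj)/HP.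
- move=> [cap /(presiltingP P2 P_proj) silt YH]; split=> //.
  exact: (torsion_theory_of_presilting R_artin A_fg P2 P_proj).
- by move=> [XY YH]; split=> //;
    exact: (torsion_tensor_stable R_artin A_fg I_env P2 P_proj XY YH).
- by move=> [XY XDA]; split=> //;
    exact: (tensor_stable_hom_stable R_artin A_fg I_env P2 P_proj XY XDA).
(* Stability gives [Hom (P, P[-1]) = 0]; the torsion theory alone gives [H^0 P] in [Xc P], that is
   [Hom (P, P[1]) = 0], and the zero intersection needed for generation. *)
- move=> [XY YDA].
  have /(Yc_cohomology1P P2 P_proj fgH)/(derived_Hom_shiftN1 P2 P_proj) HN1 :=
    hom_stable_Yc_cohomology1 R_artin A_fg I_env P2 P_proj XY YDA.
  have /(presiltingP P2 P_proj) silt := Xc_cohomology0 P2 P_proj XY.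
  split.
  + exact: Kb_proj_two_term.
  + move=> n n0; have [->|n1] := eqVneq n 1; first exact/(derived_Hom_shift1 P2 P_proj).
    by have [->//|nN1] := eqVneq n (-1); apply: derived_Hom_shift_far.
  + move=> S S_tri S_add; apply: (tri_of_stalks S_tri) => Q fgQ prQ.
    apply: (stalk_generated R_artin A_fg P2 P_proj silt _ S_tri S_add) => // M.
    by move=> /(torsion_cap XY).
Qed.
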